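(* Let $N\ge2$ be an integer, let $\Gamma\subset SU(2)$ be the dicyclic group of order $4N$, and let $T>0$. The Dirac operator on the dicyclic space $S^3/\Gamma=SU(2)/\Gamma$ equipped with the Berger metric corresponding to the parameter $T$ and the trivial spin structure has the following spectrum: (1) for every $n\in2\mathbb{N}+1$ and every $m\in\mathbb{Z}$ with $-n\le 2mN-1<-1$, the two eigenvalues $$-\frac T2 \pm\sqrt{(1+n)^2+4m^2N^2\left(\frac1{T^2}-1\right)},$$ each with multiplicity $n+1$; (2) for every $n\in\mathbb{N}$ with $n\equiv1 \pmod 4$, the eigenvalue $-\frac T2+n+1$ with multiplicity $n+1$; (3) for every $n\in\mathbb{N}$ with $n\equiv3 \pmod 4$, the eigenvalue $-\frac T2-(n+1)$ with multiplicity $n+1$; (4) for every $m\in\mathbb{N}$, the eigenvalue $-\frac T2-\frac{2mN}{T}$ with multiplicity $2mN$. Here the spectrum is understood as a multiset: the multiplicity of a real number $\lambda$ is the sum of the contributions of all parameter values listed that yield $\lambda$.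
   Context: $\mathbb{N}=\{0,1,2,\dots\}$ (a contribution with multiplicity $0$ contributes nothing). The dicyclic group $\Gamma\subset SU(2)$ of order $4N$ is generated by $\mathrm{diag}(e^{\pi i/N},e^{-\pi i/N})$ and $\begin{pmatrix}0&1\\-1&0\end{pmatrix}$. In $\mathfrak{su}(2)$ let $I=\begin{pmatrix} i&0\\0&-i\end{pmatrix}$, $J=\begin{pmatrix}0&1\\-1&0\end{pmatrix}$, $K=\begin{pmatrix}0&i\\i&0\end{pmatrix}$. For $T>0$ the Berger metric with parameter $T$ on $SU(2)\cong S^3$ is the left-invariant metric for which $X_1=\frac1T I,\ X_2=J,\ X_3=K$ is an orthonormal basis ($T=1$ is the round metric); it descends to $SU(2)/\Gamma=\{g\Gamma\}$. The trivial spin structure is the one corresponding to the lift of the isotropy representation $\Gamma\to SO(3)$ given by the inclusion $\iota:\Gamma\to SU(2)\cong\mathrm{Spin}(3)$, i.e. the principal bundle $SU(2)\times_\iota \mathrm{Spin}(3)$. Concretely, spinor fields are the functions $\psi:SU(2)\to\mathbb{C}^2$ with $\psi(g\gamma)=\gamma^{-1}\psi(g)$ for all $\gamma\in\Gamma$, and the Dirac operator is $$D\psi = I\,(X_1\psi)+J\,(X_2\psi)+K\,(X_3\psi)-\left(\tfrac T2+\tfrac1T\right)\psi,$$ where $(X\psi)(g)=\frac{d}{dt}\big|_{t=0}\psi(g\exp(tX))$ and $I,J,K$ act as matrices on $\mathbb{C}^2$. *)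

(* Defs.v *)
From HB Require Import structures.
From mathcomp Require Import all_boot all_order all_algebra.
From mathcomp Require Import all_classical all_reals all_analysis.
From mathcomp Require Import complex ring.

Set Implicit Arguments.
Unset Strict Implicit.
Unset Printing Implicit Defensive.

Import Order.TTheory GRing.Theory Num.Theory numFieldNormedType.Exports.

Local Open Scope classical_set_scope.
Local Open Scope ring_scope.
Local Open Scope complex_scope.
Local Open Scope sesquilinear_scope.

(* The usual norm topology on R[i]; matrices over R[i] then inherit the
   structure of a normed module over R[i]. *)
HB.instance Definition _ (R : realType) := NormedModule.copy R[i] R[i]^o.

Definition mx2 (A : Type) (a b c d : A) : 'M[A]_2 :=
  \matrix_(i, j) if i == 0 then (if j == 0 then a else b)
                 else (if j == 0 then c else d).

Section SU2.
Context {R : realType}.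
Local Notation C := R[i].

Definition is_SU2 (g : 'M[C]_2) : bool := (g \is unitarymx) && (\det g == 1).

Record SU2 := MkSU2 { SU2val :> 'M[C]_2; SU2P : is_SU2 SU2val }.

HB.instance Definition _ := [isSub for SU2val].
HB.instance Definition _ := [Choice of SU2 by <:].

Lemma is_SU2_1 : is_SU2 1%:M.
Proof.
rewrite /is_SU2 det1 eqxx andbT; apply/unitarymxP.
by rewrite trmx1 map_mx1 mulmx1.
Qed.

Lemma is_SU2_mul (g h : SU2) : is_SU2 (SU2val g *m SU2val h).
Proof.
have [/andP[ug /eqP dg] /andP[uh /eqP dh]] := (SU2P g, SU2P h).
by rewrite /is_SU2 mul_unitarymx //= det_mulmx dg dh mulr1.
Qed.

Lemma is_SU2_inv (g : SU2) : is_SU2 ((SU2val g) ^t*).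
Proof.
have /andP[ug /eqP dg] := SU2P g.
by rewrite /is_SU2 trmxC_unitary ug /= det_map_mx det_tr dg rmorph1.
Qed.

Let one := MkSU2 is_SU2_1.
Let mul g h := MkSU2 (is_SU2_mul g h).
Let inv g := MkSU2 (is_SU2_inv g).

Lemma SU2_mulA : associative mul.
Proof. by move=> x y z; apply: val_inj; rewrite /= mulmxA. Qed.
Lemma SU2_mul1 : left_id one mul.
Proof. by move=> x; apply: val_inj; rewrite /= mul1mx. Qed.
Lemma SU2_1mul : right_id one mul.
Proof. by move=> x; apply: val_inj; rewrite /= mulmx1. Qed.
Lemma SU2_mulV : right_inverse one inv mul.
Proof. by move=> g; apply: val_inj; have /andP[/unitarymxP] := SU2P g. Qed.
Lemma SU2_mulVl : left_inverse one inv mul.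
Proof.
move=> g; apply: val_inj; have /andP[/unitarymxP ug _] := SU2P g.
exact: mulmx1C.
Qed.

HB.instance Definition _ := isGroup.Build SU2
  SU2_mulA SU2_mul1 SU2_1mul SU2_mulVl SU2_mulV.

HB.instance Definition _ := Topological.copy SU2 (initial_topology SU2val).

Definition su2 : set 'M[C]_2 := [set X | X ^t* = - X /\ \tr X = 0].

Definition expm (X : 'M[C]_2) : 'M[C]_2 :=
  limn (series (fun k => k`!%:R^-1 *: X ^+ k)).

Lemma cvg_real_complex (u : R^nat) (a : R) :
  u @ \oo --> a -> (u n)%:C @[n --> \oo] --> (a%:C : C).
Proof.
move=> /cvgrPdist_lt ua; apply/cvgrPdist_lt => e e0.
have e_real : e = (complex.Re e)%:C by case: e e0 => x y; rewrite ltcE /= => /andP[/eqP-> _].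
rewrite e_real ltcR in e0; rewrite e_real; near=> n.
rewrite -rmorphB /= normc_def /= expr0n addr0 sqrtr_sqr ltcR.
near: n; exact: ua.
Unshelve. all: end_near. Qed.

Lemma su2E (X : 'M[C]_2) : su2 X ->
  exists x y z : R, X = mx2 (x *i) (y +i* z) (- y +i* z) ((- x) *i).
Proof.
case=> /matrixP XX; rewrite /mxtrace !big_ord_recl big_ord0 addr0.
have -> : lift ord0 ord0 = 1 :> 'I_2 by apply: val_inj.
have := XX 0 0; have := XX 1 0; have := XX 1 1; rewrite !mxE.
case E00 : (X 0 0) => [a b]; case E01 : (X 0 1) => [c d].
case E10 : (X 1 0) => [c' d']; case E11 : (X 1 1) => [a' b'].
have conjE (u v : R) : Num.conj (u +i* v) = u -i* v by [].
rewrite !conjE => _ /eqP + /eqP + /eqP; rewrite !eq_complex /=.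
move=> /andP[/eqP h3 /eqP h4] /andP[/eqP h5 _] /andP[/eqP h7 /eqP h8].
exists b, c, d; apply/matrixP => i j.
have a0 : a = 0.
  have : a *+ 2 = 0 by rewrite mulr2n {1}h5 addNr.
  by move/eqP; rewrite mulrn_eq0 /= => /eqP.
rewrite !mxE; case: i => [[|[|//]] i2]; case: j => [[|[|//]] j2] /=.
- have -> : X (Ordinal i2) (Ordinal j2) = X 0 0 by congr (X _ _); apply: val_inj.
  by rewrite E00 a0.
- have -> : X (Ordinal i2) (Ordinal j2) = X 0 1 by congr (X _ _); apply: val_inj.
  by rewrite E01.
- have -> : X (Ordinal i2) (Ordinal j2) = X 1 0 by congr (X _ _); apply: val_inj.
  by rewrite E10; congr Complex; [rewrite h3 opprK|apply: oppr_inj; rewrite -h4].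
- have -> : X (Ordinal i2) (Ordinal j2) = X 1 1 by congr (X _ _); apply: val_inj.
  rewrite E11; move: h7 h8; rewrite a0 add0r => -> /eqP.
  by rewrite addrC addr_eq0 => /eqP ->.
Qed.

Lemma mx2_mul (A : pzRingType) (a b c d a' b' c' d' : A) :
  mx2 a b c d *m mx2 a' b' c' d' =
  mx2 (a * a' + b * c') (a * b' + b * d') (c * a' + d * c') (c * b' + d * d').
Proof.
apply/matrixP => i j; rewrite !mxE !big_ord_recl big_ord0 addr0 !mxE /=.
by case: i => [[|[|//]] i2]; case: j => [[|[|//]] j2].
Qed.

Lemma det_mx2 (A : comPzRingType) (a b c d : A) :
  \det (mx2 a b c d) = a * d - b * c.
Proof.
rewrite (expand_det_row _ ord0) !big_ord_recl big_ord0 /cofactor !det_mx11 !mxE /=.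
by rewrite expr0 expr1; ring.
Qed.

Lemma expm_closed (X : 'M[C]_2) (r : R) :
  X *m X = - (r ^+ 2)%:C%:M -> (r = 0 -> X = 0) ->
  expm X = (cos r)%:C%:M + (sin r / r)%:C *: X.
Proof.
move=> XX r0X; rewrite /expm.
have powE j : X ^+ j.*2 = ((- r ^+ 2) ^+ j)%:C%:M.
  elim: j => [|j IH]; first by rewrite expr0.
  rewrite doubleS exprSr exprSr IH -mulrA -[X * X]/(X *m X) XX (exprSr _ j).
  rewrite mulrN -[X in - X = _]/(_ *m _) -scalar_mxM -rmorphM /=.
  by rewrite mulrN rmorphN /= raddfN.
have termE k : k`!%:R^-1 *: X ^+ k =
    (cos_coeff r k)%:C *: 1%:M + (sin_coeff r k / r)%:C *: X.
  have facC : (k`!%:R^-1 : C) = (k`!%:R^-1)%:C by rewrite fmorphV rmorph_nat.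
  have pC j : (- r ^+ 2) ^+ j = (-1) ^+ j * r ^+ j.*2.
    by rewrite (exprNn (r ^+ 2)) -(exprM r 2 j) mul2n.
  rewrite facC /cos_coeff /sin_coeff /=.
  have [odd_k|even_k] := boolP (odd k); last first.
    rewrite /= !mul0r scale0r addr0 mul1r.
    have kE : k = k./2.*2 by rewrite -[LHS]odd_double_half (negbTE even_k).
    rewrite {2}kE powE pC -kE !scale_scalar_mx mulr1 -rmorphM /=.
    by rewrite mulrC -exprnP.
  have kE : k = k./2.*2.+1 by rewrite -[LHS]odd_double_half odd_k.
  rewrite /= !mul0r scale0r add0r mul1r.
  rewrite {2}kE exprSr powE pC -[X in _ *: X]/(_ *m _) mul_scalar_mx scalerA -rmorphM /=.
  have [/r0X->|r0] := eqVneq r 0; first by rewrite !scaler0.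
  congr (_%:C *: _).
  have -> : k.-1./2 = k./2 by rewrite kE /= doubleK uphalf_double.
  have -> : r ^+ k = r ^+ k./2.*2 * r by rewrite {1}kE exprSr.
  by field; rewrite r0 pnatr_eq0 -lt0n fact_gt0.
have serE : series (fun k => k`!%:R^-1 *: X ^+ k) =
    (fun n => (series (cos_coeff r) n)%:C *: 1%:M +
              (series (sin_coeff r) n / r)%:C *: X).
  apply/funext => n; rewrite /series /=; under eq_bigr do rewrite termE.
  rewrite big_split /= -!scaler_suml; congr (_ *: _ + _ *: _).
    by rewrite rmorph_sum.
  by rewrite mulr_suml rmorph_sum.
have cvgZA (u : R^nat) (a : R) (A : 'M[C]_2) : u @ \oo --> a ->
    (u n)%:C *: A @[n --> \oo] --> a%:C *: A.
  by move=> ua; apply: cvgZr_tmp; exact: cvg_real_complex.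
rewrite serE -[(cos r)%:C%:M]scalemx1; apply/cvg_lim; first exact: norm_hausdorff.
apply: (@cvgD _ 'M[C]_2).
  by apply: (cvgZA (series (cos_coeff r))); rewrite unlock; exact: is_cvg_series_cos_coeff.
apply: (cvgZA (fun n => series (sin_coeff r) n / r)); apply: cvgMr_tmp.
by rewrite unlock; exact: is_cvg_series_sin_coeff.
Qed.

Lemma expm_SU2 (X : 'M[C]_2) : su2 X -> is_SU2 (expm X).
Proof.
move=> /su2E [x [y [z XE]]].
pose r := Num.sqrt (x ^+ 2 + y ^+ 2 + z ^+ 2).
have r2 : r ^+ 2 = x ^+ 2 + y ^+ 2 + z ^+ 2 by rewrite sqr_sqrtr// !addr_ge0 ?sqr_ge0.
have XX : X *m X = - (r ^+ 2)%:C%:M.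
  rewrite XE mx2_mul r2; apply/matrixP => i j; rewrite !mxE.
  case: i => [[|[|//]] i2]; case: j => [[|[|//]] j2] /=; apply/eqP;
  rewrite eq_complex /= ?oppr0 ?addr0; apply/andP; split; apply/eqP; ring.
have r0X : r = 0 -> X = 0.
  move=> r0; move: r2; rewrite r0 expr0n /= => /esym/eqP.
  rewrite !paddr_eq0 ?addr_ge0 ?sqr_ge0// !sqrf_eq0 => /andP[/andP[/eqP x0 /eqP y0] /eqP z0].
  rewrite XE x0 y0 z0 !oppr0; apply/matrixP => i j; rewrite !mxE.
  by case: ifP => _; case: ifP.
rewrite (expm_closed XX r0X).
set c := cos r; set s := sin r / r.
have cs : c ^+ 2 + s ^+ 2 * (x ^+ 2 + y ^+ 2 + z ^+ 2) = 1.
  rewrite -r2 -exprMn /s; have [r0|r0] := eqVneq r 0.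
    by rewrite r0 mulr0 /c r0 cos0 expr0n addr0 expr1n.
  by rewrite divfK// cos2Dsin2.
have -> : c%:C%:M + s%:C *: X =
   mx2 (c +i* (s * x)) ((s * y) +i* (s * z)) ((- (s * y)) +i* (s * z)) (c +i* (- (s * x))).
  rewrite XE; apply/matrixP => i j; rewrite !mxE.
  case: i => [[|[|//]] i2]; case: j => [[|[|//]] j2] /=; apply/eqP;
  rewrite eq_complex /=; apply/andP; split; apply/eqP; ring.
have trE a b a' b' : (mx2 a b a' b') ^t* = mx2 a^* a'^* b^* b'^* :> 'M[C]_2.
  apply/matrixP => i j; rewrite !mxE.
  by case: i => [[|[|//]] i2]; case: j => [[|[|//]] j2].
rewrite /is_SU2; apply/andP; split.
  apply/unitarymxP; rewrite trE mx2_mul; apply/matrixP => i j; rewrite !mxE.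
  case: i => [[|[|//]] i2]; case: j => [[|[|//]] j2] /=; apply/eqP;
  rewrite eq_complex /= -?cs; apply/andP; split; apply/eqP; ring.
rewrite det_mx2 eq_complex /= -cs; apply/andP; split; apply/eqP; ring.
Qed.

Lemma su2Z (t : R) (X : 'M[C]_2) : su2 X -> su2 (t%:C *: X).
Proof.
move=> [Xs Xt]; split; last by rewrite mxtraceZ Xt mulr0.
rewrite linearZ /= map_mxZ /= Xs scalerN; congr (- (_ *: _)).
by apply/eqP; rewrite eq_complex /= oppr0 !eqxx.
Qed.

(* For X in su(2), expm X lies in SU(2) (expm_SU2), so that the default value
   of insubd is not used: see expSU2E. *)
Definition expSU2 (X : 'M[C]_2) : SU2 := insubd (1%g : SU2) (expm X).

Lemma expSU2E (X : 'M[C]_2) : su2 X -> expSU2 X = expm X :> 'M[C]_2.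
Proof. by move=> /expm_SU2 h; rewrite /expSU2 -[SU2val _]/(val _) insubdK. Qed.

End SU2.
Arguments SU2 R : clear implicits.
Arguments su2 R : clear implicits.

Section dirac_operator.
Context {R : realType}.
Local Notation C := R[i].
Local Notation spinor := (SU2 R -> 'cV[C]_2).
Implicit Types (psi : spinor) (X : 'M[C]_2).

Definition Imx : 'M[C]_2 := mx2 (1 *i) 0 0 ((- 1) *i).
Definition Jmx : 'M[C]_2 := mx2 0 1 (- 1) 0.
Definition Kmx : 'M[C]_2 := mx2 0 (1 *i) (1 *i) 0.

Lemma su2_Imx : su2 R Imx.
Proof.
split; last first.
  rewrite /mxtrace !big_ord_recl big_ord0 !mxE /=; apply/eqP.
  by rewrite eq_complex /= !addr0 subrr eqxx.
apply/matrixP => i j; rewrite !mxE; apply/eqP.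
by case: i => [[|[|//]] ?]; case: j => [[|[|//]] ?] /=;
  rewrite eq_complex /= ?oppr0 ?opprK !eqxx.
Qed.

Lemma su2_Jmx : su2 R Jmx.
Proof.
split; last by rewrite /mxtrace !big_ord_recl big_ord0 !mxE /= !addr0.
apply/matrixP => i j; rewrite !mxE; apply/eqP.
by case: i => [[|[|//]] ?]; case: j => [[|[|//]] ?] /=;
  rewrite eq_complex /= ?oppr0 ?opprK !eqxx.
Qed.

Lemma su2_Kmx : su2 R Kmx.
Proof.
split; last by rewrite /mxtrace !big_ord_recl big_ord0 !mxE /= !addr0.
apply/matrixP => i j; rewrite !mxE; apply/eqP.
by case: i => [[|[|//]] ?]; case: j => [[|[|//]] ?] /=;
  rewrite eq_complex /= ?oppr0 ?opprK !eqxx.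
Qed.

Definition diff_quot X psi (g : SU2 R) (h : R) : 'cV[C]_2 :=
  (h^-1)%:C *: (psi (g * expSU2 (h%:C *: X))%g - psi g).

Definition lie_derivable X psi : Prop :=
  forall g, cvg (diff_quot X psi g h @[h --> (0 : R)^']).

Definition lie_derive X psi : spinor :=
  fun g => lim (diff_quot X psi g h @[h --> (0 : R)^']).

(* The left-invariant vector fields span every tangent space of SU(2), hence
   psi is of class C^k iff its iterated derivatives along them, up to order k,
   exist and are continuous. *)
Fixpoint Ck (k : nat) psi : Prop :=
  if k is k'.+1 then
    continuous psi /\
    forall X, su2 R X -> lie_derivable X psi /\ Ck k' (lie_derive X psi)
  else continuous psi.

Definition smooth psi : Prop := forall k, Ck k psi.

Lemma is_SU2_mx2 (a b : C) :
  a * a^* + b * b^* = 1 -> is_SU2 (mx2 a b (- b^*) a^*).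
Proof.
move=> ab; rewrite /is_SU2; apply/andP; split; last first.
  by rewrite det_mx2 mulrN opprK ab.
apply/unitarymxP.
have trE u v u' v' : (mx2 u v u' v') ^t* = mx2 u^* u'^* v^* v'^* :> 'M[C]_2.
  apply/matrixP => i j; rewrite !mxE.
  by case: i => [[|[|//]] i2]; case: j => [[|[|//]] j2].
have conjE (x : C) : Num.conj x = x^*%C by [].
rewrite trE mx2_mul rmorphN /= !conjcK; apply/matrixP => i j; rewrite !mxE.
case: i => [[|[|//]] i2]; case: j => [[|[|//]] j2];
  rewrite /= ?mulr1n ?mulr0n -?ab ?conjE; ring.
Qed.

Definition dicyclic_a (N : nat) : 'M[C]_2 :=
  let z := cos (pi / N%:R) +i* sin (pi / N%:R) in mx2 z 0 0 z^*.

Lemma dicyclic_a_SU2 N : is_SU2 (dicyclic_a N).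
Proof.
rewrite /dicyclic_a; move: (pi / N%:R) => x; set z := _ +i* _.
have -> : mx2 z 0 0 z^* = mx2 z 0 (- 0^*) z^* by rewrite rmorph0 oppr0.
apply: is_SU2_mx2; apply/eqP; rewrite mul0r addr0 eq_complex /= -(cos2Dsin2 x).
by apply/andP; split; apply/eqP; ring.
Qed.

Lemma Jmx_SU2 : is_SU2 Jmx.
Proof.
have -> : Jmx = mx2 0 1 (- 1^*) 0^* by rewrite rmorph0 rmorph1.
by apply: is_SU2_mx2; rewrite mul0r add0r rmorph1 mulr1.
Qed.

Definition is_subgroup (H : set (SU2 R)) : Prop :=
  [/\ H 1%g, (forall g h, H g -> H h -> H (g * h)%g)
    & (forall g, H g -> H (g^-1)%g)].

Definition dicyclic (N : nat) : set (SU2 R) :=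
  smallest is_subgroup
    [set MkSU2 (dicyclic_a_SU2 N); MkSU2 Jmx_SU2].

Definition spinor_field (N : nat) psi : Prop :=
  smooth psi /\
  forall g c : SU2 R, dicyclic N c ->
    psi (g * c)%g = SU2val (c^-1)%g *m psi g.

(* (T^-1)%:C *: Imx, Jmx, Kmx is the orthonormal frame of the Berger metric. *)
Definition dirac_op (T : R) psi : spinor := fun g =>
  Imx *m lie_derive ((T^-1)%:C *: Imx) psi g + Jmx *m lie_derive Jmx psi g
  + Kmx *m lie_derive Kmx psi g - (T / 2 + T^-1)%:C *: psi g.

Definition dirac_eigenspace (N : nat) (T : R) (lambda : C) : set spinor :=
  [set psi | spinor_field N psi /\ dirac_op T psi = (fun g => lambda *: psi g)].

Definition contrib (lambda : C) (mu : R) (k : nat) : \bar R :=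
  (if lambda == mu%:C then k else 0%N)%:R%:E.

End dirac_operator.

Definition has_dim (K : fieldType) (V : lmodType K) (E : set V) (d : nat) : Prop :=
  exists e : 'I_d -> V,
    [/\ forall i, E (e i),
        forall c : 'I_d -> K, \sum_(i < d) c i *: e i = 0 -> forall i, c i = 0
      & forall v, E v -> exists c : 'I_d -> K, v = \sum_(i < d) c i *: e i].

(* Main.v *)
(* By equivariance under J an eigenspinor is determined by its first component f, and the Dirac
   equation becomes a first-order equation relating f to its translate by J. Its square is a
   second-order equation in the left-invariant frame, to which a Bernstein-type maximum principle
   applies: |If| is bounded by a constant times |f|. Hence a discrete Fourier transform along the
   circle exp(tI), with sufficiently many sample points, already splits f into finitely many
   components of integral weight, and no integration theory is needed. Equivariance under the
   other generator leaves only the weights p - 1 with p = 2mN, m an integer.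

   The Dirac equation couples the weights p - 1 and -p - 1; going back and forth shows that on the
   component of weight p - 1 lowering after raising is the scalar mu^2 - p^2/T^2, where
   mu = lambda + T/2. Since weight chains terminate this scalar is (n+1)^2 - p^2 for some odd
   n >= |p - 1|, and the component is a combination of n + 1 matrix coefficients, because such a
   function is determined by finitely many derivatives at 1. So f is determined by its components
   with m >= 0. For m > 0, n >= p + 1 gives both square roots (1), while n = p - 1 gives only
   mu = -p/T (4), as mu = p/T would produce a nonzero function of weight -p - 1 killed by raising.
   For m = 0 the equation is a fixed-point condition in weight -1, where J composed with raising
   is (-1)^((n-1)/2) (n+1): this gives (2) and (3). *)

(* Smoothness is given only as existence and continuity of iterated derivatives along one-parameter
   subgroups. Linearity of X |-> Xf and the commutators XY - YX = 2Z must therefore be proved: the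
   former from an explicit inverse of (x, y, z) |-> exp(xI) exp(yJ) exp(zK), the latter from
   equality of mixed partials of f(g exp(sY) exp(tX)).

   A discrete Fourier component transforms by a character only under the one rotation exp(tau I),
   tau = 2 pi / (2L + 1), so a priori it mixes all weights congruent to r modulo 2L + 1. The bound
   on |If| excludes this: for small |r| Rolle's theorem forces If = irf, for large |r| the component
   would oscillate faster than the bound permits and is 0. The threshold depends on the equation
   only, so one L serves the whole eigenspace.

   Chains terminate because J^2 + K^2 acts on their far members by a scalar with positive real part,
   impossible for a nonzero function at a maximum of its modulus. For the dimension count, explicit
   eigenfunctions are paired with jets at 1; this pairing is diagonal and the jets separate the
   eigenspace. *)
Require Import Defs.
From HB Require Import structures.
From mathcomp Require Import all_boot all_order all_algebra.
From mathcomp Require Import all_classical all_reals all_analysis.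
From mathcomp Require Import complex ring lra zify.

Set Implicit Arguments.
Unset Strict Implicit.
Unset Printing Implicit Defensive.

Import Order.TTheory GRing.Theory Num.Theory numFieldNormedType.Exports.

Local Open Scope classical_set_scope.
Local Open Scope ring_scope.
Local Open Scope complex_scope.

(** * Quaternion coordinates on SU(2) *)

Section quaternion.
Context {R : realType}.
Local Notation C := R[i].
Local Notation G := (SU2 R).

Definition quat (w x y z : R) : 'M[C]_2 :=
  mx2 (w +i* x) (y +i* z) (- y +i* z) (w -i* x).

Lemma quat_mul (w x y z w' x' y' z' : R) :
  quat w x y z *m quat w' x' y' z' =
  quat (w * w' - x * x' - y * y' - z * z') (w * x' + x * w' + y * z' - z * y')
       (w * y' + y * w' + z * x' - x * z') (w * z' + z * w' + x * y' - y * x').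
Proof.
rewrite /quat mx2_mul; congr mx2; apply/eqP; rewrite eq_complex /=;
  apply/andP; split; apply/eqP; ring.
Qed.

Lemma quat_SU2 (w x y z : R) :
  w ^+ 2 + x ^+ 2 + y ^+ 2 + z ^+ 2 = 1 -> is_SU2 (quat w x y z).
Proof.
move=> n1.
have -> : quat w x y z = mx2 (w +i* x) (y +i* z) (- (y +i* z)^*) (w +i* x)^*.
  by congr mx2; apply/eqP; rewrite eq_complex /= ?opprK !eqxx.
apply: is_SU2_mx2; apply/eqP; rewrite eq_complex /= -n1.
by apply/andP; split; apply/eqP; ring.
Qed.

(** A default value unless (w, x, y, z) has norm 1; then [qmkE] applies. *)
Definition qmk (w x y z : R) : G := insubd (1%g : G) (quat w x y z).

Lemma qmkE (w x y z : R) : w ^+ 2 + x ^+ 2 + y ^+ 2 + z ^+ 2 = 1 ->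
  SU2val (qmk w x y z) = quat w x y z.
Proof. by move=> /quat_SU2 h; rewrite /qmk -[SU2val _]/(val _) insubdK. Qed.

(** Locked, so that simplification and unification do not unfold a coordinate into a matrix
    entry. *)
Definition qw : G -> R := locked (fun g => complex.Re (SU2val g 0 0)).
Definition qx : G -> R := locked (fun g => complex.Im (SU2val g 0 0)).
Definition qy : G -> R := locked (fun g => complex.Re (SU2val g 0 1)).
Definition qz : G -> R := locked (fun g => complex.Im (SU2val g 0 1)).

Lemma mx2_eta (A : Type) (M : 'M[A]_2) : M = mx2 (M 0 0) (M 0 1) (M 1 0) (M 1 1).
Proof.
apply/matrixP => i j; rewrite !mxE.
by case: i => [[|[|//]] i2]; case: j => [[|[|//]] j2] /=; congr (M _ _); apply: val_inj.
Qed.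

Lemma mx2_inj (A : Type) (a b c d a' b' c' d' : A) :
  mx2 a b c d = mx2 a' b' c' d' -> [/\ a = a', b = b', c = c' & d = d'].
Proof.
move=> /matrixP e; have := (e 0 0, e 0 1, e 1 0, e 1 1); rewrite !mxE /=.
by case=> [[[-> ->] ->] ->].
Qed.

(** Unitarity and determinant 1 give the second row from the first: multiplying d by |a|^2 + |b|^2 =
    1 and using orthogonality of the rows and ad - bc = 1 leaves the conjugate of a; likewise c is
    minus the conjugate of b. *)
Lemma SU2_quat (g : G) : SU2val g = quat (qw g) (qx g) (qy g) (qz g).
Proof.
have /andP[/unitarymxP ug /eqP dg] := SU2P g.
move: ug dg; rewrite /qw /qx /qy /qz -!lock.
move: (SU2val g) => M; rewrite (mx2_eta M); move: (M 0 0) (M 0 1) (M 1 0) (M 1 1).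
move=> a b c d; rewrite det_mx2.
have -> : map_mx Num.conj (mx2 a b c d)^T = mx2 a^* c^* b^* d^* :> 'M[C]_2.
  apply/matrixP => i j; rewrite !mxE.
  by case: i => [[|[|//]] i2]; case: j => [[|[|//]] j2].
have -> : 1%:M = mx2 1 0 0 1 :> 'M[C]_2.
  apply/matrixP => i j; rewrite !mxE.
  by case: i => [[|[|//]] i2]; case: j => [[|[|//]] j2].
rewrite mx2_mul => ug d1; have [e1 e2 e3 e4] := mx2_inj ug.
have dE : d = a^*%C.
  transitivity (d * (a * a^*%C + b * b^*%C)); first by rewrite e1 mulr1.
  transitivity (a^*%C * (a * d - b * c) + b * (c * a^*%C + d * b^*%C)); first by ring.
  by rewrite d1 e3; ring.
have cE : c = - b^*%C.
  transitivity (c * (a * a^*%C + b * b^*%C)); first by rewrite e1 mulr1.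
  transitivity (a * (c * a^*%C + d * b^*%C) - b^*%C * (a * d - b * c)); first by ring.
  by rewrite d1 e3; ring.
rewrite /quat !mxE /= dE cE; clear; case: a b => [w x] [y z] /=.
by congr mx2; apply/eqP; rewrite eq_complex /= ?opprK !eqxx.
Qed.

Lemma quat_inj (w x y z w' x' y' z' : R) : quat w x y z = quat w' x' y' z' ->
  [/\ w = w', x = x', y = y' & z = z'].
Proof. by move=> e; have [[-> ->] [-> ->] _ _] := mx2_inj e. Qed.

Lemma qnorm (g : G) : qw g ^+ 2 + qx g ^+ 2 + qy g ^+ 2 + qz g ^+ 2 = 1.
Proof.
have /andP[_ /eqP] := SU2P g; rewrite SU2_quat det_mx2 => /eqP.
by rewrite eq_complex /= => /andP[/eqP <- _]; ring.
Qed.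

Lemma SU2_ext (g h : G) :
  qw g = qw h -> qx g = qx h -> qy g = qy h -> qz g = qz h -> g = h.
Proof. by move=> e1 e2 e3 e4; apply: val_inj; rewrite /= !SU2_quat e1 e2 e3 e4. Qed.

Lemma q_quat (g : G) (w x y z : R) : SU2val g = quat w x y z ->
  (qw g = w) * (qx g = x) * (qy g = y) * (qz g = z).
Proof. by rewrite SU2_quat => e; have [-> -> -> ->] := quat_inj e. Qed.

Lemma qM (g h : G) :
  (qw (g * h)%g = qw g * qw h - qx g * qx h - qy g * qy h - qz g * qz h) *
  (qx (g * h)%g = qw g * qx h + qx g * qw h + qy g * qz h - qz g * qy h) *
  (qy (g * h)%g = qw g * qy h + qy g * qw h + qz g * qx h - qx g * qz h) *
  (qz (g * h)%g = qw g * qz h + qz g * qw h + qx g * qy h - qy g * qx h).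
Proof. by apply: q_quat; rewrite -quat_mul -!SU2_quat. Qed.

Lemma q1 : (qw (1%g : G) = 1) * (qx (1%g : G) = 0) * (qy (1%g : G) = 0) * (qz (1%g : G) = 0).
Proof.
apply: q_quat; apply/matrixP => i j; rewrite !mxE.
by case: i => [[|[|//]] i2]; case: j => [[|[|//]] j2] //=; apply/eqP;
   rewrite eq_complex /= ?oppr0 ?eqxx.
Qed.

Lemma qV (g : G) :
  (qw (g^-1)%g = qw g) * (qx (g^-1)%g = - qx g) *
  (qy (g^-1)%g = - qy g) * (qz (g^-1)%g = - qz g).
Proof.
have n1 : qw g ^+ 2 + (- qx g) ^+ 2 + (- qy g) ^+ 2 + (- qz g) ^+ 2 = 1.
  by rewrite !sqrrN qnorm.
suff -> : (g^-1)%g = qmk (qw g) (- qx g) (- qy g) (- qz g).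
  by apply: q_quat; rewrite qmkE.
apply: (mulgI g); rewrite mulgV.
have E := q_quat (qmkE n1); have n := qnorm g.
by apply: SU2_ext; rewrite qM !E q1 -?n; ring.
Qed.

Definition su2v (x y z : R) : 'M[C]_2 := quat 0 x y z.

Lemma su2_su2v (x y z : R) : su2 R (su2v x y z).
Proof.
split; last first.
  rewrite /mxtrace !big_ord_recl big_ord0 !mxE /=; apply/eqP.
  by rewrite eq_complex /= !addr0 subrr eqxx.
apply/matrixP => i j; rewrite !mxE; apply/eqP.
by case: i => [[|[|//]] ?]; case: j => [[|[|//]] ?] /=;
  rewrite eq_complex /= ?oppr0 ?opprK !eqxx.
Qed.

Lemma su2vE (X : 'M[C]_2) : su2 R X -> exists x y z, X = su2v x y z.
Proof.
move=> /su2E[x [y [z ->]]]; exists x, y, z; congr mx2.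
Qed.

Lemma quat_scale (a w x y z : R) :
  a%:C *: quat w x y z = quat (a * w) (a * x) (a * y) (a * z).
Proof.
apply/matrixP => i j; rewrite !mxE; apply/eqP.
by case: i => [[|[|//]] ?]; case: j => [[|[|//]] ?] /=;
  rewrite eq_complex /=; apply/andP; split; apply/eqP; ring.
Qed.

Lemma quat_add (w x y z w' x' y' z' : R) :
  quat w x y z + quat w' x' y' z' = quat (w + w') (x + x') (y + y') (z + z').
Proof.
apply/matrixP => i j; rewrite !mxE; apply/eqP.
by case: i => [[|[|//]] ?]; case: j => [[|[|//]] ?] /=;
  rewrite eq_complex /=; apply/andP; split; apply/eqP; ring.
Qed.

Lemma quatr (w : R) : (w%:C)%:M = quat w 0 0 0.
Proof.
apply/matrixP => i j; rewrite !mxE; apply/eqP.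
by case: i => [[|[|//]] ?]; case: j => [[|[|//]] ?] /=;
  rewrite eq_complex /= ?oppr0 !eqxx.
Qed.

Lemma quat_opp (w x y z : R) : - quat w x y z = quat (- w) (- x) (- y) (- z).
Proof.
apply/matrixP => i j; rewrite !mxE; apply/eqP.
by case: i => [[|[|//]] ?]; case: j => [[|[|//]] ?] /=;
  rewrite eq_complex /= ?opprD !eqxx.
Qed.

Definition rexp : 'M[C]_2 -> R -> G := locked (fun X h => expSU2 (h%:C *: X)).

Lemma rexpE (X : 'M[C]_2) (h : R) : rexp X h = expSU2 (h%:C *: X).
Proof. by rewrite /rexp -lock. Qed.

(** A unit imaginary quaternion squares to -1, so Euler's formula holds. *)
Lemma rexp_unit (x y z h : R) : x ^+ 2 + y ^+ 2 + z ^+ 2 = 1 ->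
  SU2val (rexp (su2v x y z) h) = quat (cos h) (sin h * x) (sin h * y) (sin h * z).
Proof.
move=> n1; rewrite rexpE expSU2E; last exact/su2Z/su2_su2v.
rewrite (@expm_closed _ _ h); last 2 first.
- rewrite quatr quat_scale quat_mul quat_opp;
  by rewrite -[h ^+ 2]mulr1 -n1; congr quat; rewrite ?oppr0; ring.
- by move=> ->; rewrite scale0r.
rewrite quatr !quat_scale quat_add; have [->|h0] := eqVneq h 0.
  by rewrite sin0; congr quat; ring.
by congr quat; field.
Qed.

Lemma rexpZ (X : 'M[C]_2) (r h : R) : rexp (r%:C *: X) h = rexp X (h * r).
Proof. by rewrite !rexpE scalerA -rmorphM. Qed.

Lemma cvg_real_complexF {T : Type} (F : set_system T) {FF : Filter F} (u : T -> R) (a : R) :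
  u x @[x --> F] --> a -> (u x)%:C @[x --> F] --> (a%:C : C).
Proof.
move=> /cvgrPdist_lt ua; apply/cvgrPdist_lt => e e0.
have e_real : e = (complex.Re e)%:C by case: e e0 => x y; rewrite ltcE /= => /andP[/eqP-> _].
rewrite e_real ltcR in e0; rewrite e_real; near=> n.
rewrite -rmorphB /= normc_def /= expr0n addr0 sqrtr_sqr ltcR.
near: n; exact: ua.
Unshelve. all: end_near. Qed.

Lemma quat_lin (w x y z : R) : quat w x y z =
  w%:C *: quat 1 0 0 0 + x%:C *: quat 0 1 0 0 + y%:C *: quat 0 0 1 0 + z%:C *: quat 0 0 0 1.
Proof. by rewrite !quat_scale !quat_add; congr quat; ring. Qed.

Lemma cvg_SU2 {T : Type} (F : set_system T) {FF : Filter F} (f : T -> G) (g : G) :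
  qw (f x) @[x --> F] --> qw g -> qx (f x) @[x --> F] --> qx g ->
  qy (f x) @[x --> F] --> qy g -> qz (f x) @[x --> F] --> qz g ->
  f x @[x --> F] --> g.
Proof.
move=> cw cx cy cz.
have h : SU2val (f x) @[x --> F] --> SU2val g.
  under eq_fun do rewrite SU2_quat quat_lin; rewrite SU2_quat quat_lin.
  apply: cvgD; [apply: cvgD; [apply: cvgD|]|];
    by apply: cvgZr_tmp; exact: cvg_real_complexF.
move=> A /=; rewrite nbhsE /= => -[B [[D oD <-] Bg] BA].
have : nbhs (SU2val g) D by exact: open_nbhs_nbhs.
move=> /h hD; change (F (f @^-1` A)); apply: (@filterS _ F FF (fun x => D (SU2val (f x)))) hD => t; exact: BA.
Qed.

Lemma Re_le (z : C) : (`|complex.Re z|)%:C <= `|z|.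
Proof.
case: z => a b; rewrite normc_def /= lecR -sqrtr_sqr ler_sqrt ?addr_ge0 ?sqr_ge0//.
by rewrite lerDl sqr_ge0.
Qed.

Lemma Im_le (z : C) : (`|complex.Im z|)%:C <= `|z|.
Proof.
case: z => a b; rewrite normc_def /= lecR -sqrtr_sqr ler_sqrt ?addr_ge0 ?sqr_ge0//.
by rewrite lerDr sqr_ge0.
Qed.

Lemma cvg_ReIm {T : Type} (F : set_system T) {FF : Filter F} (f : T -> C) (z : C) :
  f x @[x --> F] --> z <->
  complex.Re (f x) @[x --> F] --> complex.Re z /\
  complex.Im (f x) @[x --> F] --> complex.Im z.
Proof.
split=> [/cvgrPdist_lt cf|[cr ci]].
  split; apply/cvgrPdist_lt => e e0;
  have e0C : (0 : C) < e%:C by [rewrite ltcR|].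
    near=> x; rewrite -ltcR -raddfB; apply: le_lt_trans (Re_le _) _.
    near: x; exact: cf.
  near=> x; rewrite -ltcR -raddfB; apply: le_lt_trans (Im_le _) _.
  near: x; exact: cf.
have E (w : C) : w = (complex.Re w)%:C + 'i%C * (complex.Im w)%:C.
  by case: w => a b; apply/eqP; rewrite eq_complex /=; apply/andP; split; apply/eqP; ring.
rewrite (E z); under eq_fun do rewrite (E (f _)).
apply: cvgD; first exact: cvg_real_complexF.
apply: cvgM; first exact: cvg_cst.
exact: cvg_real_complexF.
Unshelve. all: end_near. Qed.

Lemma SU2_continuous : continuous (@SU2val R : G -> 'M[C]_2).
Proof. exact: initial_continuous. Qed.

Lemma q_continuous :
  [/\ continuous qw, continuous qx, continuous qy & continuous qz].
Proof.
have h i j (g : G) : SU2val x i j @[x --> g] --> SU2val g i j.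
  apply: (@continuous_comp _ _ _ (@SU2val R : G -> 'M[C]_2) (fun M : 'M[C]_2 => M i j)).
    exact: SU2_continuous.
  exact: coord_continuous.
rewrite /qw /qx /qy /qz -!lock.
by split=> g; have [h1 h2] := (cvg_ReIm _ _).1 (h 0 0 g); have [h3 h4] := (cvg_ReIm _ _).1 (h 0 1 g).
Qed.

Lemma cvg_SU2P {T : Type} (F : set_system T) {FF : Filter F} (f : T -> G) (g : G) :
  f x @[x --> F] --> g <->
  [/\ qw (f x) @[x --> F] --> qw g, qx (f x) @[x --> F] --> qx g,
      qy (f x) @[x --> F] --> qy g & qz (f x) @[x --> F] --> qz g].
Proof.
split; last by case; exact: cvg_SU2.
have [cw cx cy cz] := q_continuous.
by move=> fg; split; apply: cvg_comp fg _; [exact: cw|exact: cx|exact: cy|exact: cz].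
Qed.

Lemma cvgMg {T : Type} (F : set_system T) {FF : Filter F} (f1 f2 : T -> G) (g1 g2 : G) :
  f1 x @[x --> F] --> g1 -> f2 x @[x --> F] --> g2 ->
  (f1 x * f2 x)%g @[x --> F] --> (g1 * g2)%g.
Proof.
move=> /cvg_SU2P[a1 a2 a3 a4] /cvg_SU2P[b1 b2 b3 b4].
have M (u v : T -> R) (x y : R) : u t @[t --> F] --> x -> v t @[t --> F] --> y ->
    (u t * v t) @[t --> F] --> x * y by exact: cvgM.
apply: cvg_SU2; rewrite qM; under eq_fun do rewrite qM.
- exact: (cvgB (cvgB (cvgB (M _ _ _ _ a1 b1) (M _ _ _ _ a2 b2)) (M _ _ _ _ a3 b3)) (M _ _ _ _ a4 b4)).
- exact: (cvgB (cvgD (cvgD (M _ _ _ _ a1 b2) (M _ _ _ _ a2 b1)) (M _ _ _ _ a3 b4)) (M _ _ _ _ a4 b3)).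
- exact: (cvgB (cvgD (cvgD (M _ _ _ _ a1 b3) (M _ _ _ _ a3 b1)) (M _ _ _ _ a4 b2)) (M _ _ _ _ a2 b4)).
- exact: (cvgB (cvgD (cvgD (M _ _ _ _ a1 b4) (M _ _ _ _ a4 b1)) (M _ _ _ _ a2 b3)) (M _ _ _ _ a3 b2)).
Qed.

Lemma mulg_continuous (c : G) : continuous (fun g : G => (g * c)%g).
Proof. by move=> g; apply: (@cvgMg _ (nbhs g) _ id (fun=> c)); [move=> A|exact: cvg_cst]. Qed.

Lemma su2v_polar (x y z : R) : exists r x' y' z',
  [/\ x = r * x', y = r * y', z = r * z' & x' ^+ 2 + y' ^+ 2 + z' ^+ 2 = 1].
Proof.
pose s := x ^+ 2 + y ^+ 2 + z ^+ 2.
have s0 : 0 <= s by rewrite !addr_ge0 ?sqr_ge0.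
have [s00|sn0] := eqVneq s 0.
  exists 0, 1, 0, 0; rewrite !mul0r; move/eqP: s00.
  rewrite /s !paddr_eq0 ?addr_ge0 ?sqr_ge0// !sqrf_eq0 => /andP[/andP[/eqP-> /eqP->] /eqP->].
  by split=> //; ring.
have r2 : Num.sqrt s ^+ 2 = s by rewrite sqr_sqrtr.
have r0 : Num.sqrt s != 0 by apply: contra_neq sn0 => h; rewrite -r2 h expr0n.
exists (Num.sqrt s), (x / Num.sqrt s), (y / Num.sqrt s), (z / Num.sqrt s).
split; [by field..|]; rewrite !exprMn -!mulrDl -/s exprVn r2 mulfV//.
Qed.

Lemma rexp_q (x y z h : R) : x ^+ 2 + y ^+ 2 + z ^+ 2 = 1 ->
  (qw (rexp (su2v x y z) h) = cos h) * (qx (rexp (su2v x y z) h) = sin h * x) *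
  (qy (rexp (su2v x y z) h) = sin h * y) * (qz (rexp (su2v x y z) h) = sin h * z).
Proof. by move=> n1; apply: q_quat; exact: rexp_unit. Qed.

Lemma su2v_scale (r x y z : R) : su2v (r * x) (r * y) (r * z) = r%:C *: su2v x y z.
Proof. by rewrite /su2v quat_scale mulr0. Qed.

Lemma rexpD (X : 'M[C]_2) (s t : R) : su2 R X -> rexp X (s + t) = (rexp X s * rexp X t)%g.
Proof.
move=> /su2vE[x [y [z ->]]]; have [r [x' [y' [z' [-> -> -> n1]]]]] := su2v_polar x y z.
rewrite su2v_scale !rexpZ mulrDl; move: (s * r) (t * r) => {}s {}t.
have E u := rexp_q u n1.
apply: SU2_ext; rewrite (qM (rexp _ s) (rexp _ t)) !E ?cosD ?sinD; last 3 first.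
- by ring.
- by ring.
- by ring.
transitivity (cos s * cos t - (sin s * sin t) * (x' ^+ 2 + y' ^+ 2 + z' ^+ 2)); last by ring.
by rewrite n1 mulr1.
Qed.

Lemma rexp0 (X : 'M[C]_2) : su2 R X -> rexp X 0 = 1%g.
Proof.
move=> sX; apply: (mulgI (rexp X 0)); rewrite mulg1 -rexpD ?addr0//.
Qed.

(** Y = c^-1 X c. It converts the derivative along X of g |-> f(g c) into a derivative of f along
    Y. *)
Lemma rexp_conj (c : G) (X : 'M[C]_2) : su2 R X ->
  exists2 Y, su2 R Y /\ SU2val c *m Y = X *m SU2val c &
    forall h, (rexp X h * c = c * rexp Y h)%g.
Proof.
move=> /su2vE[x [y [z ->]]]; have [r [x' [y' [z' [-> -> -> n1]]]]] := su2v_polar x y z.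
have nc := qnorm c; have cE := SU2_quat c.
move: (qw c) (qx c) (qy c) (qz c) nc cE => a b d e nc cE.
pose p := quat a (- b) (- d) (- e) *m su2v x' y' z' *m quat a b d e.
have [x2 [y2 [z2 pE]]] : exists x2 y2 z2, p = su2v x2 y2 z2.
  by rewrite /p /su2v !quat_mul; do 3 eexists; congr quat; ring.
have cp : quat a b d e *m su2v x2 y2 z2 = su2v x' y' z' *m quat a b d e.
  have -> : su2v x' y' z' = quat a b d e *m quat a (- b) (- d) (- e) *m su2v x' y' z'.
    rewrite quat_mul [X in _ = X *m _](_ : _ = 1%:M) ?mul1mx//.
    by rewrite -[1]/(1%:C) quatr -nc; congr quat; ring.
  by rewrite -pE /p !mulmxA.
(* The conjugate of a unit imaginary quaternion again squares to -1, so it has norm 1 and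
   [rexp_unit] applies to it. *)
have n2 : x2 ^+ 2 + y2 ^+ 2 + z2 ^+ 2 = 1.
  have : p *m p = quat (- 1) 0 0 0.
    rewrite /p -!mulmxA [quat a b d e *m (_ *m _)]mulmxA.
    rewrite [quat a b d e *m quat _ _ _ _](_ : _ = 1%:M); last first.
      by rewrite quat_mul -[1]/(1%:C) quatr -nc; congr quat; ring.
    rewrite mul1mx [su2v _ _ _ *m (su2v _ _ _ *m _)]mulmxA.
    rewrite [su2v _ _ _ *m su2v _ _ _](_ : _ = quat (-1) 0 0 0); last first.
      by rewrite quat_mul -n1; congr quat; ring.
    by rewrite !quat_mul -[in RHS]nc; congr quat; ring.
  rewrite pE /su2v quat_mul => e2; have [e3 _ _ _] := quat_inj e2.
  by apply: oppr_inj; rewrite -e3; ring.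
exists (su2v (r * x2) (r * y2) (r * z2)).
  split; first exact: su2_su2v.
  by rewrite cE !su2v_scale -scalemxAl -scalemxAr cp.
move=> h; rewrite !su2v_scale !rexpZ; move: (h * r) => {}h.
apply: val_inj; rewrite /= -[LHS]/(_ *m _) -[RHS]/(_ *m _) cE !rexp_unit//.
have E u v w : quat (cos h) (sin h * u) (sin h * v) (sin h * w) =
    (cos h)%:C%:M + (sin h)%:C *: su2v u v w.
  by rewrite quatr /su2v quat_scale quat_add; congr quat; ring.
by rewrite !E mulmxDl mulmxDr -scalemxAl -scalemxAr cp scalar_mxC.
Qed.

End quaternion.

(** * One-variable calculus *)

Section calculus.
Context {R : realType}.
Implicit Types (f g : R -> R) (x d df dg k : R).

(** These rules are stated for functions written out pointwise, so that the proof of a derivative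
    can be composed as a term following the formula; [is_derive_eq] then leaves an identity for
    [ring]. *)
Lemma dvD f g x df dg : is_derive x (1:R) f df -> is_derive x (1:R) g dg ->
  is_derive x (1:R) (fun h => f h + g h) (df + dg).
Proof. by move=> ? ?; exact: is_deriveD. Qed.

Lemma dvB f g x df dg : is_derive x (1:R) f df -> is_derive x (1:R) g dg ->
  is_derive x (1:R) (fun h => f h - g h) (df - dg).
Proof. by move=> ? ?; exact: is_deriveB. Qed.

Lemma dvM f g x df dg : is_derive x (1:R) f df -> is_derive x (1:R) g dg ->
  is_derive x (1:R) (fun h => f h * g h) (f x * dg + g x * df).
Proof. by move=> ? ?; exact: is_deriveM. Qed.

Lemma dvZ k f x df : is_derive x (1:R) f df ->
  is_derive x (1:R) (fun h => k * f h) (k * df).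
Proof. by move=> ?; exact: is_deriveZ. Qed.

Lemma dvN f x df : is_derive x (1:R) f df -> is_derive x (1:R) (fun h => - f h) (- df).
Proof. by move=> ?; exact: is_deriveN. Qed.

Lemma dvC k x : is_derive x (1:R) ((fun _ => k) : R -> R) (0:R).
Proof. exact: is_derive_cst. Qed.

Lemma dv_comp f g x df dg : is_derive (g x) (1:R) f df -> is_derive x (1:R) g dg ->
  is_derive x (1:R) (fun h => f (g h)) (df * dg).
Proof. by move=> ? ?; exact: is_derive1_comp. Qed.

Lemma dv_cvg f d x : is_derive x (1:R) f d ->
  h^-1 * (f (x + h) - f x) @[h --> 0^'] --> d.
Proof.
have -> : (fun h : R => h^-1 * (f (x + h) - f x)) =
    fun h => h^-1 *: ((f \o shift x) (h *: (1 : R)) - f x).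
  by apply/funext => h; rewrite /= scaler1 [h + x]addrC.
by move=> [df <-]; exact: df.
Qed.

Lemma cvg_dv f d x :
  h^-1 * (f (x + h) - f x) @[h --> 0^'] --> d -> is_derive x (1:R) f d.
Proof.
have -> : (fun h : R => h^-1 * (f (x + h) - f x)) =
    fun h => h^-1 *: ((f \o shift x) (h *: (1 : R)) - f x).
  by apply/funext => h; rewrite /= scaler1 [h + x]addrC.
move=> cd; apply: DeriveDef; first by apply/cvg_ex; exists d.
exact/cvg_lim.
Qed.

Lemma dvV f x df : f x != 0 -> is_derive x (1:R) f df ->
  is_derive x (1:R) (fun h => (f h)^-1) (- (f x) ^- 2 * df).
Proof.
by move=> f0 fx; exact: (is_deriveV f0 fx).
Qed.

Lemma dv_div f g x df dg d : g x != 0 -> is_derive x (1:R) f df ->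
  is_derive x (1:R) g dg -> d = (df * g x - f x * dg) / (g x) ^+ 2 ->
  is_derive x (1:R) (fun h => f h / g h) d.
Proof.
move=> g0 fx gx ->; apply: (is_derive_eq (dvM fx (dvV g0 gx))).
by field.
Qed.

Lemma dv_continuous f d x : is_derive x (1:R) f d -> f y @[y --> x] --> f x.
Proof. by move=> [df _]; apply/differentiable_continuous/derivable1_diffP. Qed.

(** Lets [ring] prove identities that depend on cos^2 + sin^2 = 1: the relation is inserted as a
    factor, after which both sides agree as polynomials. *)
Lemma cos2_sin2_id (t p q : R) : p = (cos t ^+ 2 + sin t ^+ 2) * q -> p = q.
Proof. by rewrite cos2Dsin2 mul1r. Qed.

(** Uniform in the sign of h, including h = 0; |c| <= |h| makes the intermediate points converge as
    h tends to 0. *)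
Lemma mvt_abs f (df : R -> R) : (forall x, is_derive x (1:R) f (df x)) -> forall h,
  exists2 c, `|c| <= `|h| & f h - f 0 = h * df c.
Proof.
move=> fdf; have fc a b : {within `[a, b], continuous f}.
  by apply: derivable_within_continuous => y _; have [] := fdf y.
move=> h; have [h0|h0|->] := ltgtP h 0.
- have [c] := MVT h0 (fun y _ => fdf y) (fc _ _).
  rewrite in_itv /= sub0r => /andP[c0 ch] e; exists c.
    by rewrite !ltr0_norm// lerN2 ltW.
  by rewrite -opprB e mulrN opprK mulrC.
- have [c] := MVT h0 (fun y _ => fdf y) (fc _ _).
  rewrite in_itv /= subr0 => /andP[c0 ch] ->; exists c; last exact: mulrC.
  by rewrite !gtr0_norm// ltW.
- by exists 0; rewrite // subrr mul0r.
Qed.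

End calculus.

(** * Left-invariant derivatives *)

Section lie_real.
Context {R : realType}.
Local Notation C := R[i].
Local Notation G := (SU2 R).
Implicit Types (u v : G -> R) (X Y : 'M[C]_2) (g c : G).

Definition is_lieR X u u' : Prop :=
  forall g, is_derive (0 : R) (1 : R) (fun h : R => u (g * rexp X h)%g) (u' g : R).

(** Homogeneity: g exp(hX) = g exp(tX) exp((h - t)X), so derivatives at parameter 0 for all base
    points give derivatives at every parameter. *)
Lemma lieR_at X u u' : su2 R X -> is_lieR X u u' ->
  forall g t, is_derive (t : R) (1 : R) (fun h : R => u (g * rexp X h)%g) (u' (g * rexp X t)%g : R).
Proof.
move=> sX du g t.
have E : (fun h => u (g * rexp X h)%g) = (fun h => u (g * rexp X t * rexp X (h - t))%g).
  by apply/funext => h; rewrite -mulgA -rexpD// addrC subrK.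
have D1 : is_derive t (1:R) (fun h => h - t) (1 - 0) := dvB (is_derive_id t (1:R)) (dvC t t).
have D2 : is_derive (t - t) (1:R) (fun h => u (g * rexp X t * rexp X h)%g) (u' (g * rexp X t)%g).
  by rewrite subrr; exact: du.
rewrite E; apply: (is_derive_eq (@dv_comp _ _ (fun h => h - t) _ _ _ D2 D1)).
by rewrite subr0 mulr1.
Qed.

Lemma mvt_lieR X u u' : su2 R X -> is_lieR X u u' -> forall g h,
  exists2 c, `|c| <= `|h| & u (g * rexp X h)%g - u g = h * u' (g * rexp X c)%g.
Proof.
move=> sX du g h; have [c ch e] := mvt_abs (lieR_at sX du g) h.
by exists c => //; rewrite -e rexp0// mulg1.
Qed.

Lemma rexp_cvg X : su2 R X -> rexp X h @[h --> 0] --> (1%g : G).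
Proof.
move=> /su2vE[x [y [z ->]]]; have [r [x' [y' [z' [-> -> -> n1]]]]] := su2v_polar x y z.
rewrite su2v_scale; under eq_fun do rewrite rexpZ.
have hr : h * r @[h --> (0:R)] --> (0:R).
  by rewrite -[X in _ --> X](mul0r r); apply: cvgMr_tmp => A.
have c0 : cos (h * r) @[h --> (0:R)] --> (1 : R).
  by rewrite -cos0; apply: (cvg_comp _ _ hr); exact: continuous_cos.
have s0 : sin (h * r) @[h --> (0:R)] --> (0 : R).
  by rewrite -[X in _ --> X]sin0; apply: (cvg_comp _ _ hr); exact: continuous_sin.
have E t := rexp_q t n1.
have s1 a : sin (h * r) * a @[h --> (0:R)] --> (0 : R).
  by rewrite -[X in _ --> X](mul0r a); apply: cvgMr_tmp.
apply: cvg_SU2; rewrite q1; under eq_fun do rewrite E; [exact: c0|exact: s1..].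
Qed.

(** The increment splits into three, each along a single one-parameter subgroup; the mean value
    theorem turns each into a derivative at an intermediate point, and continuity at g gives the
    limit. *)
Lemma lieR_chain (X1 X2 X3 : 'M[C]_2) u u1 u2 u3 (x y z : R -> R) (x' y' z' : R) g :
  su2 R X1 -> su2 R X2 -> su2 R X3 ->
  is_lieR X1 u u1 -> is_lieR X2 u u2 -> is_lieR X3 u u3 ->
  {for g, continuous u1} -> {for g, continuous u2} -> {for g, continuous u3} ->
  x 0 = 0 -> y 0 = 0 -> z 0 = 0 ->
  is_derive (0:R) (1:R) x x' -> is_derive (0:R) (1:R) y y' -> is_derive (0:R) (1:R) z z' ->
  is_derive (0:R) (1:R)
   (fun h => u (g * rexp X1 (x h) * rexp X2 (y h) * rexp X3 (z h))%g)
   (x' * u1 g + y' * u2 g + z' * u3 g).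
Proof.
move=> s1 s2 s3 d1 d2 d3 c1 c2 c3 x0 y0 z0 dx dy dz.
have m1 h := cid2 (mvt_lieR s1 d1 g (x h)).
have m2 h := cid2 (mvt_lieR s2 d2 (g * rexp X1 (x h))%g (y h)).
have m3 h := cid2 (mvt_lieR s3 d3 (g * rexp X1 (x h) * rexp X2 (y h))%g (z h)).
pose a h := projT1 (m1 h); pose b h := projT1 (m2 h); pose c h := projT1 (m3 h).
apply: cvg_dv.
have -> : (fun h : R => h^-1 * (u (g * rexp X1 (x (0 + h)%R) * rexp X2 (y (0 + h)%R) * rexp X3 (z (0 + h)%R))%g -
     u (g * rexp X1 (x 0) * rexp X2 (y 0) * rexp X3 (z 0))%g)) =
   (fun h => (h^-1 * (x (0 + h)%R - x 0)) * u1 (g * rexp X1 (a h))%g +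
             (h^-1 * (y (0 + h)%R - y 0)) * u2 (g * rexp X1 (x h) * rexp X2 (b h))%g +
             (h^-1 * (z (0 + h)%R - z 0)) * u3 (g * rexp X1 (x h) * rexp X2 (y h) * rexp X3 (c h))%g).
  apply/funext => h; rewrite !add0r x0 y0 z0 !subr0 !rexp0// !mulg1.
  rewrite /a /b /c; case: (m1 h) => /= a' _ e1; case: (m2 h) => /= b' _ e2.
  case: (m3 h) => /= c' _ e3; rewrite -!mulrA -e1 -e2 -e3; ring.
have sq (w p : R -> R) w' : w 0 = 0 -> is_derive (0:R) (1:R) w w' ->
    (forall h, `|p h| <= `|w h|) -> p h @[h --> 0^'] --> (0 : R).
  move=> w0 /dv_continuous cw pw; apply/cvgr0Pnorm_lt => e e0.
  have cw' : w h @[h --> 0^'] --> (0 : R) by rewrite w0 in cw; exact: cvg_within_filter.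
  near=> h; apply: le_lt_trans (pw h) _; near: h.
  by move/cvgr0Pnorm_lt: cw'; exact.
have ca : a h @[h --> 0^'] --> (0:R) by apply: (sq x) dx _ => // h; rewrite /a; case: (m1 h).
have cb : b h @[h --> 0^'] --> (0:R) by apply: (sq y) dy _ => // h; rewrite /b; case: (m2 h).
have cc : c h @[h --> 0^'] --> (0:R) by apply: (sq z) dz _ => // h; rewrite /c; case: (m3 h).
have cx : x h @[h --> 0^'] --> (0:R) by apply: (sq x) dx _.
have cy : y h @[h --> 0^'] --> (0:R) by apply: (sq y) dy _.
have ce X (p : R -> R) : su2 R X -> p h @[h --> 0^'] --> (0:R) -> rexp X (p h) @[h --> 0^'] --> (1%g : G).
  by move=> sX cp; apply: (cvg_comp _ _ cp); exact: rexp_cvg.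
have cg : g @[h --> (0:R)^'] --> g by exact: cvg_cst.
have g1 : (g * rexp X1 (a h))%g @[h --> 0^'] --> g.
  by rewrite -[g in _ --> g]mulg1; apply: cvgMg => //; exact: ce.
have g2 : (g * rexp X1 (x h) * rexp X2 (b h))%g @[h --> 0^'] --> g.
  rewrite -[g in _ --> g]mulg1 -[(g * 1)%g]mulg1; apply: cvgMg; last exact: ce.
  by apply: cvgMg => //; exact: ce.
have g3 : (g * rexp X1 (x h) * rexp X2 (y h) * rexp X3 (c h))%g @[h --> 0^'] --> g.
  rewrite -[g in _ --> g]mulg1 -[(g * 1)%g]mulg1 -[(g * 1 * 1)%g]mulg1; apply: cvgMg; last exact: ce.
  by apply: cvgMg; [apply: cvgMg => //|]; exact: ce.
apply: cvgD; [apply: cvgD|].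
- by apply: cvgM; [exact: dv_cvg|exact: (cvg_comp _ _ g1 c1)].
- by apply: cvgM; [exact: dv_cvg|exact: (cvg_comp _ _ g2 c2)].
- by apply: cvgM; [exact: dv_cvg|exact: (cvg_comp _ _ g3 c3)].
Unshelve. all: end_near. Qed.

Definition eI : 'M[C]_2 := su2v 1 0 0.
Definition eJ : 'M[C]_2 := su2v 0 1 0.
Definition eK : 'M[C]_2 := su2v 0 0 1.

Lemma n100 : (1:R) ^+ 2 + 0 ^+ 2 + 0 ^+ 2 = 1. Proof. by ring. Qed.
Lemma n010 : (0:R) ^+ 2 + 1 ^+ 2 + 0 ^+ 2 = 1. Proof. by ring. Qed.
Lemma n001 : (0:R) ^+ 2 + 0 ^+ 2 + 1 ^+ 2 = 1. Proof. by ring. Qed.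

Lemma rexpI_q h : (qw (rexp eI h) = cos h) * (qx (rexp eI h) = sin h) *
  (qy (rexp eI h) = 0) * (qz (rexp eI h) = 0).
Proof. by have E := rexp_q h n100; rewrite /eI !E mulr1 mulr0. Qed.

Lemma rexpJ_q h : (qw (rexp eJ h) = cos h) * (qx (rexp eJ h) = 0) *
  (qy (rexp eJ h) = sin h) * (qz (rexp eJ h) = 0).
Proof. by have E := rexp_q h n010; rewrite /eJ !E mulr1 mulr0. Qed.

Lemma rexpK_q h : (qw (rexp eK h) = cos h) * (qx (rexp eK h) = 0) *
  (qy (rexp eK h) = 0) * (qz (rexp eK h) = sin h).
Proof. by have E := rexp_q h n001; rewrite /eK !E mulr1 mulr0. Qed.

Lemma cos_atan_gt0 (t : R) : 0 < cos (atan t).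
Proof. by apply: cos_gt0_pihalf; rewrite atan_gtNpi2 atan_ltpi2. Qed.

Lemma sin_atan (t : R) : sin (atan t) = t * cos (atan t).
Proof. by rewrite -{2}[t]atanK /tan mulfVK// gt_eqF// cos_atan_gt0. Qed.

Lemma cos_atan2 (t : R) : cos (atan t) ^+ 2 = (1 + t ^+ 2)^-1.
Proof. by rewrite cos_atan exprVn sqr_sqrtr// addr_ge0 ?sqr_ge0. Qed.

(** exp(yJ) exp(zK) has coordinates (cos y cos z, sin y sin z, sin y cos z, cos y sin z), so wa = bc
    is the equation of its image in the sphere; w > 0 fixes the signs. *)
Lemma chartJK (w a b c : R) : 0 < w -> w * a = b * c ->
  w ^+ 2 + a ^+ 2 + b ^+ 2 + c ^+ 2 = 1 ->
  let y := atan (b / w) in let z := atan (c / w) in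
  [/\ cos y * cos z = w, sin y * sin z = a, sin y * cos z = b & cos y * sin z = c].
Proof.
move=> w0 wa n1 y z; have wn : w != 0 by rewrite gt_eqF.
have e1 : cos y * cos z = w.
  apply/eqP; rewrite -(@eqrXn2 _ 2)//; last 2 first.
  - by rewrite mulr_ge0// ltW// cos_atan_gt0.
  - exact: ltW.
  rewrite exprMn !cos_atan2.
  have -> : (1 + (b / w) ^+ 2) = (w ^+ 2 + b ^+ 2) / w ^+ 2 by field.
  have -> : (1 + (c / w) ^+ 2) = (w ^+ 2 + c ^+ 2) / w ^+ 2 by field.
  have wb : w ^+ 2 + b ^+ 2 != 0 by rewrite gt_eqF// ltr_wpDr ?sqr_ge0// exprn_gt0.
  have wc : w ^+ 2 + c ^+ 2 != 0 by rewrite gt_eqF// ltr_wpDr ?sqr_ge0// exprn_gt0.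
  have E : (w ^+ 2 + b ^+ 2) * (w ^+ 2 + c ^+ 2) = w ^+ 2.
    transitivity (w ^+ 2 * (w ^+ 2 + a ^+ 2 + b ^+ 2 + c ^+ 2) + ((b * c) ^+ 2 - (w * a) ^+ 2)).
      by ring.
    by rewrite n1 wa; ring.
  rewrite -invfM; apply/eqP; rewrite mulf_div E; field.
  by rewrite wn.
split=> //; rewrite !sin_atan -/y -/z.
- transitivity (b * c / w ^+ 2 * (cos y * cos z)); first by field.
  by rewrite e1 -wa; field.
- by rewrite -mulrA e1; field.
- by rewrite mulrCA e1; field.
Qed.

(* Explicit inverse, near 1, of the chart (x, y, z) |-> exp(xI) exp(yJ) exp(zK). *)
Lemma chartI (g : G) (w a b c : R) : qw g = w -> qx g = a -> qy g = b -> qz g = c ->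
  let Q := w * w - a * a + c * c - b * b in
  let x := atan (2 * (w * a - b * c) / Q) / 2 in
  let w1 := cos x * w + sin x * a in
  let y := atan ((cos x * b + sin x * c) / w1) in
  let z := atan ((cos x * c - sin x * b) / w1) in
  0 < Q -> 0 < w1 -> (rexp eI x * rexp eJ y * rexp eK z)%g = g.
Proof.
move=> gw ga gb gc Q x w1 y z Q0 w10; have := qnorm g; rewrite gw ga gb gc => n1.
have cs := cos2Dsin2 x.
(* tan(2x) = 2(wa - bc)/Q is exactly the condition under which exp(-xI) g satisfies the equation
   required by [chartJK]. *)
have tx : (cos x ^+ 2 - sin x ^+ 2) * (w * a - b * c) = cos x * sin x * Q.
  have c2 : cos (x + x) = cos x ^+ 2 - sin x ^+ 2 by rewrite cosD; ring.
  have s2 : sin (x + x) = 2 * (cos x * sin x) by rewrite sinD; ring.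
  have := sin_atan (2 * (w * a - b * c) / Q).
  have -> : atan (2 * (w * a - b * c) / Q) = x + x by rewrite /x -splitr.
  rewrite s2 c2 => e; have Qn : Q != 0 by rewrite gt_eqF.
  transitivity (2 * (cos x * sin x) * Q / 2); last by field.
  by rewrite e; field.
pose a1 := cos x * a - sin x * w.
have /= [||e1 e2 e3 e4] := @chartJK w1 a1 (cos x * b + sin x * c) (cos x * c - sin x * b) w10.
- have -> : w1 * a1 = (cos x ^+ 2 - sin x ^+ 2) * (w * a - b * c) - cos x * sin x * Q
     + (cos x * b + sin x * c) * (cos x * c - sin x * b) by rewrite /w1 /a1 /Q; ring.
  by rewrite tx subrr add0r.
- transitivity ((cos x ^+ 2 + sin x ^+ 2) * (w ^+ 2 + a ^+ 2 + b ^+ 2 + c ^+ 2)).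
    by rewrite /w1 /a1; ring.
  by rewrite cs n1 mulr1.
rewrite -mulgA; have q1 := qM (rexp eJ y) (rexp eK z).
rewrite !rexpJ_q !rexpK_q in q1; rewrite !(mulr0, mul0r, subr0, addr0, add0r) in q1.
rewrite -/y -/z in e1 e2 e3 e4; rewrite e1 e2 e3 e4 in q1.
by apply: SU2_ext; rewrite (qM (rexp eI x)) !q1 !rexpI_q ?gw ?ga ?gb ?gc; apply: (@cos2_sin2_id _ x); rewrite /w1 /a1; ring.
Qed.

Lemma su2_eI : su2 R eI. Proof. exact: su2_su2v. Qed.
Lemma su2_eJ : su2 R eJ. Proof. exact: su2_su2v. Qed.
Lemma su2_eK : su2 R eK. Proof. exact: su2_su2v. Qed.

(** Near h = 0 the curve exp(hX) is written in the chart as a product of exponentials of I, J and K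
    whose parameters have the components of X as derivatives at 0; then [lieR_chain] applies. *)
Lemma lieR_lin (x y z : R) u uI uJ uK : is_lieR eI u uI -> is_lieR eJ u uJ -> is_lieR eK u uK ->
  continuous uI -> continuous uJ -> continuous uK ->
  is_lieR (su2v x y z) u (fun g => x * uI g + y * uJ g + z * uK g).
Proof.
move=> dI dJ dK cI cJ cK g.
have [r [x' [y' [z' [-> -> -> n1]]]]] := su2v_polar x y z.
rewrite su2v_scale.
pose w h := cos (h * r); pose a h := sin (h * r) * x'.
pose b h := sin (h * r) * y'; pose c h := sin (h * r) * z'.
have dr : is_derive (0:R) (1:R) (fun h => h * r) (0 * 0 + r * 1).
  exact: (dvM (is_derive_id _ _) (dvC r 0)).
have dw : is_derive (0:R) (1:R) w 0.
  apply: (is_derive_eq (dv_comp (is_derive_cos _) dr)).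
  by rewrite mul0r sin0; ring.
have ds t : is_derive (0:R) (1:R) (fun h => sin (h * r) * t) (r * t).
  apply: (is_derive_eq (dvM (dv_comp (is_derive_sin _) dr) (dvC t 0))).
  by rewrite mul0r cos0 sin0; ring.
have w0 : w 0 = 1 by rewrite /w mul0r cos0.
have s0 t : sin (0 * r) * t = 0 by rewrite mul0r sin0 mul0r.
have da : is_derive (0:R) (1:R) a (r * x') by exact: ds.
have db : is_derive (0:R) (1:R) b (r * y') by exact: ds.
have dc : is_derive (0:R) (1:R) c (r * z') by exact: ds.
have a0 : a 0 = 0 by exact: s0.
have b0 : b 0 = 0 by exact: s0.
have c0 : c 0 = 0 by exact: s0.
have E t := rexp_q t n1.
have gw h : qw (rexp (su2v x' y' z') (h * r)) = w h by rewrite E.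
have ga h : qx (rexp (su2v x' y' z') (h * r)) = a h by rewrite E.
have gb h : qy (rexp (su2v x' y' z') (h * r)) = b h by rewrite E.
have gc h : qz (rexp (su2v x' y' z') (h * r)) = c h by rewrite E.
clearbody w a b c.
pose Q h := w h * w h - a h * a h + c h * c h - b h * b h.
pose P h := 2 * (w h * a h - b h * c h).
pose xi h := atan (P h / Q h) / 2.
pose w1 h := cos (xi h) * w h + sin (xi h) * a h.
pose b1 h := cos (xi h) * b h + sin (xi h) * c h.
pose c1 h := cos (xi h) * c h - sin (xi h) * b h.
have dQ : is_derive (0:R) (1:R) Q 0.
  apply: (is_derive_eq (dvB (dvD (dvB (dvM dw dw) (dvM da da)) (dvM dc dc)) (dvM db db))).
  by rewrite a0 b0 c0; ring.
have dP : is_derive (0:R) (1:R) P (2 * (r * x')).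
  apply: (is_derive_eq (dvZ 2 (dvB (dvM dw da) (dvM db dc)))).
  by rewrite w0 a0 b0 c0; ring.
have Q0 : Q 0 = 1 by rewrite /Q w0 a0 b0 c0; ring.
have P0 : P 0 = 0 by rewrite /P w0 a0 b0 c0; ring.
have dt : is_derive (0:R) (1:R) (fun h => P h / Q h) (2 * (r * x')).
  by apply: (dv_div _ dP dQ); rewrite Q0 ?oner_eq0// P0; field.
have dxi : is_derive (0:R) (1:R) xi (r * x').
  apply: (is_derive_eq (dvM (dv_comp (is_derive1_atan _) dt) (dvC 2^-1 0))).
  by rewrite P0 Q0 mul0r; field; rewrite -?natr1; lra.
have xi0 : xi 0 = 0 by rewrite /xi P0 mul0r atan0 mul0r.
have dcx := dv_comp (is_derive_cos _) dxi; have dsx := dv_comp (is_derive_sin _) dxi.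
have dw1 : is_derive (0:R) (1:R) w1 0.
  apply: (is_derive_eq (dvD (dvM dcx dw) (dvM dsx da))).
  by rewrite xi0 w0 a0 sin0 cos0; ring.
have db1 : is_derive (0:R) (1:R) b1 (r * y').
  apply: (is_derive_eq (dvD (dvM dcx db) (dvM dsx dc))).
  by rewrite xi0 b0 c0 sin0 cos0; ring.
have dc1 : is_derive (0:R) (1:R) c1 (r * z').
  apply: (is_derive_eq (dvB (dvM dcx dc) (dvM dsx db))).
  by rewrite xi0 b0 c0 sin0 cos0; ring.
have w10 : w1 0 = 1 by rewrite /w1 xi0 w0 a0 sin0 cos0; ring.
have b10 : b1 0 = 0 by rewrite /b1 b0 c0; ring.
have c10 : c1 0 = 0 by rewrite /c1 b0 c0; ring.
have at1 (f : R -> R) d : f 0 = 0 -> is_derive (0:R) (1:R) f d ->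
    is_derive (0:R) (1:R) (fun h => atan (f h / w1 h)) d /\ atan (f 0 / w1 0) = 0.
  move=> f0 df; split; last by rewrite f0 mul0r atan0.
  have dfw : is_derive (0:R) (1:R) (fun h => f h / w1 h) d.
    by apply: (dv_div _ df dw1); rewrite w10 ?oner_eq0// f0; field.
  by apply: (is_derive_eq (dv_comp (is_derive1_atan _) dfw)); rewrite f0 mul0r; field.
have [dy y0] := at1 _ _ b10 db1; have [dz z0] := at1 _ _ c10 dc1.
have := lieR_chain su2_eI su2_eJ su2_eK dI dJ dK (cI g) (cJ g) (cK g) xi0 y0 z0 dxi dy dz.
(* The chart formula requires [Q h] and [w1 h] to be positive, which is only known near h = 0. *)
apply: near_eq_is_derive.
have cQ : Q h @[h --> (0:R)] --> (1:R) by rewrite -Q0; exact: dv_continuous dQ.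
have cw : w1 h @[h --> (0:R)] --> (1:R) by rewrite -w10; exact: dv_continuous dw1.
near=> h; rewrite rexpZ -!mulgA; congr (u (g * _)%g); rewrite mulgA.
apply: (chartI (gw h) (ga h) (gb h) (gc h)).
  by near: h; apply: (cvgr_gt _ cQ); exact: ltr01.
by near: h; apply: (cvgr_gt _ cw); exact: ltr01.
Unshelve. all: end_near. Qed.

(** Both sides are limits of the same second difference of F over the square with corners (0, 0) and
    (h, h), divided by h^2. *)
Lemma schwarz (F Fs Ft Fst Fts : R -> R -> R) :
  (forall s t, is_derive s (1:R) (F^~ t) (Fs s t)) ->
  (forall s t, is_derive t (1:R) (F s) (Ft s t)) ->
  (forall s t, is_derive t (1:R) (Fs s) (Fst s t)) ->
  (forall s t, is_derive s (1:R) (Ft^~ t) (Fts s t)) ->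
  Fst p.1 p.2 @[p --> ((0, 0) : R * R)] --> Fst 0 0 ->
  Fts p.1 p.2 @[p --> ((0, 0) : R * R)] --> Fts 0 0 ->
  Fst 0 0 = Fts 0 0.
Proof.
move=> dFs dFt dFst dFts cst cts.
have mid h : exists s t s' t', [/\ [/\ `|s| <= `|h|, `|t| <= `|h|, `|s'| <= `|h| & `|t'| <= `|h|]
    & h * (h * Fst s t) = h * (h * Fts s' t')].
  have [s sh e1] := mvt_abs (fun s => dvB (dFs s h) (dFs s 0)) h.
  have [t th e2] := mvt_abs (dFst s) h.
  have [t' th' e3] := mvt_abs (fun t => dvB (dFt h t) (dFt 0 t)) h.
  have [s' sh' e4] := mvt_abs (dFts ^~ t') h.
  by exists s, t, s', t'; split=> //; rewrite -e2 -e1 -e4 -e3; ring.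
apply/eqP/negPn/negP => ne; pose e := `|Fst 0 0 - Fts 0 0| / 2.
have e0 : 0 < e by rewrite divr_gt0// normr_gt0 subr_eq0.
have key (H : R -> R -> R) : H p.1 p.2 @[p --> ((0, 0) : R * R)] --> H 0 0 ->
    \forall h \near (0:R)^', forall s t, `|s| <= `|h| -> `|t| <= `|h| -> `|H 0 0 - H s t| < e.
  move=> /cvgrPdist_lt /(_ _ e0) [[A B] /= [nA nB] AB].
  have /nbhs_ballP[a /= a0 Aa] := nA; have /nbhs_ballP[b /= b0 Bb] := nB.
  have : \forall h \near (0:R)^', `|h| < Num.min a b.
    by apply: dnbhs0_lt; rewrite lt_min a0 b0.
  apply: filterS => h; rewrite lt_min => /andP[ha hb] s t sh th.
  apply: (AB (s, t)); split=> /=.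
    by apply: Aa; rewrite /ball /= sub0r normrN (le_lt_trans sh).
  by apply: Bb; rewrite /ball /= sub0r normrN (le_lt_trans th).
have [h [h0 [k1 k2]]] := filter_ex (filterI (nbhs_dnbhs_neq (0 : R)) (filterI (key _ cst) (key _ cts))).
have [s [t [s' [t' [[a1 a2 a3 a4] E]]]]] := mid h.
have {}E : Fst s t = Fts s' t' by move: E => /(mulfI h0) /(mulfI h0).
have /= := ltrD (k1 s t a1 a2) (k2 s' t' a3 a4).
rewrite -splitr ltNge => /negP; apply.
rewrite (le_trans _ (ler_normB _ _))// E.
by have -> : Fst 0 0 - Fts s' t' - (Fts 0 0 - Fts s' t') = Fst 0 0 - Fts 0 0 by ring.
Qed.

Lemma rexp_conjE c X Y : su2 R X -> su2 R Y -> SU2val c *m Y = X *m SU2val c ->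
  forall h, (rexp X h * c = c * rexp Y h)%g.
Proof.
move=> sX sY e h; have [Y' [_ e'] ->] := rexp_conj c sX.
congr (c * rexp _ h)%g; rewrite -e in e'.
have uc : SU2val c \in unitmx.
  by have /andP[_ /eqP dc] := SU2P c; rewrite unitmxE dc unitr1.
by rewrite -[Y'](mulKmx uc) e' mulKmx.
Qed.

Lemma lieR_trans c X Y u u' : su2 R X -> su2 R Y -> SU2val c *m Y = X *m SU2val c ->
  is_lieR Y u u' -> is_lieR X (fun g => u (g * c)%g) (fun g => u' (g * c)%g).
Proof.
move=> sX sY e du g; have E : (fun h => u (g * rexp X h * c)%g) = (fun h => u (g * c * rexp Y h)%g).
  by apply/funext => h; rewrite -mulgA (rexp_conjE sX sY e) mulgA.
by rewrite E; exact: du.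
Qed.

(** Schwarz for F(s, t) = u(g exp(sY) exp(tX)). Moving exp(hY) past exp(tX) turns it into exp(h
    W(t)), W(t) = exp(-tX) Y exp(tX), whose derivative is cos(2t) Y - sin(2t) Z; differentiating
    sin(2t) at 0 produces the 2Z. *)
Lemma lieR_bracket X Y (W : R -> 'M[C]_2) u uX uY uZ uXX uXY uXZ uYX uZX :
  su2 R X -> su2 R Y ->
  (forall t, su2 R (W t) /\ SU2val (rexp X t) *m W t = Y *m SU2val (rexp X t)) ->
  (forall t, is_lieR (W t) u (fun g => cos (t + t) * uY g - sin (t + t) * uZ g)) ->
  (forall t, is_lieR (W t) uX (fun g => cos (t + t) * uYX g - sin (t + t) * uZX g)) ->
  is_lieR X u uX -> is_lieR X uX uXX -> is_lieR X uY uXY -> is_lieR X uZ uXZ ->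
  [/\ continuous uY, continuous uZ & continuous uXY] -> continuous uXZ ->
  continuous uYX -> continuous uZX ->
  forall g, uXY g - uYX g = 2 * uZ g.
Proof.
move=> sX sY W_ lu luX dX dXX dXY dXZ [cY cZ cXY] cXZ cYX cZX g.
pose m s t := (g * rexp Y s * rexp X t)%g.
pose F s t := u (m s t).
pose Fs s t := cos (t + t) * uY (m s t) - sin (t + t) * uZ (m s t).
pose Ft s t := uX (m s t).
pose Fst s t := (cos (t + t) * uXY (m s t) + uY (m s t) * (- sin (t + t) * (1 + 1)))
              - (sin (t + t) * uXZ (m s t) + uZ (m s t) * (cos (t + t) * (1 + 1))).
pose Fts s t := cos (t + t) * uYX (m s t) - sin (t + t) * uZX (m s t).
have m00 : m 0 0 = g by rewrite /m !rexp0// !mulg1.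
suff : Fst 0 0 = Fts 0 0.
  rewrite /Fst /Fts m00 addr0 cos0 sin0 !mul0r !mul1r => e.
  by rewrite -[uYX g]subr0 -e; ring.
have swap (v : G -> R) (v' : R -> G -> R) : (forall t, is_lieR (W t) v (v' t)) ->
    forall s t, is_derive s (1:R) (fun h => v (m h t)) (v' t (m s t)).
  move=> dv s t; have [sW eW] := W_ t.
  exact: (lieR_at sY (lieR_trans sY sW eW (dv t)) g s).
have dtt t : is_derive t (1:R) (fun h => h + h) (1 + 1) by exact: dvD.
have cm : m p.1 p.2 @[p --> ((0, 0) : R * R)] --> g.
  have cr X' (f : R * R -> R) : su2 R X' -> f p @[p --> ((0, 0) : R * R)] --> (0:R) ->
      rexp X' (f p) @[p --> ((0, 0) : R * R)] --> (1%g : G).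
    by move=> sX' cf; apply: (cvg_comp _ _ cf); exact: rexp_cvg.
  rewrite -[g in _ --> g]mulg1 -[(g * 1)%g]mulg1; apply: cvgMg; last first.
    by apply: cr => //; exact: cvg_snd.
  by apply: cvgMg; [exact: cvg_cst|apply: cr => //; exact: cvg_fst].
have ct : p.2 + p.2 @[p --> ((0, 0) : R * R)] --> (0 + 0 : R).
  by apply: cvgD; exact: cvg_snd.
have cc : cos (p.2 + p.2) @[p --> ((0, 0) : R * R)] --> (cos (0 + 0) : R).
  by apply: (cvg_comp _ _ ct); exact: continuous_cos.
have cs : sin (p.2 + p.2) @[p --> ((0, 0) : R * R)] --> (sin (0 + 0) : R).
  by apply: (cvg_comp _ _ ct); exact: continuous_sin.
have cv (v : G -> R) : continuous v -> v (m p.1 p.2) @[p --> ((0, 0) : R * R)] --> v (m 0 0).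
  by move=> c; rewrite m00; apply: (cvg_comp _ _ cm); exact: c.
have h1 s t : is_derive s (1:R) (F^~ t) (Fs s t) := swap u _ lu s t.
have h2 s t : is_derive t (1:R) (F s) (Ft s t) := lieR_at sX dX (g * rexp Y s)%g t.
have h3 s t : is_derive t (1:R) (Fs s) (Fst s t).
  exact: (dvB (dvM (dv_comp (is_derive_cos _) (dtt t)) (lieR_at sX dXY (g * rexp Y s)%g t))
    (dvM (dv_comp (is_derive_sin _) (dtt t)) (lieR_at sX dXZ (g * rexp Y s)%g t))).
have h4 s t : is_derive s (1:R) (Ft^~ t) (Fts s t) := swap uX _ luX s t.
have h5 : Fst p.1 p.2 @[p --> ((0, 0) : R * R)] --> Fst 0 0.
  have c2 : (1 + 1 : R) @[_ --> ((0, 0) : R * R)] --> (1 + 1 : R) by exact: cvg_cst.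
  exact: (cvgB (cvgD (cvgM cc (cv _ cXY)) (cvgM (cv _ cY) (cvgM (cvgN cs) c2)))
    (cvgD (cvgM cs (cv _ cXZ)) (cvgM (cv _ cZ) (cvgM cc c2)))).
have h6 : Fts p.1 p.2 @[p --> ((0, 0) : R * R)] --> Fts 0 0.
  exact: (cvgB (cvgM cc (cv _ cYX)) (cvgM cs (cv _ cZX))).
exact: (schwarz h1 h2 h3 h4 h5 h6).
Qed.

End lie_real.

(** * Smooth functions on SU(2) *)

Section smooth_scalar.
Context {R : realType}.
Local Notation C := R[i].
Local Notation G := (SU2 R).
Local Notation Re := complex.Re.
Local Notation Im := complex.Im.
Implicit Types (f h : G -> C) (X Y : 'M[C]_2) (g c : G) (k : nat).

Lemma cReD (a b : C) : Re (a + b) = Re a + Re b. Proof. by case: a; case: b. Qed.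
Lemma cImD (a b : C) : Im (a + b) = Im a + Im b. Proof. by case: a; case: b. Qed.
Lemma cReM (a b : C) : Re (a * b) = Re a * Re b - Im a * Im b.
Proof. by case: a; case: b. Qed.
Lemma cImM (a b : C) : Im (a * b) = Re a * Im b + Im a * Re b.
Proof. by case: a => p q; case: b => p' q' /=; rewrite addrC [q * _]mulrC [p * _]mulrC; ring. Qed.
Lemma ReIm_eq (a b : C) : Re a = Re b -> Im a = Im b -> a = b.
Proof. by case: a => p q; case: b => p' q' /= -> ->. Qed.

Definition cont f := continuous (fun g => Re (f g)) /\ continuous (fun g => Im (f g)).

Definition is_lie X f f' := is_lieR X (fun g => Re (f g)) (fun g => Re (f' g)) /\
  is_lieR X (fun g => Im (f g)) (fun g => Im (f' g)).

(** The derivative is quantified existentially, so that closure properties are proved by exhibiting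
    one, without reference to default values of [lie]. *)
Fixpoint smC k f : Prop := if k is k'.+1 then
  cont f /\ forall X, su2 R X -> exists2 f', is_lie X f f' & smC k' f' else cont f.

Definition sm f := forall k, smC k f.

Definition lie : 'M[C]_2 -> (G -> C) -> G -> C := locked (fun X f g =>
  ('D_(1:R) (fun t : R => Re (f (g * rexp X t)%g)) (0:R)) +i*
  ('D_(1:R) (fun t : R => Im (f (g * rexp X t)%g)) (0:R))).

Lemma is_lie_lie X f f' : is_lie X f f' -> lie X f = f'.
Proof.
move=> [dr di]; apply/funext => g; rewrite /lie -lock.
by have [_ ->] := dr g; have [_ ->] := di g; case: (f' g).
Qed.

Lemma is_lieD X f f' h h' : is_lie X f f' -> is_lie X h h' ->
  is_lie X (fun g => f g + h g) (fun g => f' g + h' g).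
Proof.
move=> [a1 a2] [b1 b2]; split=> g.
  by rewrite cReD; under eq_fun do rewrite cReD; exact: (dvD (a1 g) (b1 g)).
by rewrite cImD; under eq_fun do rewrite cImD; exact: (dvD (a2 g) (b2 g)).
Qed.

Lemma is_lieM X f f' h h' : su2 R X -> is_lie X f f' -> is_lie X h h' ->
  is_lie X (fun g => f g * h g) (fun g => f' g * h g + f g * h' g).
Proof.
move=> sX [a1 a2] [b1 b2]; split=> g.
  rewrite cReD !cReM; under eq_fun do rewrite cReM.
  apply: (is_derive_eq (dvB (dvM (a1 g) (b1 g)) (dvM (a2 g) (b2 g)))).
  by rewrite rexp0// mulg1; ring.
rewrite cImD !cImM; under eq_fun do rewrite cImM.
apply: (is_derive_eq (dvD (dvM (a1 g) (b2 g)) (dvM (a2 g) (b1 g)))).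
by rewrite rexp0// mulg1; ring.
Qed.

Lemma is_lie_cst X (a : C) : is_lie X (fun _ => a) (fun _ => 0).
Proof. by split=> g; exact: dvC. Qed.

Lemma is_lieR_eq X (u u' u'' : G -> R) : is_lieR X u u' -> (forall g, u' g = u'' g) -> is_lieR X u u''.
Proof. by move=> df /funext <-. Qed.

Lemma is_lie_eq X f f' f'' : is_lie X f f' -> (forall g, f' g = f'' g) -> is_lie X f f''.
Proof. by move=> df /funext <-. Qed.

Lemma is_lieZ X f f' (a : C) : su2 R X -> is_lie X f f' ->
  is_lie X (fun g => a * f g) (fun g => a * f' g).
Proof.
move=> sX df; apply: (is_lie_eq (is_lieM sX (is_lie_cst X a) df)) => g.
by rewrite mul0r add0r.
Qed.

Lemma is_lie_trans c X Y f f' : su2 R X -> su2 R Y -> SU2val c *m Y = X *m SU2val c ->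
  is_lie Y f f' -> is_lie X (fun g => f (g * c)%g) (fun g => f' (g * c)%g).
Proof.
move=> sX sY e [d1 d2]; split.
  exact: (lieR_trans sX sY e d1).
exact: (lieR_trans sX sY e d2).
Qed.

Lemma contD f h : cont f -> cont h -> cont (fun g => f g + h g).
Proof.
move=> [a1 a2] [b1 b2]; split=> g.
  by under eq_fun do rewrite cReD; exact: (cvgD (a1 g) (b1 g)).
by under eq_fun do rewrite cImD; exact: (cvgD (a2 g) (b2 g)).
Qed.

Lemma contM f h : cont f -> cont h -> cont (fun g => f g * h g).
Proof.
move=> [a1 a2] [b1 b2]; split=> g.
  by under eq_fun do rewrite cReM; exact: (cvgB (cvgM (a1 g) (b1 g)) (cvgM (a2 g) (b2 g))).
by under eq_fun do rewrite cImM; exact: (cvgD (cvgM (a1 g) (b2 g)) (cvgM (a2 g) (b1 g))).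
Qed.

Lemma cont_cst (a : C) : cont (fun _ => a).
Proof. by split; exact: cst_continuous. Qed.

Lemma cont_trans c f : cont f -> cont (fun g => f (g * c)%g).
Proof.
move=> [a1 a2]; split=> g.
  exact: (continuous_comp (@mulg_continuous _ c g) (a1 (g * c)%g)).
exact: (continuous_comp (@mulg_continuous _ c g) (a2 (g * c)%g)).
Qed.

Lemma sm_cont f : sm f -> cont f.
Proof. by move=> /(_ 0%N). Qed.

Lemma sm_is_lie X f : sm f -> su2 R X -> is_lie X f (lie X f).
Proof.
move=> /(_ 1%N) [_ /(_ X)] + sX => /(_ sX) [f' df _].
by rewrite (is_lie_lie df).
Qed.

Lemma sm_lie X f : sm f -> su2 R X -> sm (lie X f).
Proof.
move=> sf sX k; have [_ /(_ _ sX) [f' df sf']] := sf k.+1.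
by rewrite (is_lie_lie df).
Qed.

Lemma smC_cst k (a : C) : smC k (fun _ => a).
Proof.
elim: k a => [|k IH] a /=; first exact: cont_cst.
split; [exact: cont_cst|move=> X sX; exists (fun=> 0) => //; exact: is_lie_cst].
Qed.

Lemma smD f h : sm f -> sm h -> sm (fun g => f g + h g).
Proof.
move=> sf sh k; have := sh k; have := sf k; clear sf sh.
elim: k f h => [|k IH] f h /=; first exact: contD.
move=> [cf df] [ch dh]; split; first exact: contD.
move=> X sX; have [f' df' sf'] := df X sX; have [h' dh' sh'] := dh X sX.
by exists (fun g => f' g + h' g); [exact: is_lieD|exact: IH].
Qed.

Lemma smZ (a : C) f : sm f -> sm (fun g => a * f g).
Proof.
move=> sf k; have := sf k; clear sf.
elim: k f => [|k IH] f /=; first by apply: contM; exact: cont_cst.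
move=> [cf df]; split; first by apply: contM => //; exact: cont_cst.
move=> X sX; have [f' df' sf'] := df X sX.
by exists (fun g => a * f' g); [exact: is_lieZ|exact: IH].
Qed.

Lemma sm_cst (a : C) : sm (fun _ => a). Proof. by move=> k; exact: smC_cst. Qed.

Lemma sm_sum (I : Type) (r : seq I) (P : pred I) (F : I -> G -> C) :
  (forall i, sm (F i)) -> sm (fun g => \sum_(i <- r | P i) F i g).
Proof.
move=> sF; elim: r => [|i r IH].
  have -> : (fun g => \sum_(i <- [::] | P i) F i g) = fun _ => 0.
    by apply/funext => g; rewrite big_nil.
  exact: sm_cst.
have -> : (fun g => \sum_(i <- i :: r | P i) F i g) =
    fun g => (if P i then F i g else 0) + \sum_(i <- r | P i) F i g.
  by apply/funext => g; rewrite big_cons; case: ifP => //; rewrite add0r.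
by apply: smD => //; case: (P i) => //; exact: sm_cst.
Qed.

(** Each derivative along X becomes one along c^-1 X c, so the induction uses that [smC] covers all
    of su(2). *)
Lemma sm_trans c f : sm f -> sm (fun g => f (g * c)%g).
Proof.
move=> sf k; have := sf k; clear sf.
elim: k f => [|k IH] f /=; first exact: cont_trans.
move=> [cf df]; split; first exact: cont_trans.
move=> X sX; have [Y [sY e] _] := rexp_conj c sX; have [f' df' sf'] := df Y sY.
exists (fun g => f' (g * c)%g); [exact: (is_lie_trans sX sY e)|exact: IH].
Qed.

Lemma lieD X f h : su2 R X -> sm f -> sm h ->
  lie X (fun g => f g + h g) = fun g => lie X f g + lie X h g.
Proof. by move=> sX sf sh; apply/is_lie_lie/is_lieD; exact: sm_is_lie. Qed.

Lemma lieZ X (a : C) f : su2 R X -> sm f -> lie X (fun g => a * f g) = fun g => a * lie X f g.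
Proof. by move=> sX sf; apply/is_lie_lie/is_lieZ => //; exact: sm_is_lie. Qed.

Lemma lie_cst X (a : C) : lie X (fun _ => a) = fun _ => 0.
Proof. exact/is_lie_lie/is_lie_cst. Qed.

Lemma lieB X f h : su2 R X -> sm f -> sm h ->
  lie X (fun g => f g - h g) = fun g => lie X f g - lie X h g.
Proof.
move=> sX sf sh; have -> : (fun g => f g - h g) = (fun g => f g + (-1) * h g).
  by apply/funext => g; rewrite mulN1r.
rewrite lieD//; last exact: smZ.
by rewrite lieZ//; apply/funext => g; rewrite mulN1r.
Qed.

Lemma lie_sum X (I : Type) (r : seq I) (P : pred I) (F : I -> G -> C) : su2 R X ->
  (forall i, sm (F i)) ->
  lie X (fun g => \sum_(i <- r | P i) F i g) = fun g => \sum_(i <- r | P i) lie X (F i) g.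
Proof.
move=> sX sF; elim: r => [|i r IH].
  have -> : (fun g => \sum_(i <- [::] | P i) F i g) = fun _ => 0.
    by apply/funext => g; rewrite big_nil.
  by rewrite lie_cst; apply/funext => g; rewrite big_nil.
have -> : (fun g => \sum_(i <- i :: r | P i) F i g) =
    fun g => (if P i then F i g else 0) + \sum_(i <- r | P i) F i g.
  by apply/funext => g; rewrite big_cons; case: ifP => //; rewrite add0r.
rewrite lieD//; last 2 first.
- by case: (P i) => //; exact: sm_cst.
- exact: sm_sum.
rewrite IH; apply/funext => g; rewrite big_cons; case: ifP => _ //.
by rewrite lie_cst add0r.
Qed.

Lemma lie_trans c X Y f : su2 R X -> su2 R Y -> SU2val c *m Y = X *m SU2val c -> sm f ->
  lie X (fun g => f (g * c)%g) = fun g => lie Y f (g * c)%g.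
Proof.
by move=> sX sY e sf; apply: is_lie_lie; apply: (is_lie_trans sX sY e); exact: sm_is_lie.
Qed.

Lemma is_lie_lin (x y z : R) f : sm f -> is_lie (su2v x y z) f
  (fun g => x%:C * lie eI f g + y%:C * lie eJ f g + z%:C * lie eK f g).
Proof.
move=> sf; have [i1 i2] := sm_is_lie sf su2_eI; have [j1 j2] := sm_is_lie sf su2_eJ.
have [k1 k2] := sm_is_lie sf su2_eK.
have [ci1 ci2] := sm_cont (sm_lie sf su2_eI); have [cj1 cj2] := sm_cont (sm_lie sf su2_eJ).
have [ck1 ck2] := sm_cont (sm_lie sf su2_eK).
have e1 (a : R) (b : C) : Re (a%:C * b) = a * Re b by rewrite cReM /= mul0r subr0.
have e2 (a : R) (b : C) : Im (a%:C * b) = a * Im b by rewrite cImM /= mul0r addr0.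
split.
  have -> : (fun g => Re (x%:C * lie eI f g + y%:C * lie eJ f g + z%:C * lie eK f g)) =
    fun g => x * Re (lie eI f g) + y * Re (lie eJ f g) + z * Re (lie eK f g).
    by apply/funext => g; rewrite !cReD !e1.
  exact: (lieR_lin x y z i1 j1 k1 ci1 cj1 ck1).
have -> : (fun g => Im (x%:C * lie eI f g + y%:C * lie eJ f g + z%:C * lie eK f g)) =
  fun g => x * Im (lie eI f g) + y * Im (lie eJ f g) + z * Im (lie eK f g).
  by apply/funext => g; rewrite !cImD !e2.
exact: (lieR_lin x y z i2 j2 k2 ci2 cj2 ck2).
Qed.

Lemma lie_lin (x y z : R) f : sm f -> lie (su2v x y z) f =
  (fun g => x%:C * lie eI f g + y%:C * lie eJ f g + z%:C * lie eK f g).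
Proof. by move=> sf; apply/is_lie_lie/is_lie_lin. Qed.

Lemma lie_bracket X Y Z (W : R -> 'M[C]_2) f :
  su2 R X -> su2 R Y -> su2 R Z ->
  (forall t, su2 R (W t) /\ SU2val (rexp X t) *m W t = Y *m SU2val (rexp X t)) ->
  (forall t h, sm h -> lie (W t) h = fun g => (cos (t + t))%:C * lie Y h g - (sin (t + t))%:C * lie Z h g) ->
  sm f -> forall g, lie X (lie Y f) g - lie Y (lie X f) g = 2 * lie Z f g.
Proof.
move=> sX sY sZ W_ lW sf g.
have e1 (a : R) (b : C) : Re (a%:C * b) = a * Re b by rewrite cReM /= mul0r subr0.
have e2 (a : R) (b : C) : Im (a%:C * b) = a * Im b by rewrite cImM /= mul0r addr0.
have cReN (a : C) : Re (- a) = - Re a by case: a.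
have cImN (a : C) : Im (- a) = - Im a by case: a.
have key (P : C -> R) : (forall a b, P (a - b) = P a - P b) -> (forall (a : R) b, P (a%:C * b) = a * P b) ->
    (forall h V, sm h -> su2 R V -> is_lieR V (fun g => P (h g)) (fun g => P (lie V h g))) ->
    (forall h, sm h -> continuous (fun g => P (h g))) ->
    P (lie X (lie Y f) g) - P (lie Y (lie X f) g) = 2 * P (lie Z f g).
  move=> PB PZ PD PC.
  have l t h : sm h -> is_lieR (W t) (fun g => P (h g))
      (fun g => cos (t + t) * P (lie Y h g) - sin (t + t) * P (lie Z h g)).
    by move=> sh; have [sW _] := W_ t; apply: (is_lieR_eq (PD _ _ sh sW)) => g'; rewrite lW// PB !PZ.
  have sXf := sm_lie sf sX; have sYf := sm_lie sf sY; have sZf := sm_lie sf sZ.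
  by apply: (lieR_bracket sX sY W_ (fun t => l t _ sf) (fun t => l t _ sXf) (PD _ _ sf sX)
    (PD _ _ sXf sX) (PD _ _ sYf sX) (PD _ _ sZf sX)); [split|..]; apply: PC => //; exact: sm_lie.
have two : (2 : C) = 2%:C by rewrite rmorph_nat.
apply: ReIm_eq; rewrite two ?e1 ?e2 ?cReD ?cImD ?cReN ?cImN; apply: key => //.
- by move=> a b; rewrite cReD cReN.
- by move=> h V sh sV; have [] := sm_is_lie sh sV.
- by move=> h /sm_cont[].
- by move=> a b; rewrite cImD cImN.
- by move=> h V sh sV; have [] := sm_is_lie sh sV.
- by move=> h /sm_cont[].
Qed.

(** W(t) is exp(-tI) J exp(tI), computed with quaternions; the two brackets below are its cyclic
    analogues. *)
Lemma lie_brIJ f : sm f -> forall g, lie eI (lie eJ f) g - lie eJ (lie eI f) g = 2 * lie eK f g.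
Proof.
apply: (@lie_bracket _ _ _ (fun t => su2v 0 (cos (t + t)) (- sin (t + t)))); try exact: su2_su2v.
  move=> t; split; first exact: su2_su2v.
  rewrite rexp_unit ?n100// /su2v !quat_mul cosD sinD; congr quat; apply: (@cos2_sin2_id _ t); ring.
by move=> t h sh; rewrite lie_lin//; apply/funext => g; rewrite rmorphN; ring.
Qed.

Lemma lie_brJK f : sm f -> forall g, lie eJ (lie eK f) g - lie eK (lie eJ f) g = 2 * lie eI f g.
Proof.
apply: (@lie_bracket _ _ _ (fun t => su2v (- sin (t + t)) 0 (cos (t + t)))); try exact: su2_su2v.
  move=> t; split; first exact: su2_su2v.
  rewrite rexp_unit ?n010// /su2v !quat_mul cosD sinD; congr quat; apply: (@cos2_sin2_id _ t); ring.
by move=> t h sh; rewrite lie_lin//; apply/funext => g; rewrite rmorphN; ring.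
Qed.

Lemma lie_brKI f : sm f -> forall g, lie eK (lie eI f) g - lie eI (lie eK f) g = 2 * lie eJ f g.
Proof.
apply: (@lie_bracket _ _ _ (fun t => su2v (cos (t + t)) (- sin (t + t)) 0)); try exact: su2_su2v.
  move=> t; split; first exact: su2_su2v.
  rewrite rexp_unit ?n001// /su2v !quat_mul cosD sinD; congr quat; apply: (@cos2_sin2_id _ t); ring.
by move=> t h sh; rewrite lie_lin//; apply/funext => g; rewrite rmorphN; ring.
Qed.

End smooth_scalar.

(** * Maximum principle *)

Section maximum.
Context {R : realType}.
Local Notation C := R[i].
Local Notation G := (SU2 R).
Implicit Types (u v W : G -> R) (X Y : 'M[C]_2) (g c : G).

Lemma circle_angle (x y : R) : x ^+ 2 + y ^+ 2 = 1 ->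
  exists2 a : R, `|a| <= pi & x = cos a /\ y = sin a.
Proof.
move=> n1; have x1 : -1 <= x <= 1.
  rewrite -ler_norml -(@ler_pXn2r _ 2) ?nnegrE// expr1n -normrX ger0_norm ?sqr_ge0//.
  by rewrite -n1 lerDl sqr_ge0.
have ca : cos (acos x) = x by rewrite acosK// in_itv.
have sa : sin (acos x) = `|y|.
  by rewrite sin_acos// -n1 [x ^+ 2 + _]addrC addrK sqrtr_sqr.
have pa : `|acos x| <= pi by rewrite ger0_norm ?acos_ge0// acos_lepi.
have [y0|y0] := leP 0 y.
  by exists (acos x) => //; rewrite ca sa ger0_norm.
exists (- acos x); first by rewrite normrN.
by rewrite cosN sinN ca sa ltr0_norm// opprK.
Qed.

Lemma polar (x y : R) : exists r a : R,
  [/\ 0 <= r, r ^+ 2 = x ^+ 2 + y ^+ 2, `|a| <= pi, x = r * cos a & y = r * sin a].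
Proof.
pose r := Num.sqrt (x ^+ 2 + y ^+ 2).
have r2 : r ^+ 2 = x ^+ 2 + y ^+ 2 by rewrite sqr_sqrtr// addr_ge0 ?sqr_ge0.
have [r0|r0] := eqVneq r 0.
  exists 0, 0; rewrite normr0 pi_ge0 !mul0r expr0n /=; move: r2; rewrite r0 expr0n /= => /esym/eqP.
  by rewrite paddr_eq0 ?sqr_ge0// !sqrf_eq0 => /andP[/eqP-> /eqP->]; split; rewrite // expr0n addr0.
have [|a ha [xa ya]] := @circle_angle (x / r) (y / r).
  by rewrite !exprMn -mulrDl -r2 exprVn mulfV// expf_neq0.
exists r, a; rewrite sqrtr_ge0 -xa -ya; split=> //; by field.
Qed.

(** Serves twice: a compact box of angles covers the group, which yields maxima, and paths along I
    and J alone reach every point, which yields constancy in [lieR_const]. *)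
Lemma euler g : exists s t u : R, [/\ `|s| <= pi, `|t| <= pi, `|u| <= pi &
  g = (rexp eI s * rexp eJ t * rexp eI u)%g].
Proof.
have [r1 [a [r10 r1E pa wE xE]]] := polar (qw g) (qx g).
have [r2 [b [r20 r2E pb yE zE]]] := polar (qy g) (qz g).
have [|t pt [t1 t2]] := @circle_angle r1 r2.
  by rewrite r1E r2E -(qnorm g); ring.
(* The product has first row cos(t) e^{i(s+u)}, sin(t) e^{i(s-u)}, whence s + u = a and s - u =
   b. *)
exists ((a + b) / 2), t, ((a - b) / 2); split=> //.
- by rewrite normrM [`|2^-1|]ger0_norm// ler_pdivrMr//; have := ler_normD a b; lra.
- by rewrite normrM [`|2^-1|]ger0_norm// ler_pdivrMr//; have := ler_normB a b; lra.
have q1 := qM (rexp eJ t) (rexp eI ((a - b) / 2)).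
rewrite !rexpJ_q !rexpI_q in q1; rewrite !(mulr0, mul0r, subr0, addr0, add0r) in q1.
have aE : a = (a + b) / 2 + (a - b) / 2 by field.
have bE : b = (a + b) / 2 - (a - b) / 2 by field.
rewrite -mulgA; apply: SU2_ext; rewrite (qM (rexp eI ((a + b) / 2))) !q1 !rexpI_q ?wE ?xE ?yE ?zE ?t1 ?t2.
- by rewrite [in LHS]aE cosD; ring.
- by rewrite [in LHS]aE sinD; ring.
- by rewrite [in LHS]bE cosB; ring.
- by rewrite [in LHS]bE sinB; ring.
Qed.

Lemma SU2_max W : continuous W -> exists g0, forall g, W g <= W g0.
Proof.
move=> cW.
pose E (p : R * R * R) : G := (rexp eI p.1.1 * rexp eJ p.1.2 * rexp eI p.2)%g.
pose I : set R := [set x | `|x| <= pi].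
have cI : compact I.
  have -> : I = `[- pi, pi]%classic by apply/seteqP; split=> x /=; rewrite /I /= in_itv /= ler_norml.
  exact: segment_compact.
have cE : continuous E.
  have ce X (f : R * R * R -> R) : su2 R X -> continuous f -> continuous (fun p => rexp X (f p)).
    move=> sX cf p.
    have h : (rexp X (f p) * rexp X (f p' - f p))%g @[p' --> p] --> (rexp X (f p) * 1)%g.
      apply: cvgMg; first exact: cvg_cst.
      have c0 : f p' - f p @[p' --> p] --> (0 : R).
        by rewrite -(subrr (f p)); apply: cvgB; [exact: cf|exact: cvg_cst].
      by apply: (cvg_comp _ _ c0); exact: rexp_cvg.
    rewrite mulg1 in h.
    have e : (fun p' => (rexp X (f p) * rexp X (f p' - f p))%g) = (fun p' => rexp X (f p')).
      by apply/funext => p'; rewrite -rexpD// addrC subrK.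
    by rewrite e in h.
  move=> p; apply: cvgMg; first apply: cvgMg.
  - by apply: (ce eI (fun p => p.1.1)); [exact: su2_eI|move=> q; apply: (continuous_comp (g := fst)); exact: cvg_fst].
  - by apply: (ce eJ (fun p => p.1.2)); [exact: su2_eJ|move=> q; apply: (continuous_comp (g := snd)); [exact: cvg_fst|exact: cvg_snd]].
  - by apply: (ce eI (fun p => p.2)); [exact: su2_eI|move=> q; exact: cvg_snd].
have I0 : I 0 by rewrite /I /= normr0 pi_ge0.
have [|||p _ pm] := @compact_EVT_max _ R (W \o E) (I `*` I `*` I).
- by exists (0, 0, 0); rewrite /=.
- by apply: compact_setX => //; apply: compact_setX.
- apply: continuous_subspaceT => p; apply: continuous_comp; [exact: cE|exact: cW].
exists (E p) => g; have [s [t [u [hs ht hu ->]]]] := euler g.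
by apply: (pm (s, t, u)); rewrite inE.
Qed.

(** The first derivative vanishes at a maximum; a positive second derivative would make it positive
    just after, and the function would exceed its maximum. *)
Lemma lie_max2 X W W1 W2 g0 : su2 R X -> is_lieR X W W1 -> is_lieR X W1 W2 ->
  (forall g, W g <= W g0) -> W2 g0 <= 0.
Proof.
move=> sX d1 d2 mW; rewrite leNgt; apply/negP => W20.
have p1 t := lieR_at sX d1 g0 t.
have z1 : W1 g0 = 0.
  have h1 : is_derive (0:R) (1:R) (fun h : R => W (g0 * rexp X h)%g) 0.
    have ab : (-1:R) <= 1 by lra.
    have hd t : t \in `](-1:R), 1[ -> derivable (fun h : R => W (g0 * rexp X h)%g) t 1.
      by move=> _; have [] := p1 t.
    have h0 : (0:R) \in `](-1:R), 1[ by rewrite in_itv /= ltrN10 ltr01.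
    apply: (derive1_at_max ab hd h0) => t _.
    by rewrite rexp0// mulg1.
  by have [_ e1] := h1; have [_ e2] := d1 g0; rewrite -e2 e1.
have := dv_cvg (d2 g0); rewrite rexp0// mulg1 z1.
move=> /(cvgr_gt _) /(_ _ W20); rewrite -nbhs_nearE /dnbhs /within /= => /nbhs_ballP[e /= e0 be].
have k (c : R) : 0 < c < e -> 0 < W1 (g0 * rexp X c)%g.
  move=> /andP[c0 ce]; have := be c; rewrite /ball /= sub0r normrN gtr0_norm// => /(_ ce).
  by rewrite gt_eqF// add0r subr0 pmulr_rgt0 ?invr_gt0//; apply.
have e20 : 0 < e / 2 by rewrite divr_gt0.
have [c] := MVT e20 (fun t _ => p1 t) (derivable_within_continuous (fun t _ => @ex_derive _ _ _ _ _ _ _ (p1 t))).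
rewrite in_itv /= => /andP[c0 ce]; rewrite rexp0// mulg1 subr0 => E.
have : 0 < W1 (g0 * rexp X c)%g * (e / 2).
  by rewrite mulr_gt0// k// c0 (lt_trans ce)// ltr_pdivrMr// ltr_pMr// ltr1n.
by rewrite -E subr_gt0 ltNge mW.
Qed.

End maximum.

(** * Estimates for the squared Dirac equation *)

Section maximum_principle.
Context {R : realType}.
Local Notation C := R[i].
Local Notation G := (SU2 R).
Local Notation Re := complex.Re.
Local Notation Im := complex.Im.
Implicit Types (f h : G -> C) (X Y : 'M[C]_2) (g c : G).

Definition dotC (a b : C) : R := Re a * Re b + Im a * Im b.
Definition sqn (a : C) : R := dotC a a.

Lemma sqn_ge0 a : 0 <= sqn a.
Proof. by rewrite addr_ge0// -expr2 sqr_ge0. Qed.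

Lemma sqn_eq0 a : sqn a <= 0 -> a = 0.
Proof.
move=> s0; have : sqn a == 0 by rewrite eq_le s0 sqn_ge0.
rewrite /sqn /dotC -!expr2 paddr_eq0 ?sqr_ge0// !sqrf_eq0 => /andP[/eqP r0 /eqP i0].
by apply: ReIm_eq.
Qed.

Lemma dotC_lie X f f' h h' : is_lie X f f' -> is_lie X h h' -> su2 R X ->
  is_lieR X (fun g => dotC (f g) (h g)) (fun g => dotC (f' g) (h g) + dotC (f g) (h' g)).
Proof.
move=> [a1 a2] [b1 b2] sX g; rewrite /dotC.
apply: (is_derive_eq (dvD (dvM (a1 g) (b1 g)) (dvM (a2 g) (b2 g)))).
by rewrite rexp0// mulg1; ring.
Qed.

Lemma sqn_lie1 X f : sm f -> su2 R X ->
  is_lieR X (fun g => sqn (f g)) (fun g => 2 * dotC (f g) (lie X f g)).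
Proof.
move=> sf sX; have df := sm_is_lie sf sX.
by apply: (is_lieR_eq (dotC_lie df df sX)) => g; rewrite /dotC; ring.
Qed.

Lemma is_lieRZ X (a : R) (u u' : G -> R) : is_lieR X u u' ->
  is_lieR X (fun g => a * u g) (fun g => a * u' g).
Proof. by move=> du g; exact: dvZ. Qed.

Lemma is_lieRD X (u u' v v' : G -> R) : is_lieR X u u' -> is_lieR X v v' ->
  is_lieR X (fun g => u g + v g) (fun g => u' g + v' g).
Proof. by move=> du dv' g; exact: dvD. Qed.

Lemma sqn_lie2 X f : sm f -> su2 R X ->
  is_lieR X (fun g => 2 * dotC (f g) (lie X f g))
    (fun g => 2 * (sqn (lie X f g) + dotC (f g) (lie X (lie X f) g))).
Proof.
move=> sf sX; have df := sm_is_lie sf sX; have ddf := sm_is_lie (sm_lie sf sX) sX.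
exact: (is_lieRZ 2 (dotC_lie df ddf sX)).
Qed.

Lemma sqn_continuous f : sm f -> continuous (fun g => sqn (f g)).
Proof.
move=> /sm_cont[c1 c2] g; rewrite /sqn /dotC.
exact: (cvgD (cvgM (c1 g) (c1 g)) (cvgM (c2 g) (c2 g))).
Qed.

Lemma dotCD (a b c : C) : dotC a (b + c) = dotC a b + dotC a c.
Proof. by rewrite /dotC cReD cImD; ring. Qed.

Lemma dotC_scale (a b : C) : dotC a (b * a) = Re b * sqn a.
Proof. by rewrite /sqn /dotC cReM cImM; ring. Qed.

(** At a maximum of |f|^2 the second derivatives along J and K have sum at most 0, yet this sum
    equals 2(|Jf|^2 + |Kf|^2 + Re gamma |f|^2). This is what terminates weight chains. *)
Lemma lapJK_eq0 f (gamma : C) : sm f -> 0 < Re gamma ->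
  (forall g, lie eJ (lie eJ f) g + lie eK (lie eK f) g = gamma * f g) ->
  forall g, f g = 0.
Proof.
move=> sf g0 fE; have [m mx] := SU2_max (sqn_continuous sf).
have hJ := lie_max2 su2_eJ (sqn_lie1 sf su2_eJ) (sqn_lie2 sf su2_eJ) mx.
have hK := lie_max2 su2_eK (sqn_lie1 sf su2_eK) (sqn_lie2 sf su2_eK) mx.
have E : dotC (f m) (lie eJ (lie eJ f) m) + dotC (f m) (lie eK (lie eK f) m) = Re gamma * sqn (f m).
  by rewrite -dotCD fE dotC_scale.
have := sqn_ge0 (lie eJ f m); have := sqn_ge0 (lie eK f m) => sK sJ.
have sm0 : Re gamma * sqn (f m) <= 0 by lra.
rewrite pmulr_rle0// in sm0.
by move=> g; apply: sqn_eq0; apply: le_trans (mx g) sm0.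
Qed.

(* The square of the Dirac equation, for one component of an eigenspinor. *)
Definition berger_eq (kappa alpha : R) (beta : C) f := sm f /\
  forall g, lie eJ (lie eJ f) g + lie eK (lie eK f) g + kappa%:C * lie eI (lie eI f) g =
    - 'i%C * alpha%:C * lie eI f g + beta * f g.

Lemma dotC_iI (a b : C) (alpha : R) : dotC a (- 'i%C * alpha%:C * b) = alpha * (Re a * Im b - Im a * Re b).
Proof. by case: a => a1 a2; case: b => b1 b2; rewrite /dotC /=; ring. Qed.

Lemma dotC_mulr (a b : C) (k : R) : dotC a (k%:C * b) = k * dotC a b.
Proof. by case: a => a1 a2; case: b => b1 b2; rewrite /dotC /=; ring. Qed.

(** J^2 + K^2 commutes with I: [I, J^2] = 2(KJ + JK), and [I, K^2] is its negative. Hence If solves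
    the same equation as f. *)
Lemma lieI_lapJK f : sm f -> forall g,
  lie eI (lie eJ (lie eJ f)) g + lie eI (lie eK (lie eK f)) g =
  lie eJ (lie eJ (lie eI f)) g + lie eK (lie eK (lie eI f)) g.
Proof.
move=> sf g.
have sI := sm_lie sf su2_eI; have sJ := sm_lie sf su2_eJ; have sK := sm_lie sf su2_eK.
have IJ h : sm h -> lie eI (lie eJ h) = fun g => lie eJ (lie eI h) g + 2 * lie eK h g.
  by move=> sh; apply/funext => g'; rewrite -lie_brIJ//; ring.
have IK h : sm h -> lie eI (lie eK h) = fun g => lie eK (lie eI h) g - 2 * lie eJ h g.
  by move=> sh; apply/funext => g'; rewrite -lie_brKI//; ring.
rewrite !(IJ _ sJ) !(IK _ sK) (IJ _ sf) (IK _ sf).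
rewrite lieD ?lieB ?lieZ//; first ring.
all: by [exact: su2_eJ|exact: su2_eK|exact: sm_lie su2_eJ|exact: sm_lie su2_eK|
  exact: sm_lie sI su2_eJ|exact: sm_lie sI su2_eK|exact/smZ].
Qed.

Lemma berger_lieI kappa alpha beta f : berger_eq kappa alpha beta f ->
  berger_eq kappa alpha beta (lie eI f).
Proof.
move=> [sf fE]; split; first exact: sm_lie su2_eI.
move=> g; rewrite -lieI_lapJK//.
have sI := sm_lie sf su2_eI; have sJ := sm_lie sf su2_eJ; have sK := sm_lie sf su2_eK.
have sII := sm_lie sI su2_eI.
have sJJ := sm_lie sJ su2_eJ; have sKK := sm_lie sK su2_eK.
have E : lie eI (fun g => lie eJ (lie eJ f) g + lie eK (lie eK f) g + kappa%:C * lie eI (lie eI f) g) =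
  lie eI (fun g => - 'i%C * alpha%:C * lie eI f g + beta * f g).
  by congr lie; apply/funext => g'; exact: fE.
have := congr1 (fun F => F g) E.
rewrite (lieD su2_eI (smD sJJ sKK) (smZ _ sII)) (lieD su2_eI sJJ sKK) (lieZ _ su2_eI sII).
by rewrite (lieD su2_eI (smZ _ sI) (smZ _ sf)) (lieZ _ su2_eI sI) (lieZ _ su2_eI sf).
Qed.

(* Maximum principle for |If|^2 + A |f|^2 with A large. *)
Lemma bernstein (kappa alpha : R) (beta : C) : 0 < kappa -> exists2 K : R, 0 <= K &
  forall f, berger_eq kappa alpha beta f -> forall B, (forall g, sqn (f g) <= B) ->
  forall g, sqn (lie eI f g) <= K * B.
Proof.
move=> k0.
(* [c1] and [c2] bound what remains after completing squares in the equations of If and of f ([q1],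
   [q2]); [A] satisfies A kappa / 2 = c1 + 1, so that in [key] the term |If|^2 survives with
   coefficient 1. *)
pose c1 : R := `|alpha ^+ 2 / (4 * kappa) - Re beta|.
pose c2 : R := `|alpha ^+ 2 / (2 * kappa) - Re beta|.
pose A : R := 2 * (c1 + 1) / kappa.
have A0 : 0 <= A by rewrite divr_ge0 ?(ltW k0)// mulr_ge0// addr_ge0// normr_ge0.
exists (A * (c2 + 1)); first by rewrite mulr_ge0// addr_ge0// normr_ge0.
move=> f bf B fB; have [sf fE] := bf; have [sI IE] := berger_lieI bf.
pose W g := sqn (lie eI f g) + A * sqn (f g).
pose W1 X g := 2 * dotC (lie eI f g) (lie X (lie eI f) g) + A * (2 * dotC (f g) (lie X f g)).
pose W2 X g := 2 * (sqn (lie X (lie eI f) g) + dotC (lie eI f g) (lie X (lie X (lie eI f)) g))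
  + A * (2 * (sqn (lie X f g) + dotC (f g) (lie X (lie X f) g))).
have d1 X : su2 R X -> is_lieR X W (W1 X).
  by move=> sX; apply: is_lieRD; [exact: sqn_lie1|apply: is_lieRZ; exact: sqn_lie1].
have d2 X : su2 R X -> is_lieR X (W1 X) (W2 X).
  by move=> sX; apply: is_lieRD; [exact: sqn_lie2|apply: is_lieRZ; exact: sqn_lie2].
have cW : continuous W.
  have cA : continuous ((fun _ => A) : G -> R) by exact: cst_continuous.
  by move=> g; exact: (cvgD (@sqn_continuous _ sI g) (cvgM (cA g) (@sqn_continuous _ sf g))).
have [m mx] := SU2_max cW.
have hI : W2 eI m <= 0 := lie_max2 su2_eI (d1 _ su2_eI) (d2 _ su2_eI) mx.
have hJ : W2 eJ m <= 0 := lie_max2 su2_eJ (d1 _ su2_eJ) (d2 _ su2_eJ) mx.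
have hK : W2 eK m <= 0 := lie_max2 su2_eK (d1 _ su2_eK) (d2 _ su2_eK) mx.
have D1 := congr1 (dotC (lie eI f m)) (IE m).
have D2 := congr1 (dotC (f m)) (fE m).
rewrite !dotCD !dotC_iI dotC_scale dotC_mulr in D1.
rewrite !dotCD !dotC_iI dotC_scale dotC_mulr in D2.
set x1 := sqn (lie eI f m) in D1 D2 *.
have key : x1 <= A * c2 * sqn (f m).
  have q1 : - (alpha ^+ 2 / (4 * kappa)) * x1 <=
     kappa * sqn (lie eI (lie eI f) m) + alpha * (Re (lie eI f m) * Im (lie eI (lie eI f) m) - Im (lie eI f m) * Re (lie eI (lie eI f) m)).
    rewrite /x1 /sqn /dotC; move: (Re (lie eI f m)) (Im (lie eI f m)) (Re (lie eI (lie eI f) m)) (Im (lie eI (lie eI f) m)) => p q r s.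
    rewrite -subr_ge0.
    have -> : kappa * (r * r + s * s) + alpha * (p * s - q * r) - - (alpha ^+ 2 / (4 * kappa)) * (p * p + q * q)
       = kappa * (s + alpha * p / (2 * kappa)) ^+ 2 + kappa * (r - alpha * q / (2 * kappa)) ^+ 2.
      by field; rewrite gt_eqF.
    by rewrite addr_ge0// mulr_ge0 ?sqr_ge0 ?ltW.
  have q2 : kappa / 2 * x1 - alpha ^+ 2 / (2 * kappa) * sqn (f m) <=
     kappa * x1 + alpha * (Re (f m) * Im (lie eI f m) - Im (f m) * Re (lie eI f m)).
    rewrite /x1 /sqn /dotC; move: (Re (f m)) (Im (f m)) (Re (lie eI f m)) (Im (lie eI f m)) => p q r s.
    rewrite -subr_ge0.
    have -> : kappa * (r * r + s * s) + alpha * (p * s - q * r) - (kappa / 2 * (r * r + s * s) - (alpha ^+ 2 / (2 * kappa)) * (p * p + q * q))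
       = kappa / 2 * (s + alpha * p / kappa) ^+ 2 + kappa / 2 * (r - alpha * q / kappa) ^+ 2.
      by field; rewrite gt_eqF.
    by rewrite addr_ge0// mulr_ge0 ?sqr_ge0 ?divr_ge0 ?ltW.
  have r1 : alpha ^+ 2 / (4 * kappa) - Re beta <= c1 by exact: ler_norm.
  have r2 : alpha ^+ 2 / (2 * kappa) - Re beta <= c2 by exact: ler_norm.
  have Ak : A * kappa = 2 * (c1 + 1) by rewrite /A mulfVK// gt_eqF.
  have x10 : 0 <= x1 by exact: sqn_ge0.
  have y0 := sqn_ge0 (f m).
  have t1 := ler_wpM2r x10 r1; have t2 := ler_wpM2r y0 r2.
  have s1 := sqn_ge0 (lie eJ (lie eI f) m); have s2 := sqn_ge0 (lie eK (lie eI f) m).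
  have s3 := sqn_ge0 (lie eJ f m); have s4 := sqn_ge0 (lie eK f m).
  have hI' : kappa * W2 eI m <= 0 by rewrite mulr_ge0_le0// ltW.
  rewrite /W2 -/x1 in hI' hJ hK.
  have F1 : - c1 * x1 <= sqn (lie eJ (lie eI f) m) + sqn (lie eK (lie eI f) m) +
      kappa * sqn (lie eI (lie eI f) m) + (dotC (lie eI f m) (lie eJ (lie eJ (lie eI f)) m)
      + dotC (lie eI f m) (lie eK (lie eK (lie eI f)) m)
      + kappa * dotC (lie eI f m) (lie eI (lie eI (lie eI f)) m)).
    rewrite D1; lra.
  have F2 : kappa / 2 * x1 - c2 * sqn (f m) <= sqn (lie eJ f m) + sqn (lie eK f m) +
      kappa * x1 + (dotC (f m) (lie eJ (lie eJ f) m) + dotC (f m) (lie eK (lie eK f) m)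
      + kappa * dotC (f m) (lie eI (lie eI f) m)).
    rewrite D2; lra.
  have F3 := ler_wpM2l A0 F2.
  have Ax : A * kappa * x1 = 2 * (c1 + 1) * x1 by rewrite Ak.
  clear D1 D2 q1 q2 t1 t2 r1 r2 Ak; lra.
move=> g; apply: (@le_trans _ _ (W g)); first by rewrite lerDl mulr_ge0// sqn_ge0.
apply: le_trans (mx g) _; rewrite /W -/x1.
have h0 := fB m.
have : A * c2 * sqn (f m) <= A * c2 * B by rewrite ler_wpM2l// mulr_ge0// normr_ge0.
have : A * sqn (f m) <= A * B by rewrite ler_wpM2l.
have -> : A * (c2 + 1) * B = A * c2 * B + A * B by ring.
lra.
Qed.

(** * Fourier analysis along the circle exp(tI) *)

Definition cis (t : R) : C := cos t +i* sin t.

Lemma cisD s t : cis (s + t) = cis s * cis t.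
Proof. by rewrite /cis cosD sinD; apply: ReIm_eq => /=; ring. Qed.

Lemma cis0 : cis 0 = 1.
Proof. by rewrite /cis cos0 sin0. Qed.

Lemma cisX t n : cis (n%:R * t) = cis t ^+ n.
Proof.
elim: n => [|n IH]; first by rewrite mul0r cis0 expr0.
by rewrite exprS -IH -cisD; congr cis; rewrite -natr1; ring.
Qed.

Lemma cisN t : cis t * cis (- t) = 1.
Proof. by rewrite -cisD subrr cis0. Qed.

Lemma cis2pi : cis (2 * pi) = 1.
Proof. by rewrite mulr2n mulrDl mul1r cisD /cis cospi sinpi; apply: ReIm_eq => /=; ring. Qed.

Lemma cis2piz (d : int) : cis (2 * pi * d%:~R) = 1.
Proof.
have cn (n : nat) : cis (2 * pi * n%:R) = 1 by rewrite mulrC cisX cis2pi expr1n.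
case: d => n; rewrite ?NegzE ?mulrNz; first exact: cn.
by have := cisN (2 * pi * n.+1%:R); rewrite cn mul1r mulrN.
Qed.

Lemma sqn_cis t (a : C) : sqn (cis t * a) = sqn a.
Proof.
rewrite /sqn /dotC cReM cImM /cis /=.
transitivity ((cos t ^+ 2 + sin t ^+ 2) * (Re a * Re a + Im a * Im a)); first by ring.
by rewrite cos2Dsin2 mul1r.
Qed.

Lemma cis_eq1 (t : R) : `|t| < 2 * pi -> cis t = 1 -> t = 0.
Proof.
move=> t2 ct; have c1 : cos t = 1 by have := congr1 (fun z : C => Re z) ct.
have s0 : sin (t / 2) = 0.
  have := cosD (t / 2) (t / 2); rewrite -splitr c1 => e.
  have e2 := cos2Dsin2 (t / 2); apply/eqP; rewrite -sqrf_eq0; apply/eqP.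
  by rewrite -!expr2 in e; lra.
have p0 := pi_gt0 R.
have [t0|t0|->//] := ltgtP t 0.
  have : 0 < sin (- (t / 2)).
    by apply: sin_gt0_pi; move: t2; rewrite ltr0_norm//; lra.
  by rewrite sinN s0 oppr0 ltxx.
have : 0 < sin (t / 2) by apply: sin_gt0_pi; move: t2; rewrite gtr0_norm//; lra.
by rewrite s0 ltxx.
Qed.

(** A geometric sum over an M-th root of unity; |d| < M makes the root different from 1 unless d =
    0. *)
Lemma cis_sum (M : nat) (d : int) : (`|d| < M)%N ->
  \sum_(k < M) cis (2 * pi / M%:R * d%:~R) ^+ k = (if d == 0 then M%:R else 0).
Proof.
move=> dM; have M0 : (M%:R : R) != 0 by rewrite pnatr_eq0; case: M dM.
have [->|d0] := eqVneq d 0.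
  rewrite mulr0 cis0 (eq_bigr (fun=> 1)); last by move=> k _; rewrite expr1n.
  by rewrite sumr_const card_ord.
set z := cis _; have z1 : z - 1 != 0.
  rewrite subr_eq0; apply/eqP => /cis_eq1 H.
  have : 2 * pi / M%:R * d%:~R = 0 :> R.
    apply: H; rewrite normrM ger0_norm; last by rewrite divr_ge0// mulr_ge0// pi_ge0.
    have -> : 2 * pi / M%:R * `|d%:~R| = 2 * pi * (`|d%:~R| / M%:R) :> R by ring.
    rewrite gtr_pMr ?mulr_gt0 ?pi_gt0// ltr_pdivrMr; last first.
      by rewrite lt_def M0 ler0n.
    by rewrite mul1r -intr_norm -natr_absz ltr_nat.
  move/eqP; rewrite !mulf_eq0 invr_eq0 (negbTE M0) intr_eq0 (negbTE d0) !orbF.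
  by rewrite pnatr_eq0 /= gt_eqF// pi_gt0.
have zM : z ^+ M = 1.
  rewrite /z -cisX mulrA [M%:R * _]mulrC divfK//.
  exact: cis2piz.
apply: (mulfI z1); rewrite mulr0 -subrX1 zM subrr.
by [].
Qed.

Definition tau (L : nat) : R := 2 * pi / L.*2.+1%:R.

(* The 2L+1 sample points suffice to separate the weights in [-L, L]. *)
Definition wproj (L : nat) (r : int) f g : C :=
  (L.*2.+1%:R)^-1 * \sum_(k < L.*2.+1) cis (- (tau L * r%:~R)) ^+ k * f (g * rexp eI (k%:R * tau L))%g.

Definition rotw (q : int) f := forall g t, f (g * rexp eI t)%g = cis (q%:~R * t) * f g.

Lemma natC_neq0 (n : nat) : (n.+1%:R : C) != 0.
Proof. by rewrite pnatr_eq0. Qed.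

(** |q - r| <= 2L < 2L + 1, so distinct weights are not confused by the sampling. *)
Lemma proj_rotw L r q f : (`|q| <= L)%N -> (`|r| <= L)%N -> rotw q f ->
  wproj L r f = fun g => if q == r then f g else 0.
Proof.
move=> qL rL fq; apply/funext => g; rewrite /wproj.
rewrite (eq_bigr (fun k : 'I__ => cis (tau L * (q - r)%:~R) ^+ k * f g)); last first.
  move=> k _; rewrite fq mulrA; congr (_ * _).
  rewrite -!cisX -cisD; congr cis; rewrite rmorphB /=; ring.
rewrite -mulr_suml /tau cis_sum; last by lia.
rewrite subr_eq0; case: eqP => _; last by rewrite mul0r mulr0.
by rewrite mulrA mulVf ?mul1r// natC_neq0.
Qed.

Lemma rexp_2pi : rexp eI (2 * pi) = 1%g :> G.
Proof.
have e := congr1 (fun z : C => Re z) cis2pi; have e' := congr1 (fun z : C => Im z) cis2pi; rewrite /= in e e'.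
by apply: SU2_ext; rewrite rexpI_q q1.
Qed.

(** Holds for arbitrary f: summing over the weights first leaves only the sample point k = 0. *)
Lemma proj_sum L f g : \sum_(j < L.*2.+1) wproj L (j%:Z - L%:Z) f g = f g.
Proof.
rewrite /wproj -mulr_sumr exchange_big /=.
rewrite (bigD1 ord0)//= [X in _ + X]big1 ?addr0; last first.
  move=> k k0; rewrite -mulr_suml.
  rewrite (eq_bigr (fun j : 'I_(L.*2.+1) => cis (tau L * L%:R * k%:R) * cis (2 * pi / L.*2.+1%:R * (- k%:Z)%:~R) ^+ j)).
    rewrite -mulr_sumr cis_sum; last by have := ltn_ord k; lia.
    have kn : (k%:Z == 0 :> int) = false by apply/negbTE; apply: contra k0 => /eqP[k0]; apply/eqP/val_inj.
    by rewrite oppr_eq0 kn mulr0 mul0r.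
  move=> j _; rewrite -!cisX -cisD -/(tau L); congr cis.
  by rewrite rmorphN rmorphB /= -!pmulrn; ring.
rewrite (eq_bigr (fun=> f g)); last first.
  by move=> j _; rewrite expr0 mul1r mul0r rexp0 ?mulg1//; exact: su2_eI.
by rewrite sumr_const card_ord -[f g *+ _]mulr_natl mulrA mulVf ?mul1r// natC_neq0.
Qed.

(** Rotation by tau shifts the samples cyclically, since exp(2 pi I) = 1. For arbitrary f this works
    only for multiples of this one angle. *)
Lemma proj_rot L r f g : wproj L r f (g * rexp eI (tau L))%g = cis (tau L * r%:~R) * wproj L r f g.
Proof.
rewrite /wproj mulrCA; congr (_ * _); rewrite mulr_sumr.
have M0 : (L.*2.+1%:R : R) != 0 by rewrite pnatr_eq0.
pose F (k : nat) := cis (- (tau L * r%:~R)) ^+ k * f (g * rexp eI (k%:R * tau L))%g.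
have E (k : nat) : cis (- (tau L * r%:~R)) ^+ k * f (g * rexp eI (tau L) * rexp eI (k%:R * tau L))%g
   = cis (tau L * r%:~R) * F k.+1.
  rewrite /F exprS !mulrA cisN mul1r -mulgA -rexpD; last exact: su2_eI.
  by congr (_ * f (g * rexp _ _)%g); rewrite /tau -[k.+1]addn1 natrD; ring.
rewrite (eq_bigr (fun k : 'I__ => cis (tau L * r%:~R) * F k.+1)); last by move=> k _; exact: E.
rewrite -!mulr_sumr; congr (_ * _).
rewrite big_ord_recr /= [RHS]big_ord_recl /= addrC; congr (_ + _).
rewrite /F expr0 mul0r rexp0 ?mulg1 ?mul1r; last exact: su2_eI.
have Mt : L.*2.+1%:R * tau L = 2 * pi by rewrite /tau mulrC divfK.
rewrite Mt rexp_2pi mulg1 -[in RHS](mul1r (f g)); congr (_ * _).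
rewrite -cisX; have -> : L.*2.+1%:R * (- (tau L * r%:~R)) = - (2 * pi * r%:~R) :> R.
  by rewrite mulrN mulrA Mt.
have := cisN (2 * pi * r%:~R); rewrite cis2piz mul1r => ->.
by [].
Qed.

Lemma rexp_normal (x y z : R) (n : x ^+ 2 + y ^+ 2 + z ^+ 2 = 1) (t : R) (p q s p' q' s' : R) :
  quat (cos t) (sin t * x) (sin t * y) (sin t * z) *m su2v p' q' s' =
  su2v p q s *m quat (cos t) (sin t * x) (sin t * y) (sin t * z) ->
  SU2val (rexp (su2v x y z) t) *m su2v p' q' s' = su2v p q s *m SU2val (rexp (su2v x y z) t).
Proof. by rewrite rexp_unit. Qed.

Lemma lieI_rot f t : sm f ->
  lie eI (fun g => f (g * rexp eI t)%g) = fun g => lie eI f (g * rexp eI t)%g.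
Proof.
move=> sf; apply: (@lie_trans _ _ eI eI) => //; try exact: su2_eI.
by apply: (rexp_normal n100); rewrite !quat_mul; congr quat; ring.
Qed.

(** Conjugation by exp(tI) rotates the plane of J and K by the angle 2t; J^2 + K^2 is therefore
    invariant, as used in [berger_rot]. *)
Lemma lieJ_rot f t : sm f -> lie eJ (fun g => f (g * rexp eI t)%g) =
  fun g => (cos (t + t))%:C * lie eJ f (g * rexp eI t)%g - (sin (t + t))%:C * lie eK f (g * rexp eI t)%g.
Proof.
move=> sf; rewrite (@lie_trans _ _ eJ (su2v 0 (cos (t + t)) (- sin (t + t)))) //.
- by apply/funext => g; rewrite lie_lin// rmorphN; ring.
- exact: su2_eJ.
- exact: su2_su2v.
apply: (rexp_normal n100); rewrite !quat_mul cosD sinD; congr quat; apply: (@cos2_sin2_id _ t); ring.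
Qed.

Lemma lieK_rot f t : sm f -> lie eK (fun g => f (g * rexp eI t)%g) =
  fun g => (cos (t + t))%:C * lie eK f (g * rexp eI t)%g + (sin (t + t))%:C * lie eJ f (g * rexp eI t)%g.
Proof.
move=> sf; rewrite (@lie_trans _ _ eK (su2v 0 (sin (t + t)) (cos (t + t)))) //.
- by apply/funext => g; rewrite lie_lin//; ring.
- exact: su2_eK.
- exact: su2_su2v.
apply: (rexp_normal n100); rewrite !quat_mul cosD sinD; congr quat; apply: (@cos2_sin2_id _ t); ring.
Qed.

Section berger.
Variables (kappa alpha : R) (beta : C).
Local Notation berger := (berger_eq kappa alpha beta).

Lemma bergerD f h : berger f -> berger h -> berger (fun g => f g + h g).
Proof.
move=> [sf fE] [sh hE]; split; first exact: smD.
have sfl X := @sm_lie _ X _ sf; have shl X := @sm_lie _ X _ sh.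
have D X : su2 R X -> lie X (lie X (fun g => f g + h g)) = fun g => lie X (lie X f) g + lie X (lie X h) g.
  by move=> sX; rewrite (lieD sX sf sh) (lieD sX (sfl _ sX) (shl _ sX)).
move=> g; rewrite (D _ su2_eJ) (D _ su2_eK) (D _ su2_eI) (lieD su2_eI sf sh).
transitivity ((- 'i%C * alpha%:C * lie eI f g + beta * f g) + (- 'i%C * alpha%:C * lie eI h g + beta * h g)); last by ring.
by rewrite -fE -hE; ring.
Qed.

Lemma bergerZ (a : C) f : berger f -> berger (fun g => a * f g).
Proof.
move=> [sf fE]; split; first exact: smZ.
have sfl X := @sm_lie _ X _ sf.
have D X : su2 R X -> lie X (lie X (fun g => a * f g)) = fun g => a * lie X (lie X f) g.
  by move=> sX; rewrite (lieZ a sX sf) (lieZ a sX (sfl _ sX)).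
move=> g; rewrite (D _ su2_eJ) (D _ su2_eK) (D _ su2_eI) (lieZ a su2_eI sf).
transitivity (a * (- 'i%C * alpha%:C * lie eI f g + beta * f g)); last by ring.
by rewrite -fE; ring.
Qed.

Lemma berger0 : berger (fun=> 0).
Proof.
split; first exact: sm_cst.
by move=> g; rewrite !lie_cst !mulr0 !addr0.
Qed.

Lemma berger_sum (n : nat) (F : 'I_n -> G -> C) : (forall i, berger (F i)) ->
  berger (fun g => \sum_(i < n) F i g).
Proof.
move=> bF; elim: n F bF => [|n IH] F bF.
  have -> : (fun g => \sum_(i < 0) F i g) = fun=> 0 by apply/funext => g; rewrite big_ord0.
  exact: berger0.
have -> : (fun g => \sum_(i < n.+1) F i g) = (fun g => \sum_(i < n) F (widen_ord (leqnSn n) i) g + F ord_max g).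
  by apply/funext => g; rewrite big_ord_recr.
by apply: bergerD => //; apply: IH.
Qed.

Lemma berger_rot f t : berger f -> berger (fun g => f (g * rexp eI t)%g).
Proof.
move=> [sf fE]; split; first exact: sm_trans.
have sI := sm_lie sf su2_eI; have sJ := sm_lie sf su2_eJ; have sK := sm_lie sf su2_eK.
have rJ := sm_trans (rexp eI t) sJ; have rK := sm_trans (rexp eI t) sK.
move=> g; rewrite (lieI_rot t sf) (lieI_rot t sI) (lieJ_rot t sf) (lieK_rot t sf).
rewrite (lieB su2_eJ (smZ _ rJ) (smZ _ rK)) (lieD su2_eK (smZ _ rK) (smZ _ rJ)).
rewrite (lieZ _ su2_eJ rJ) (lieZ _ su2_eJ rK) (lieZ _ su2_eK rK) (lieZ _ su2_eK rJ).
rewrite (lieJ_rot t sJ) (lieJ_rot t sK) (lieK_rot t sK) (lieK_rot t sJ).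
rewrite -fE; move: (lie _ (lie _ _) _) (lie eJ (lie eK _) _) (lie eK (lie eJ _) _) (lie eK (lie eK _) _) (lie eI (lie eI _) _).
move=> jj jk kj kk ii.
have cs : (cos (t + t))%:C ^+ 2 + (sin (t + t))%:C ^+ 2 = 1 :> C.
  by rewrite -!rmorphXn -rmorphD /= cos2Dsin2.
rewrite -[jj in RHS]mul1r -[kk in RHS]mul1r -cs; ring.
Qed.

Lemma berger_proj L r f : berger f -> berger (wproj L r f).
Proof.
move=> bf; apply: bergerZ; apply: berger_sum => k; apply: bergerZ; exact: berger_rot.
Qed.

(** The defect of f from having weight x: up to a unit factor, the derivative of s |-> e^{-ixs} f(g
    exp(sI)), which is constant for weight x ([tw_dv]). *)
Definition tw (x : R) f : G -> C := fun g => lie eI f g - 'i%C * x%:C * f g.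

Lemma berger_tw x f : berger f -> berger (tw x f).
Proof.
move=> bf; have -> : tw x f = fun g => lie eI f g + (- ('i%C * x%:C)) * f g.
  by apply/funext => g; rewrite /tw mulNr.
by apply: bergerD; [exact: berger_lieI|exact: bergerZ].
Qed.

Lemma tw_dv x f g t : sm f ->
  is_derive t (1:R) (fun s => Re (cis (- (x * s)) * f (g * rexp eI s)%g)) (Re (cis (- (x * t)) * tw x f (g * rexp eI t)%g)) /\
  is_derive t (1:R) (fun s => Im (cis (- (x * s)) * f (g * rexp eI s)%g)) (Im (cis (- (x * t)) * tw x f (g * rexp eI t)%g)).
Proof.
move=> sf; have [d1 d2] := sm_is_lie sf su2_eI.
have {}d1 := lieR_at su2_eI d1 g t; have {}d2 := lieR_at su2_eI d2 g t.
have dl : is_derive t (1:R) (fun s : R => - (x * s)) (- (x * 1)).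
  by apply: dvN; apply: dvZ; exact: is_derive_id.
have dc := dv_comp (is_derive_cos _) dl; have ds := dv_comp (is_derive_sin _) dl.
split.
  under eq_fun do rewrite cReM /=.
  apply: (is_derive_eq (dvB (dvM dc d1) (dvM ds d2))).
  by rewrite /tw cReM /= !cReD !cImD /=; case: (f _) => p q; case: (lie _ _ _) => p' q' /=; ring.
under eq_fun do rewrite cImM /=.
apply: (is_derive_eq (dvD (dvM dc d2) (dvM ds d1))).
by rewrite /tw cImM /= !cReD !cImD /=; case: (f _) => p q; case: (lie _ _ _) => p' q' /=; ring.
Qed.

Lemma weight_rot x f : sm f -> (forall g, lie eI f g = 'i%C * x%:C * f g) ->
  forall g t, f (g * rexp eI t)%g = cis (x * t) * f g.
Proof.
move=> sf fE g t.
have z g' : tw x f g' = 0 by rewrite /tw fE subrr.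
have e : cis (- (x * t)) * f (g * rexp eI t)%g = cis (- (x * 0)) * f (g * rexp eI 0)%g.
  apply: ReIm_eq; apply: (@is_derive_0_is_cst _ (fun s => _ (cis (- (x * s)) * f (g * rexp eI s)%g))) => s.
    by have [+ _] := tw_dv x g s sf; rewrite z mulr0.
  by have [_ +] := tw_dv x g s sf; rewrite z mulr0.
by rewrite -[LHS]mul1r -(cisN (x * t)) -mulrA e mulr0 oppr0 cis0 mul1r rexp0 ?mulg1//; exact: su2_eI.
Qed.

(** Equal end values give a zero of F1 between 0 and T; between that zero and 0 the function F1
    changes by at most T times the bound on |F2|. *)
Lemma rolle_bound (F F1 F2 : R -> R) (T B : R) : 0 < T ->
  (forall t, is_derive t (1:R) F (F1 t)) -> (forall t, is_derive t (1:R) F1 (F2 t)) ->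
  F T = F 0 -> (forall t, F2 t ^+ 2 <= B) -> F1 0 ^+ 2 <= T ^+ 2 * B.
Proof.
move=> T0 d1 d2 FT F2B.
have [c cT e] := MVT T0 (fun t _ => d1 t) (derivable_within_continuous (fun t _ => @ex_derive _ _ _ _ _ _ _ (d1 t))).
have c0 : F1 c = 0.
  by move: e; rewrite FT subrr subr0 => /esym/eqP; rewrite mulf_eq0 (gt_eqF T0) orbF => /eqP.
have [d _ e2] := mvt_abs d2 c; rewrite c0 sub0r in e2.
rewrite -sqrrN e2 exprMn ler_pM ?sqr_ge0//.
by move: cT; rewrite in_itv /= => /andP[c1 c2]; rewrite ler_pXn2r ?nnegrE ?ltW.
Qed.

Lemma sqn_max f : sm f -> exists m, forall g, sqn (f g) <= sqn (f m).
Proof. by move=> sf; exact: (SU2_max (@sqn_continuous _ sf)). Qed.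

Lemma sqr_Re_le (z : C) : Re z ^+ 2 <= sqn z.
Proof. by rewrite /sqn /dotC expr2 lerDl -expr2 sqr_ge0. Qed.

Lemma sqr_Im_le (z : C) : Im z ^+ 2 <= sqn z.
Proof. by rewrite /sqn /dotC -!expr2 lerDr sqr_ge0. Qed.

Section bounded.
Variable K : R.
Hypothesis K0 : 0 <= K.
Hypothesis bK : forall f, berger f -> forall B, (forall g, sqn (f g) <= B) ->
  forall g, sqn (lie eI f g) <= K * B.

(* Rolle on [0, T] bounds [tw x f] by T times its own derivative along I, which the Bernstein
   estimate bounds by the maximum of [tw x f]; for small T this maximum must be 0. *)
Lemma weight_small (T x : R) f : 0 < T -> 4 * T ^+ 2 * (K + x ^+ 2) < 1 -> berger f ->
  (forall g, f (g * rexp eI T)%g = cis (T * x) * f g) ->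
  forall g, lie eI f g = 'i%C * x%:C * f g.
Proof.
move=> T0 Tx bf fT; have bh := berger_tw x bf; have [sf _] := bf; have [sh _] := bh.
have [m mx] := sqn_max sh.
(* Bernstein for [tw x f], with |a + b|^2 <= 2|a|^2 + 2|b|^2; the other factor 2 in 4 T^2 (K + x^2)
   comes from treating real and imaginary parts separately. *)
have ddB g : sqn (tw x (tw x f) g) <= 2 * (K + x ^+ 2) * sqn (tw x f m).
  have h1 := bK bh mx g; have h2 := mx g.
  have : sqn (tw x (tw x f) g) <= 2 * sqn (lie eI (tw x f) g) + 2 * x ^+ 2 * sqn (tw x f g).
    rewrite {1}/tw; move: (lie _ _ _) (tw x f g) => a b.
    rewrite -subr_ge0 (_ : _ - _ = sqn (a + 'i%C * x%:C * b)); first exact: sqn_ge0.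
    by rewrite /sqn /dotC; case: a => a1 a2; case: b => b1 b2 /=; ring.
  have h3 : x ^+ 2 * sqn (tw x f g) <= x ^+ 2 * sqn (tw x f m) by rewrite ler_wpM2l ?sqr_ge0.
  move: h1 h2 h3; move: (x ^+ 2) => y; lra.
have per : cis (- (x * T)) * f (m * rexp eI T)%g = cis (- (x * 0)) * f (m * rexp eI 0)%g.
  rewrite fT mulr0 oppr0 cis0 rexp0; last exact: su2_eI.
  by rewrite mulg1 mul1r mulrA [cis (- _) * _]mulrC [T * x]mulrC cisN mul1r.
have F0 (F : C -> R) : F (cis (- (x * 0)) * tw x f (m * rexp eI 0)%g) = F (tw x f m).
  by rewrite mulr0 oppr0 cis0 mul1r rexp0 ?mulg1//; exact: su2_eI.
have b1 : Re (tw x f m) ^+ 2 <= T ^+ 2 * (2 * (K + x ^+ 2) * sqn (tw x f m)).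
  rewrite -[in leLHS](F0 (fun z => Re z)).
  apply: (@rolle_bound (fun s => Re (cis (- (x * s)) * f (m * rexp eI s)%g))
     (fun s => Re (cis (- (x * s)) * tw x f (m * rexp eI s)%g))
     (fun s => Re (cis (- (x * s)) * tw x (tw x f) (m * rexp eI s)%g))) => //.
  - by move=> t; have [] := tw_dv x m t sf.
  - by move=> t; have [] := tw_dv x m t sh.
  - by rewrite per.
  - by move=> t; apply: le_trans (sqr_Re_le _) _; rewrite sqn_cis.
have b2 : Im (tw x f m) ^+ 2 <= T ^+ 2 * (2 * (K + x ^+ 2) * sqn (tw x f m)).
  rewrite -[in leLHS](F0 (fun z => Im z)).
  apply: (@rolle_bound (fun s => Im (cis (- (x * s)) * f (m * rexp eI s)%g))
     (fun s => Im (cis (- (x * s)) * tw x f (m * rexp eI s)%g))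
     (fun s => Im (cis (- (x * s)) * tw x (tw x f) (m * rexp eI s)%g))) => //.
  - by move=> t; have [] := tw_dv x m t sf.
  - by move=> t; have [] := tw_dv x m t sh.
  - by rewrite per.
  - by move=> t; apply: le_trans (sqr_Im_le _) _; rewrite sqn_cis.
have b3 : sqn (tw x f m) <= 4 * T ^+ 2 * (K + x ^+ 2) * sqn (tw x f m).
  rewrite {1}/sqn /dotC -!expr2.
  have -> : 4 * T ^+ 2 * (K + x ^+ 2) * sqn (tw x f m) = T ^+ 2 * (2 * (K + x ^+ 2) * sqn (tw x f m)) + T ^+ 2 * (2 * (K + x ^+ 2) * sqn (tw x f m)).
    by ring.
  exact: lerD.
have z : sqn (tw x f m) <= 0.
  rewrite leNgt; apply/negP => p; move: b3; rewrite leNgt => /negP; apply.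
  by rewrite -[ltRHS]mul1r ltr_pM2r.
by move=> g; apply/eqP; rewrite -subr_eq0; apply/eqP/sqn_eq0; exact: le_trans (mx g) z.
Qed.

(** At a maximum m of |f| the rotation changes f(m) by an amount of squared modulus |e^{iTx} - 1|^2
    |f(m)|^2 = 2(1 - cos(Tx)) |f(m)|^2, whereas the mean value theorem with |If|^2 <= K |f(m)|^2
    allows at most 2 T^2 K |f(m)|^2. *)
Lemma weight_large (T x : R) f : T ^+ 2 * K < 1 - cos (T * x) -> berger f ->
  (forall g, f (g * rexp eI T)%g = cis (T * x) * f g) -> forall g, f g = 0.
Proof.
move=> Tx bf fT; have [sf _] := bf; have [m mx] := sqn_max sf.
have [d1 d2] := sm_is_lie sf su2_eI.
have [c1 _ e1] := mvt_lieR su2_eI d1 m T; have [c2 _ e2] := mvt_lieR su2_eI d2 m T.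
have k1 := bK bf mx (m * rexp eI c1)%g; have k2 := bK bf mx (m * rexp eI c2)%g.
have h1 := le_trans (sqr_Re_le _) k1; have h2 := le_trans (sqr_Im_le _) k2.
have E : 2 * (1 - cos (T * x)) * sqn (f m) = T ^+ 2 * (Re (lie eI f (m * rexp eI c1)%g) ^+ 2 + Im (lie eI f (m * rexp eI c2)%g) ^+ 2).
  rewrite [RHS]mulrDr -!exprMn -e1 -e2 fT.
  transitivity ((1 - 2 * cos (T * x) + (cos (T * x) ^+ 2 + sin (T * x) ^+ 2)) * sqn (f m)).
    by rewrite cos2Dsin2; ring.
  by rewrite cReM cImM /sqn /dotC /cis /=; ring.
have z : sqn (f m) <= 0.
  rewrite leNgt; apply/negP => p.
  have q1 : T ^+ 2 * (Re (lie eI f (m * rexp eI c1)%g) ^+ 2 + Im (lie eI f (m * rexp eI c2)%g) ^+ 2) <= T ^+ 2 * (K * sqn (f m) + K * sqn (f m)).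
    by rewrite ler_wpM2l ?sqr_ge0// lerD.
  rewrite -E in q1.
  have : T ^+ 2 * K * sqn (f m) < (1 - cos (T * x)) * sqn (f m) by rewrite ltr_pM2r.
  by lra.
by move=> g; apply: sqn_eq0; exact: le_trans (mx g) z.
Qed.

End bounded.
End berger.

(** 1/8 comes from 1 - cos t = 2 sin^2(t/2) and sin(t/2) >= t/4 near 0, the derivative of sin at 0
    being larger than 1/2. *)
Lemma one_sub_cos_ge : exists2 d : R, 0 < d & forall t, 0 <= t < d -> t ^+ 2 / 8 <= 1 - cos t.
Proof.
have : is_derive (0:R) (1:R) sin (1:R) by rewrite -[1 in X in is_derive _ _ _ X]cos0; exact: is_derive_sin.
move=> /dv_cvg /(cvgr_gt _) /(_ 2^-1) [|]; first by lra.
move=> e /= e0 be; exists (2 * e); first by rewrite mulr_gt0.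
move=> t /andP[t0 te]; have [->|tn] := eqVneq t 0; first by rewrite cos0 expr0n mul0r subrr.
have t20 : 0 < t / 2 by rewrite divr_gt0// lt_def tn.
have s : t / 4 <= sin (t / 2).
  have /= := be (t / 2); rewrite sub0r normrN gtr0_norm// => h.
  have te2 : t / 2 < e by rewrite ltr_pdivrMr// mulrC.
  have := h te2 (lt0r_neq0 t20); rewrite add0r sin0 subr0 ltr_pdivlMl// => h'.
  apply: ltW; apply: le_lt_trans h'; lra.
have c : 1 - cos t = 2 * sin (t / 2) ^+ 2.
  by have e1 := cosD (t / 2) (t / 2); have := cos2Dsin2 (t / 2); rewrite -splitr -!expr2 in e1; lra.
rewrite c; have : (t / 4) ^+ 2 <= sin (t / 2) ^+ 2.
  by rewrite ler_pXn2r// nnegrE ?divr_ge0// (le_trans _ s)// divr_ge0.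
have -> : (t / 4) ^+ 2 = t ^+ 2 / 16 by field.
lra.
Qed.

Lemma tau_lt (e : R) : 0 < e -> exists L0 : nat, forall L, (L0 <= L)%N -> 0 < (tau L : R) < e.
Proof.
move=> e0; exists (Num.bound (2 * pi / e)) => L hL.
have p0 : 0 < 2 * pi :> R by rewrite mulr_gt0// pi_gt0.
have L0 : 0 < L.*2.+1%:R :> R by rewrite ltr0n.
rewrite divr_gt0//= ltr_pdivrMr// [e * _]mulrC -ltr_pdivrMr//.
have h : 0 <= 2 * pi / e by rewrite divr_ge0// ltW.
apply: lt_le_trans (archi_boundP h) _; rewrite ler_nat (leq_trans hL)//.
by rewrite -addnn -addSn; lia.
Qed.

Theorem weight_decomposition (kappa alpha : R) (beta : C) : 0 < kappa ->
  exists L0 : nat, forall L, (L0 <= L)%N -> forall f, berger_eq kappa alpha beta f ->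
  forall r : int, (`|r| <= L)%N ->
  forall g, lie eI (wproj L r f) g = 'i%C * (r%:~R)%:C * wproj L r f g.
Proof.
move=> k0; have [K K0 bK] := bernstein alpha beta k0.
have [d d0 hd] := one_sub_cos_ge.
(* [r0] separates the two regimes: r0^2 > 8K makes tau^2 r0^2 / 8 exceed tau^2 K, as [weight_large]
   requires. *)
pose r0 := (Num.bound (8 * K)).+1.
have r0K : 8 * K < r0%:R ^+ 2.
  have h : 0 <= 8 * K by rewrite mulr_ge0.
  have := archi_boundP h => h1; apply: (lt_trans h1).
  rewrite -natrX ltr_nat /r0; nia.
have r0p : 0 < r0%:R :> R by rewrite ltr0n.
pose Q := K + r0%:R ^+ 2.
have Q0 : 0 < Q by rewrite ltr_wpDl// exprn_gt0.
(* Three demands on tau: [one_sub_cos_ge] applies at tau r0; tau r0 stays in [0, pi], where cos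
   decreases; and 4 tau^2 Q < 1, as [weight_small] requires. *)
pose e := Num.min (d / r0%:R) (Num.min (pi / r0%:R) (4 * Q + 1)^-1).
have [|L0 hL0] := @tau_lt e.
  by rewrite !lt_min !divr_gt0 ?pi_gt0//= invr_gt0 addr_gt0// mulr_gt0.
exists L0 => L hL f bf r rL.
have /andP[t0] := hL0 L hL; rewrite !lt_min => /andP[td /andP[tp tQ]].
have bp := berger_proj L r bf; have rot := proj_rot L r f.
have [rr0|rr0] := leqP `|r| r0.
  apply: (weight_small bK t0 _ bp rot).
  have rr : (r%:~R : R) ^+ 2 <= r0%:R ^+ 2.
    by rewrite -(real_normK (num_real (r%:~R : R))) -intr_norm -natr_absz ler_pXn2r ?nnegrE// ler_nat.
  apply: (@le_lt_trans _ _ (4 * tau L ^+ 2 * Q)).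
    by apply: ler_wpM2l; [rewrite mulr_ge0 ?sqr_ge0|exact: lerD].
  have h1 : tau L * (4 * Q + 1) < 1 by rewrite -ltr_pdivlMr ?div1r// addr_gt0// mulr_gt0.
  have h3 : 0 <= tau L * Q by rewrite mulr_ge0// ltW.
  have aux (a q : R) : 0 < a -> 0 <= a * q -> a * (4 * q + 1) < 1 -> 4 * a ^+ 2 * q < 1.
    move=> a0 aq h; have a1 : a < 1 by move: h; rewrite mulrDr mulr1 mulrCA; lra.
    have : a * (a * q) <= 1 * (a * q) by rewrite ler_wpM2r// ltW.
    by rewrite mul1r => h'; move: h; rewrite mulrDr mulr1 mulrCA expr2 -!mulrA; lra.
  exact: aux.
have z : forall g, wproj L r f g = 0.
  apply: (weight_large bK _ bp rot).
  have ci (s : int) : cos (tau L * s%:~R) = cos (tau L * `|s|%N%:R) :> R.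
    by case: s => n //; rewrite NegzE abszN mulrNz mulrN cosN.
  rewrite ci.
  have hp : tau L * `|r|%N%:R <= pi :> R.
    have h : 2 * `|r|%N%:R <= L.*2.+1%:R :> R by rewrite -natrM ler_nat; lia.
    rewrite (_ : tau L * `|r|%N%:R = pi * (2 * `|r|%N%:R) / L.*2.+1%:R); last by rewrite /tau; ring.
    by rewrite ler_pdivrMr ?ltr0n// ler_pM2l// pi_gt0.
  have h0 : tau L * r0%:R <= pi :> R by rewrite -ler_pdivlMr// ltW.
  have c : cos (tau L * `|r|%N%:R) <= cos (tau L * r0%:R) :> R.
    rewrite leNgt ltr_cos; first by rewrite -leNgt ler_pM2l// ler_nat ltnW.
      by rewrite in_itv /= ?h0 ?hp andbT mulr_ge0// ltW.
    by rewrite in_itv /= ?h0 ?hp andbT mulr_ge0// ltW.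
  have hh : (tau L * r0%:R) ^+ 2 / 8 <= 1 - cos (tau L * r0%:R) :> R.
    by apply: hd; rewrite mulr_ge0 ?ltW//= -ltr_pdivlMr.
  apply: (@lt_le_trans _ _ ((tau L * r0%:R) ^+ 2 / 8)); last by lra.
  rewrite (_ : (tau L * r0%:R) ^+ 2 / 8 = tau L ^+ 2 * (r0%:R ^+ 2 / 8)); last by ring.
  by rewrite ltr_pM2l ?exprn_gt0//; lra.
have -> : wproj L r f = fun=> 0 by apply/funext => g; exact: z.
by move=> g; rewrite lie_cst mulr0.
Qed.

End maximum_principle.

(** * Weight chains *)

Section sl2.
Context {R : realType}.
Local Notation C := R[i].
Local Notation G := (SU2 R).
Local Notation Re := complex.Re.
Local Notation Im := complex.Im.
Implicit Types (f h F : G -> C) (g c : G) (q : int).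

(* [Em] raises the weight by 2 and [Ep] lowers it by 2. *)
Definition Ep f : G -> C := fun g => lie eJ f g + 'i%C * lie eK f g.
Definition Em f : G -> C := fun g => - lie eJ f g + 'i%C * lie eK f g.

Definition wt q f := sm f /\ forall g, lie eI f g = 'i%C * q%:~R * f g.

Lemma sqr_iC : 'i%C * 'i%C = -1 :> C.
Proof. by apply/eqP; rewrite eq_complex /=; apply/andP; split; apply/eqP; ring. Qed.

Lemma sm_Ep f : sm f -> sm (Ep f).
Proof. by move=> sf; apply: smD; [exact: sm_lie su2_eJ|apply: smZ; exact: sm_lie su2_eK]. Qed.

Lemma sm_Em f : sm f -> sm (Em f).
Proof.
move=> sf; rewrite /Em; under eq_fun do rewrite -mulN1r.
by apply: smD; apply: smZ; [exact: sm_lie su2_eJ|exact: sm_lie su2_eK].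
Qed.

Lemma EpD f h : sm f -> sm h -> Ep (fun g => f g + h g) = fun g => Ep f g + Ep h g.
Proof.
move=> sf sh; apply/funext => g.
by rewrite /Ep (lieD su2_eJ sf sh) (lieD su2_eK sf sh); ring.
Qed.

Lemma EmD f h : sm f -> sm h -> Em (fun g => f g + h g) = fun g => Em f g + Em h g.
Proof.
move=> sf sh; apply/funext => g.
by rewrite /Em (lieD su2_eJ sf sh) (lieD su2_eK sf sh); ring.
Qed.

Lemma EpZ (a : C) f : sm f -> Ep (fun g => a * f g) = fun g => a * Ep f g.
Proof.
move=> sf; apply/funext => g.
by rewrite /Ep (lieZ a su2_eJ sf) (lieZ a su2_eK sf); ring.
Qed.

Lemma EmZ (a : C) f : sm f -> Em (fun g => a * f g) = fun g => a * Em f g.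
Proof.
move=> sf; apply/funext => g.
by rewrite /Em (lieZ a su2_eJ sf) (lieZ a su2_eK sf); ring.
Qed.

Lemma Ep0 : Ep (fun=> 0) = fun=> 0.
Proof. by apply/funext => g; rewrite /Ep !lie_cst mulr0 addr0. Qed.

Lemma Em0 : Em (fun=> 0) = fun=> 0.
Proof. by apply/funext => g; rewrite /Em !lie_cst mulr0 addr0 oppr0. Qed.

Lemma lie2 X (a b : C) f h : su2 R X -> sm f -> sm h ->
  lie X (fun g => a * f g + b * h g) = fun g => a * lie X f g + b * lie X h g.
Proof.
move=> sX sf sh; rewrite (lieD sX (smZ a sf) (smZ b sh)).
by rewrite (lieZ a sX sf) (lieZ b sX sh).
Qed.

Lemma EpE f : Ep f = fun g => 1 * lie eJ f g + 'i%C * lie eK f g.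
Proof. by apply/funext => g; rewrite mul1r. Qed.

Lemma EmE f : Em f = fun g => (- 1) * lie eJ f g + 'i%C * lie eK f g.
Proof. by apply/funext => g; rewrite mulN1r. Qed.

Lemma lieIEp f : sm f -> forall g, lie eI (Ep f) g = Ep (lie eI f) g - 2 * 'i%C * Ep f g.
Proof.
move=> sf g; have sJ := sm_lie sf su2_eJ; have sK := sm_lie sf su2_eK.
rewrite EpE (lie2 _ _ su2_eI sJ sK) /Ep.
have -> : lie eI (lie eJ f) g = lie eJ (lie eI f) g + 2 * lie eK f g by rewrite -lie_brIJ//; ring.
have -> : lie eI (lie eK f) g = lie eK (lie eI f) g - 2 * lie eJ f g by rewrite -lie_brKI//; ring.
transitivity (lie eJ (lie eI f) g + 'i%C * lie eK (lie eI f) g - 2 * 'i%C * lie eJ f g - 2 * ('i%C * 'i%C) * lie eK f g); last by ring.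
by rewrite sqr_iC; ring.
Qed.

Lemma lieIEm f : sm f -> forall g, lie eI (Em f) g = Em (lie eI f) g + 2 * 'i%C * Em f g.
Proof.
move=> sf g; have sJ := sm_lie sf su2_eJ; have sK := sm_lie sf su2_eK.
rewrite EmE (lie2 _ _ su2_eI sJ sK) /Em.
have -> : lie eI (lie eJ f) g = lie eJ (lie eI f) g + 2 * lie eK f g by rewrite -lie_brIJ//; ring.
have -> : lie eI (lie eK f) g = lie eK (lie eI f) g - 2 * lie eJ f g by rewrite -lie_brKI//; ring.
transitivity (- lie eJ (lie eI f) g + 'i%C * lie eK (lie eI f) g - 2 * 'i%C * lie eJ f g + 2 * ('i%C * 'i%C) * lie eK f g); last by ring.
by rewrite sqr_iC; ring.
Qed.

Lemma EpEm f : sm f -> forall g, Ep (Em f) g =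
  - (lie eJ (lie eJ f) g + lie eK (lie eK f) g) + 2 * 'i%C * lie eI f g.
Proof.
move=> sf g; have sJ := sm_lie sf su2_eJ; have sK := sm_lie sf su2_eK.
rewrite /Ep EmE (lie2 _ _ su2_eJ sJ sK) (lie2 _ _ su2_eK sJ sK).
have -> : lie eJ (lie eK f) g = lie eK (lie eJ f) g + 2 * lie eI f g by rewrite -lie_brJK//; ring.
transitivity (- lie eJ (lie eJ f) g + ('i%C * 'i%C) * lie eK (lie eK f) g + 2 * 'i%C * lie eI f g); first by ring.
by rewrite sqr_iC; ring.
Qed.

Lemma EmEp f : sm f -> forall g, Em (Ep f) g =
  - (lie eJ (lie eJ f) g + lie eK (lie eK f) g) - 2 * 'i%C * lie eI f g.
Proof.
move=> sf g; have sJ := sm_lie sf su2_eJ; have sK := sm_lie sf su2_eK.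
rewrite /Em EpE (lie2 _ _ su2_eJ sJ sK) (lie2 _ _ su2_eK sJ sK).
have -> : lie eJ (lie eK f) g = lie eK (lie eJ f) g + 2 * lie eI f g by rewrite -lie_brJK//; ring.
transitivity (- lie eJ (lie eJ f) g + ('i%C * 'i%C) * lie eK (lie eK f) g - 2 * 'i%C * lie eI f g); first by ring.
by rewrite sqr_iC; ring.
Qed.

Lemma wt_Ep q f : wt q f -> wt (q - 2) (Ep f).
Proof.
move=> [sf fE]; split; first exact: sm_Ep.
move=> g; rewrite (lieIEp sf); have -> : lie eI f = fun g => 'i%C * q%:~R * f g by apply/funext.
by rewrite EpZ// rmorphB /=; ring.
Qed.

Lemma wt_Em q f : wt q f -> wt (q + 2) (Em f).
Proof.
move=> [sf fE]; split; first exact: sm_Em.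
move=> g; rewrite (lieIEm sf); have -> : lie eI f = fun g => 'i%C * q%:~R * f g by apply/funext.
by rewrite EmZ// rmorphD /=; ring.
Qed.

Lemma wtD q f h : wt q f -> wt q h -> wt q (fun g => f g + h g).
Proof.
move=> [sf fE] [sh hE]; split; first exact: smD.
by move=> g; rewrite (lieD su2_eI sf sh) fE hE; ring.
Qed.

Lemma wtZ q (a : C) f : wt q f -> wt q (fun g => a * f g).
Proof.
move=> [sf fE]; split; first exact: smZ.
by move=> g; rewrite (lieZ a su2_eI sf) fE; ring.
Qed.

Lemma wt_comm q f : wt q f -> forall g, Ep (Em f) g = Em (Ep f) g - 4 * q%:~R * f g.
Proof.
move=> [sf fE] g; rewrite (EpEm sf) (EmEp sf) fE.
transitivity (- (lie eJ (lie eJ f) g + lie eK (lie eK f) g) + 2 * ('i%C * 'i%C) * q%:~R * f g); first by ring.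
transitivity (- (lie eJ (lie eJ f) g + lie eK (lie eK f) g) - 2 * ('i%C * 'i%C) * q%:~R * f g - 4 * q%:~R * f g); last by ring.
by rewrite sqr_iC; ring.
Qed.

(** Ep Em + (q + 1)^2 on weight q is a Casimir operator, hence constant along the chain. *)
Lemma up_chain q (kappa : C) F : wt q F -> (forall g, Ep (Em F) g = kappa * F g) ->
  forall j : nat, wt (q + (2 * j)%N%:Z) (iter j Em F) /\
    forall g, Ep (Em (iter j Em F)) g =
      (kappa + (q%:~R + 1) ^+ 2 - (q%:~R + 1 + 2 * j%:R) ^+ 2) * iter j Em F g.
Proof.
move=> wF FE; elim=> [|j [wj IH]].
  by split=> [|g]; rewrite /= ?muln0 ?addr0// FE mulr0 addr0 addrK.
have w' : wt (q + (2 * j.+1)%N%:Z) (iter j.+1 Em F).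
  by have := wt_Em wj; rewrite -addrA -PoszD; congr (wt (q + Posz _) _); lia.
split=> // g; rewrite (wt_comm w') [iter j.+1 Em F]iterS.
have -> : Ep (Em (iter j Em F)) = fun g => (kappa + (q%:~R + 1) ^+ 2 - (q%:~R + 1 + 2 * j%:R) ^+ 2) * iter j Em F g.
  by apply/funext.
rewrite EmZ; last by have [] := wj.
by rewrite rmorphD /= -[in X in _ - X]pmulrn natrM -natr1; ring.
Qed.

(** Here the same Casimir operator reads Em Ep + (q - 1)^2. *)
Lemma down_chain q (kappa : C) F : wt q F -> (forall g, Em (Ep F) g = kappa * F g) ->
  forall j : nat, wt (q - (2 * j)%N%:Z) (iter j Ep F) /\
    forall g, Em (Ep (iter j Ep F)) g =
      (kappa + (q%:~R - 1) ^+ 2 - (q%:~R - 1 - 2 * j%:R) ^+ 2) * iter j Ep F g.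
Proof.
move=> wF FE; elim=> [|j [wj IH]].
  by split=> [|g]; rewrite /= ?muln0 ?subr0// FE mulr0 subr0 addrK.
have w' : wt (q - (2 * j.+1)%N%:Z) (iter j.+1 Ep F).
  by have := wt_Ep wj; rewrite -addrA -opprD -PoszD; congr (wt (q - Posz _) _); lia.
split=> // g.
have -> : Em (Ep (iter j.+1 Ep F)) g = Ep (Em (iter j.+1 Ep F)) g + 4 * (q - (2 * j.+1)%N%:Z)%:~R * iter j.+1 Ep F g.
  by rewrite (wt_comm w'); ring.
rewrite [iter j.+1 Ep F]iterS.
have -> : Em (Ep (iter j Ep F)) = fun g => (kappa + (q%:~R - 1) ^+ 2 - (q%:~R - 1 - 2 * j%:R) ^+ 2) * iter j Ep F g.
  by apply/funext.
rewrite EpZ; last by have [] := wj.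
by rewrite rmorphB /= -[in X in _ + X]pmulrn natrM -natr1; ring.
Qed.

Lemma chain_end (op : (G -> C) -> G -> C) F : (exists J, forall g, iter J op F g = 0) ->
  (exists g, F g != 0) ->
  exists j, (exists g, iter j op F g != 0) /\ forall g, iter j.+1 op F g = 0.
Proof.
move=> [J FJ] [g0 F0].
have ex : exists j, `[< forall g, iter j op F g = 0 >] by exists J; apply/asboolP.
case: (ex_minnP ex) => -[|m] /asboolP mz min.
  by move: F0; rewrite -[F g0]/(iter 0 op F g0) mz eqxx.
exists m; split => //; apply: contrapT => nz.
have : (m.+1 <= m)%N.
  apply: min; apply/asboolP => g; apply/eqP/negPn/negP => ng; apply: nz.
  by exists g.
by rewrite ltnn.
Qed.

Lemma intC (z : int) : (z%:~R : C) = (z%:~R)%:C.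
Proof. by rewrite -(rmorph_int (real_complex R)). Qed.

Lemma lap_wt q (kappa : C) f : wt q f -> (forall g, Ep (Em f) g = kappa * f g) ->
  forall g, lie eJ (lie eJ f) g + lie eK (lie eK f) g = (- kappa - 2 * q%:~R) * f g.
Proof.
move=> [sf fE] kE g; have := EpEm sf g; rewrite kE fE => e.
have s : 2 * 'i%C * ('i%C * q%:~R * f g) = - 2 * q%:~R * f g :> C.
  transitivity (2 * ('i%C * 'i%C) * q%:~R * f g); first by ring.
  by rewrite sqr_iC; ring.
by rewrite mulrBl mulNr e s; ring.
Qed.

Lemma big_pos (a b : R) : exists J : nat, forall x, J%:R <= x -> 0 < x ^+ 2 - a * x - b.
Proof.
exists (Num.bound (`|a| + `|b|)).+1 => x hx.
have h : 0 <= `|a| + `|b| by rewrite addr_ge0.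
have := archi_boundP h; rewrite -natr1 in hx => h1.
have h2 : a <= `|a| := ler_norm a; have h3 : b <= `|b| := ler_norm b.
have b0 : 0 <= `|b| by []. have a0 : 0 <= `|a| by [].
have x1 : 1 + `|a| + `|b| <= x by lra.
have x0 : 0 <= x by lra.
have : (1 + `|b|) * x <= (x - a) * x by rewrite ler_wpM2r//; lra.
have : (1 + `|b|) * 1 <= (1 + `|b|) * x by rewrite ler_wpM2l//; lra.
rewrite expr2 mulrBl; lra.
Qed.

(** At weight x - 1 of the chain, J^2 + K^2 acts by x^2 - 2x plus a constant ([lap_wt]). Its real
    part is positive for large x, where [lapJK_eq0] applies. *)
Lemma up_term q (kappa : C) F : wt q F -> (forall g, Ep (Em F) g = kappa * F g) ->
  exists J, forall g, iter J Em F g = 0.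
Proof.
move=> wF FE.
have [J0 hJ] := big_pos 2 (Re kappa + (q%:~R + 1) ^+ 2).
exists (J0 + `|q|)%N; set J := (J0 + `|q|)%N.
have [wJ kJ] := up_chain wF FE J.
apply: (lapJK_eq0 _ _ (lap_wt wJ kJ)); first by have [] := wJ.
have /hJ : J0%:R <= (q + (2 * J)%N%:Z + 1)%:~R :> R.
  by rewrite -[J0%:R]/(J0%:Z%:~R) ler_int /J; lia.
suff -> : Re (- (kappa + (q%:~R + 1) ^+ 2 - (q%:~R + 1 + 2 * J%:R) ^+ 2) - 2 * (q + (2 * J)%N%:Z)%:~R) =
  (q + (2 * J)%N%:Z + 1)%:~R ^+ 2 - 2 * (q + (2 * J)%N%:Z + 1)%:~R - (Re kappa + (q%:~R + 1) ^+ 2) + 2.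
  by lra.
have -> : - (kappa + (q%:~R + 1) ^+ 2 - (q%:~R + 1 + 2 * J%:R) ^+ 2) - 2 * (q + (2 * J)%N%:Z)%:~R
  = - kappa + ((q + (2 * J)%N%:Z + 1)%:~R ^+ 2 - 2 * (q + (2 * J)%N%:Z + 1)%:~R - (q%:~R + 1) ^+ 2 + 2 : R)%:C.
  by ring.
by rewrite cReD; case: (kappa) => k1 k2 /=; ring.
Qed.

Lemma down_term q (kappa : C) F : wt q F -> (forall g, Em (Ep F) g = kappa * F g) ->
  exists J, forall g, iter J Ep F g = 0.
Proof.
move=> wF FE.
have [J0 hJ] := big_pos 2 (Re kappa + (q%:~R - 1) ^+ 2).
exists (J0 + `|q|)%N; set J := (J0 + `|q|)%N.
have [wJ kJ] := down_chain wF FE J.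
have kJ' g : Ep (Em (iter J Ep F)) g = (kappa + (q%:~R - 1) ^+ 2 - (q%:~R - 1 - 2 * J%:R) ^+ 2
    - 4 * (q - (2 * J)%N%:Z)%:~R) * iter J Ep F g.
  by rewrite (wt_comm wJ) kJ; ring.
apply: (lapJK_eq0 _ _ (lap_wt wJ kJ')); first by have [] := wJ.
have /hJ : J0%:R <= (- q + (2 * J)%N%:Z + 1)%:~R :> R.
  by rewrite -[J0%:R]/(J0%:Z%:~R) ler_int /J; lia.
suff -> : Re (- (kappa + (q%:~R - 1) ^+ 2 - (q%:~R - 1 - 2 * J%:R) ^+ 2 - 4 * (q - (2 * J)%N%:Z)%:~R) - 2 * (q - (2 * J)%N%:Z)%:~R) =
  (- q + (2 * J)%N%:Z + 1)%:~R ^+ 2 - 2 * (- q + (2 * J)%N%:Z + 1)%:~R - (Re kappa + (q%:~R - 1) ^+ 2) + 2.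
  by lra.
have -> : - (kappa + (q%:~R - 1) ^+ 2 - (q%:~R - 1 - 2 * J%:R) ^+ 2 - 4 * (q - (2 * J)%N%:Z)%:~R) - 2 * (q - (2 * J)%N%:Z)%:~R
  = - kappa + ((- q + (2 * J)%N%:Z + 1)%:~R ^+ 2 - 2 * (- q + (2 * J)%N%:Z + 1)%:~R - (q%:~R - 1) ^+ 2 + 2 : R)%:C.
  by ring.
by rewrite cReD; case: (kappa) => k1 k2 /=; ring.
Qed.

(** The functions lying at weight 2k - n in copies of the irreducible representation of dimension n
    + 1; the scalar is (n + 1)^2 - (2k - n + 1)^2. *)
Definition casimir_eigen (n k : nat) F := wt (2 * k%:Z - n%:Z) F /\
  forall g, Ep (Em F) g = 4 * k.+1%:R * (n - k)%N%:R * F g.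

(** Both chains of a nonzero F stop, after j steps upwards and j' downwards. The Casimir scalar is
    (q + 2j + 1)^2 at the top and (q - 2j' - 1)^2 at the bottom; equality forces q = j' - j, so n =
    j + j' and k = j'. *)
Lemma casimir_ends q (kappa : C) F : wt q F -> (forall g, Ep (Em F) g = kappa * F g) ->
  (exists g, F g != 0) ->
  exists n k : nat, [/\ (k <= n)%N, q = 2 * k%:Z - n%:Z, kappa = 4 * k.+1%:R * (n - k)%N%:R,
    (forall g, iter (n - k).+1 Em F g = 0) & (forall g, iter k.+1 Ep F g = 0)].
Proof.
move=> wF FE Fn.
have FE' g : Em (Ep F) g = (kappa + 4 * q%:~R) * F g.
  by have := wt_comm wF g; rewrite FE => e; rewrite mulrDl e; ring.
have [j [[g1 j1] j2]] := chain_end (up_term wF FE) Fn.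
have [j' [[g2 j3] j4]] := chain_end (down_term wF FE') Fn.
have e1 : kappa + (q%:~R + 1) ^+ 2 - (q%:~R + 1 + 2 * j%:R) ^+ 2 = 0.
  apply: (mulIf j1); rewrite mul0r; have [_ <-] := up_chain wF FE j.
  have -> : Em (iter j Em F) = fun=> 0 by apply/funext.
  by rewrite Ep0.
have e2 : kappa + 4 * q%:~R + (q%:~R - 1) ^+ 2 - (q%:~R - 1 - 2 * j'%:R) ^+ 2 = 0.
  apply: (mulIf j3); rewrite mul0r; have [_ <-] := down_chain wF FE' j'.
  have -> : Ep (iter j' Ep F) = fun=> 0 by apply/funext.
  by rewrite Em0.
have e3 : (q + 1 + 2 * j%:Z) ^+ 2 = (q - 1 - 2 * j'%:Z) ^+ 2.
  apply/eqP; rewrite -(@eqr_int C); apply/eqP.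
  transitivity (kappa + (q%:~R + 1) ^+ 2 - (kappa + (q%:~R + 1) ^+ 2 - (q%:~R + 1 + 2 * j%:R) ^+ 2)).
    by ring.
  by rewrite e1 -e2; ring.
have qE : q = j'%:Z - j%:Z.
  have : (2 * q + 2 * j%:Z - 2 * j'%:Z) * (2 + 2 * j%:Z + 2 * j'%:Z) = 0.
    transitivity ((q + 1 + 2 * j%:Z) ^+ 2 - (q - 1 - 2 * j'%:Z) ^+ 2); first by ring.
    by rewrite e3 subrr.
  by move=> /eqP; rewrite mulf_eq0 => /orP[/eqP|/eqP]; lia.
exists (j + j')%N, j'; rewrite addnK; split => //; first by lia.
  by rewrite qE; lia.
have -> : kappa = (q%:~R + 1 + 2 * j%:R) ^+ 2 - (q%:~R + 1) ^+ 2.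
  by apply/eqP; rewrite -subr_eq0 -e1; apply/eqP; ring.
by rewrite qE; ring.
Qed.

(** * Uniqueness from derivatives at 1 *)

Lemma lieR_const (u : G -> R) : is_lieR eI u (fun=> 0) -> is_lieR eJ u (fun=> 0) ->
  forall g, u g = u 1%g.
Proof.
move=> dI dJ g.
have cst X (x : G) t : su2 R X -> is_lieR X u (fun=> 0) -> u (x * rexp X t)%g = u x.
  move=> sX dX; have := @is_derive_0_is_cst _ (fun s => u (x * rexp X s)%g) t 0 (lieR_at sX dX x).
  by rewrite rexp0// mulg1.
have [s [t [v [_ _ _ ->]]]] := euler g.
rewrite (cst eI) ?(cst eJ)//; try exact: su2_eI; try exact: su2_eJ.
by rewrite -[rexp eI s]mul1g (cst eI)//; exact: su2_eI.
Qed.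

Lemma is_lieR_sum X n (u u' : 'I_n -> G -> R) : (forall i, is_lieR X (u i) (u' i)) ->
  is_lieR X (fun g => \sum_(i < n) u i g) (fun g => \sum_(i < n) u' i g).
Proof.
elim: n u u' => [|n IH] u u' du g.
  rewrite big_ord0; have -> : (fun t => \sum_(i < 0) u i (g * rexp X t)%g) = fun=> 0.
    by apply/funext => t; rewrite big_ord0.
  exact: dvC.
rewrite big_ord_recl; have -> : (fun t => \sum_(i < n.+1) u i (g * rexp X t)%g) =
    fun t => u ord0 (g * rexp X t)%g + \sum_(i < n) u (lift ord0 i) (g * rexp X t)%g.
  by apply/funext => t; rewrite big_ord_recl.
apply: dvD; first exact: du.
by apply: (IH (fun i => u (lift ord0 i)) (fun i => u' (lift ord0 i))) => i; exact: du.
Qed.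

Lemma lieJ_EpEm f g : lie eJ f g = 2^-1 * (Ep f g - Em f g).
Proof. by rewrite /Ep /Em; field. Qed.

Lemma dotCC (a b : C) : dotC a b = dotC b a.
Proof. by rewrite /dotC; ring. Qed.

(* The functions y_l = Ep^l h span a finite-dimensional su(2)-module carrying an invariant
   Hermitian form; the sum S below is the corresponding invariant norm, hence constant. *)
Lemma highest_weight_uniq n h : wt n%:Z h -> (forall g, Em h g = 0) ->
  (forall g, iter n.+1 Ep h g = 0) -> (forall l, (l <= n)%N -> iter l Ep h 1%g = 0) ->
  forall g, h g = 0.
Proof.
move=> wh Emh Eph h1.
pose y l := iter l Ep h.
pose k l : R := 4 * l.+1%:R * (n - l)%N%:R.
(* Chosen so that alpha_l = alpha_{l+1} k_l: in the derivative of [S] along J the Ep-term of index l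
   then cancels the Em-term of index l + 1. *)
pose alpha l : R := \prod_(m < l) (k m)^-1.
have FE g : Em (Ep h) g = (4 * n%:R) * h g.
  have := wt_comm wh g; have -> : Em h = fun=> 0 by apply/funext.
  by rewrite Ep0 => e; rewrite -[LHS]subr0 e -pmulrn; ring.
have wy l : wt (n%:Z - (2 * l)%N%:Z) (y l) by have [] := down_chain wh FE l.
have sy l : sm (y l) by have [] := wy l.
have Emy l g : (l < n)%N -> Em (y l.+1) g = (k l)%:C * y l g.
  move=> ln; have [_ /(_ g) E] := down_chain wh FE l.
  rewrite /y iterS E; congr (_ * _).
  by rewrite /k !rmorphM /= !rmorph_nat natrB ?(ltnW ln)// -natr1; ring.
have k0 l : (l < n)%N -> k l != 0.
  by move=> ln; rewrite /k !mulf_neq0// pnatr_eq0// -lt0n subn_gt0.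
have ak l : (l < n)%N -> alpha l = alpha l.+1 * k l.
  by move=> ln; rewrite /alpha big_ord_recr /= mulfVK// k0.
have a0 l : (l <= n)%N -> 0 < alpha l.
  move=> ln; apply: prodr_gt0 => m _; rewrite invr_gt0 !mulr_gt0// ?ltr0n// subn_gt0.
  exact: leq_trans (ltn_ord m) ln.
pose S g := \sum_(l < n.+1) alpha l * sqn (y l g).
have yn g : y n.+1 g = 0 by exact: Eph.
have y0 g : Em (y 0%N) g = 0 by exact: Emh.
have dS X : su2 R X -> is_lieR X S (fun g => \sum_(l < n.+1) alpha l * (2 * dotC (y l g) (lie X (y l) g))).
  by move=> sX; apply: is_lieR_sum => l; apply: is_lieRZ; exact: sqn_lie1.
(* Along I each [y l] changes only its phase. *)
have dSI : is_lieR eI S (fun=> 0).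
  apply: (is_lieR_eq (dS _ su2_eI)) => g; apply: big1 => l _.
  have [_ ->] := wy l; rewrite intC; move: (_%:~R) (y l g) => x [p r].
  by rewrite /dotC /=; ring.
have dSJ : is_lieR eJ S (fun=> 0).
  apply: (is_lieR_eq (dS _ su2_eJ)) => g.
  have -> : \sum_(l < n.+1) alpha l * (2 * dotC (y l g) (lie eJ (y l) g)) =
      \sum_(l < n.+1) alpha l * dotC (y l g) (y l.+1 g) - \sum_(l < n.+1) alpha l * dotC (y l g) (Em (y l) g).
    rewrite -sumrB; apply: eq_bigr => l _; rewrite lieJ_EpEm -[Ep (y l)]/(y l.+1).
    move: (y l g) (y l.+1 g) (Em (y l) g) => [p r] [p' r'] [p'' r''].
    have -> : 2^-1 = (2^-1)%:C :> C by rewrite fmorphV rmorph_nat.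
    by rewrite /dotC /=; field.
  have d0 (a : C) : dotC a 0 = 0 by rewrite /dotC /= !mulr0 addr0.
  have -> : \sum_(l < n.+1) alpha l * dotC (y l g) (y l.+1 g) = \sum_(l < n) alpha l * dotC (y l g) (y l.+1 g).
    rewrite big_ord_recr; transitivity (\sum_(l < n) alpha l * dotC (y l g) (y l.+1 g) + alpha n * dotC (y n g) (y n.+1 g)) => //.
    by rewrite yn d0 mulr0 addr0.
  have -> : \sum_(l < n.+1) alpha l * dotC (y l g) (Em (y l) g) = \sum_(l < n) alpha l.+1 * dotC (y l.+1 g) (Em (y l.+1) g).
    rewrite big_ord_recl; transitivity (alpha 0%N * dotC (y 0%N g) (Em (y 0%N) g) + \sum_(l < n) alpha l.+1 * dotC (y l.+1 g) (Em (y l.+1) g)) => //.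
    by rewrite y0 d0 mulr0 add0r.
  rewrite -sumrB; apply: big1 => l _.
  by rewrite (Emy _ _ (ltn_ord l)) dotC_mulr [dotC (y l.+1 g) _]dotCC (ak _ (ltn_ord l)); ring.
have S0 g : S g = 0.
  rewrite (lieR_const dSI dSJ) /S; apply: big1 => l _.
  have sq0 : sqn (0 : C) = 0 by rewrite /sqn /dotC /= !mulr0 addr0.
  have -> : y l 1%g = 0 by apply: h1; rewrite -ltnS.
  by rewrite sq0 mulr0.
move=> g; have := S0 g; rewrite /S big_ord_recl /= /alpha big_ord0 mul1r => /eqP.
rewrite paddr_eq0 ?sqn_ge0//; last first.
  by apply: sumr_ge0 => l _; rewrite mulr_ge0 ?sqn_ge0// ltW// a0// ltn_ord.
by move=> /andP[/eqP s0 _]; apply: sqn_eq0; rewrite -[h]/(y 0%N) s0.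
Qed.

Lemma sm_iterEp j f : sm f -> sm (iter j Ep f).
Proof. by move=> sf; elim: j => //= j; exact: sm_Ep. Qed.

Lemma sm_iterEm j f : sm f -> sm (iter j Em f).
Proof. by move=> sf; elim: j => //= j; exact: sm_Em. Qed.

Lemma iterEpZ j (a : C) f : sm f -> iter j Ep (fun g => a * f g) = fun g => a * iter j Ep f g.
Proof. by move=> sf; elim: j => //= j ->; rewrite EpZ//; exact: sm_iterEp. Qed.

Lemma iterEmZ j (a : C) f : sm f -> iter j Em (fun g => a * f g) = fun g => a * iter j Em f g.
Proof. by move=> sf; elim: j => //= j ->; rewrite EmZ//; exact: sm_iterEm. Qed.

Lemma iterEpD j f h : sm f -> sm h ->
  iter j Ep (fun g => f g + h g) = fun g => iter j Ep f g + iter j Ep h g.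
Proof. by move=> sf sh; elim: j => //= j ->; rewrite EpD//; exact: sm_iterEp. Qed.

Lemma iterEmD j f h : sm f -> sm h ->
  iter j Em (fun g => f g + h g) = fun g => iter j Em f g + iter j Em h g.
Proof. by move=> sf sh; elim: j => //= j ->; rewrite EmD//; exact: sm_iterEm. Qed.

Lemma casimir_uniq n k F : (k <= n)%N -> casimir_eigen n k F ->
  (forall l, (l <= n)%N -> iter l Ep (iter (n - k) Em F) 1%g = 0) ->
  forall g, F g = 0.
Proof.
move=> kn [wF FE] F1; apply: contrapT => /existsNP[g0 /eqP Fg0].
have sF : sm F by have [] := wF.
have [n' [k' [kn' qE kE e1 e2]]] := casimir_ends wF FE (ex_intro _ g0 Fg0).
(* The weight 2k - n and the scalar 4(k + 1)(n - k) determine n and k; this transfers the vanishing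
   at both ends of the chain to the given n and k. *)
have [En Ek] : n' = n /\ k' = k.
  have E : (k.+1 * (n - k) = k'.+1 * (n' - k'))%N.
    apply/eqP; rewrite -(eqn_pmul2l (isT : (0 < 4)%N)) !mulnA -(@eqr_nat C) !natrM; apply/eqP; exact: kE.
  have : (n + k' * 2 = n' + k * 2)%N by lia.
  have [m ->] : exists m, n = (k + m)%N by exists (n - k)%N; rewrite subnKC.
  have [m' En'] : exists m', n' = (k' + m')%N by exists (n' - k')%N; rewrite subnKC.
  nia.
subst n' k'.
(* The scalar of Ep Em on the m-th raised function; it equals 4(k + m + 1)(n - k - m), nonzero below
   the top. *)
pose km m : C := 4 * k.+1%:R * (n - k)%N%:R + ((2 * k%:Z - n%:Z)%:~R + 1) ^+ 2 - ((2 * k%:Z - n%:Z)%:~R + 1 + 2 * m%:R) ^+ 2.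
have km0 (m : nat) : (m < n - k)%N -> km m != 0.
  move=> mn; have [e nE] : exists e, n = (k + (m + e.+1))%N by exists (n - k - m).-1; lia.
  have -> : km m = (4 * (k + m).+1 * e.+1)%N%:R.
    by rewrite /km nE addKn; ring.
  by rewrite pnatr_eq0 !muln_eq0.
have EpEmj : iter (n - k) Ep (iter (n - k) Em F) = fun g => \prod_(m < n - k) km m * F g.
  elim: (n - k)%N => [|j IH]; first by apply/funext => g; rewrite big_ord0 mul1r.
  rewrite iterSr iterS.
  have -> : Ep (Em (iter j Em F)) = fun g => km j * iter j Em F g.
    by apply/funext => g; have [_ ->] := up_chain wF FE j.
  rewrite iterEpZ; last exact: sm_iterEm.
  by rewrite IH; apply/funext => g; rewrite big_ord_recr /=; ring.
set h := iter (n - k) Em F.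
have q0 : forall g, h g = 0.
  apply: (@highest_weight_uniq n) => //.
  - have [+ _] := up_chain wF FE (n - k); rewrite -/h.
    by have -> : 2 * k%:Z - n%:Z + (2 * (n - k))%N%:Z = n%:Z by lia.
  - move=> g; have -> : n.+1 = (k.+1 + (n - k))%N by lia.
    rewrite iterD EpEmj iterEpZ// e2 mulr0//.
have := EpEmj; rewrite -/h; have -> : h = fun=> 0 by apply/funext.
have E0 j : iter j Ep (fun=> 0) = (fun=> 0 : C) :> (G -> C) by elim: j => //= j ->; exact: Ep0.
rewrite E0 => /(congr1 (fun f => f g0)) /esym/eqP; rewrite mulf_eq0 (negbTE Fg0) orbF.
by apply/negP/prodf_neq0 => m _; exact: km0 (ltn_ord m).
Qed.

(** * Matrix coefficients *)

Lemma smC_mono k f : smC k.+1 f -> smC k f.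
Proof.
elim: k f => [|k IH] f [cf df] //; split=> // X sX.
by have [f' df' sf'] := df X sX; exists f' => //; exact: IH.
Qed.

Lemma smCD k f h : smC k f -> smC k h -> smC k (fun g => f g + h g).
Proof.
elim: k f h => [|k IH] f h /=; first exact: contD.
move=> [cf df] [ch dh]; split; first exact: contD.
move=> X sX; have [f' df' sf'] := df X sX; have [h' dh' sh'] := dh X sX.
by exists (fun g => f' g + h' g); [exact: is_lieD|exact: IH].
Qed.

Lemma smCM k f h : smC k f -> smC k h -> smC k (fun g => f g * h g).
Proof.
elim: k f h => [|k IH] f h; first exact: contM.
move=> sf sh; have mf := smC_mono sf; have mh := smC_mono sh.
case: sf => [cf df]; case: sh => [ch dh]; split; first exact: contM.
move=> X sX; have [f' df' sf'] := df X sX; have [h' dh' sh'] := dh X sX.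
by exists (fun g => f' g * h g + f g * h' g); [exact: is_lieM|apply: smCD; exact: IH].
Qed.

Lemma smM f h : sm f -> sm h -> sm (fun g => f g * h g).
Proof. by move=> sf sh k; exact: smCM. Qed.

Lemma SU2_mulE g c : SU2val (g * c)%g = SU2val g *m SU2val c.
Proof. by []. Qed.

Lemma entry_lie X (i j : 'I_2) : su2 R X ->
  is_lie X (fun g => SU2val g i j) (fun g => (SU2val g *m X) i j).
Proof.
move=> /su2vE[x [y [z ->]]]; have [r [x' [y' [z' [-> -> -> n1]]]]] := su2v_polar x y z.
rewrite su2v_scale.
have E g t : SU2val (g * rexp (r%:C *: su2v x' y' z') t)%g i j =
    (cos (t * r))%:C * SU2val g i j + (sin (t * r))%:C * (SU2val g *m su2v x' y' z') i j.
  rewrite rexpZ SU2_mulE rexp_unit//.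
  have -> : quat (cos (t * r)) (sin (t * r) * x') (sin (t * r) * y') (sin (t * r) * z') =
    (cos (t * r))%:C *: 1%:M + (sin (t * r))%:C *: su2v x' y' z'.
    by rewrite scalemx1 quatr /su2v quat_scale quat_add; congr quat; ring.
  by rewrite mulmxDr -!scalemxAr mulmx1 !mxE.
have E2 g : (SU2val g *m (r%:C *: su2v x' y' z')) i j = r%:C * (SU2val g *m su2v x' y' z') i j.
  by rewrite -scalemxAr [LHS]mxE.
have dr : is_derive (0:R) (1:R) (fun t => t * r) (0 * 0 + r * 1).
  exact: (dvM (is_derive_id _ _) (dvC r 0)).
have dc := dv_comp (is_derive_cos _) dr; have ds := dv_comp (is_derive_sin _) dr.
split=> g.
  have -> : (fun t => Re (SU2val (g * rexp (r%:C *: su2v x' y' z') t)%g i j)) =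
     fun t => cos (t * r) * Re (SU2val g i j) + sin (t * r) * Re ((SU2val g *m su2v x' y' z') i j).
    by apply/funext => t; rewrite E cReD !cReM /=; ring.
  apply: (is_derive_eq (dvD (dvM dc (dvC _ _)) (dvM ds (dvC _ _)))).
  by rewrite E2 cReM /= mul0r sin0 cos0; ring.
have -> : (fun t => Im (SU2val (g * rexp (r%:C *: su2v x' y' z') t)%g i j)) =
   fun t => cos (t * r) * Im (SU2val g i j) + sin (t * r) * Im ((SU2val g *m su2v x' y' z') i j).
  by apply/funext => t; rewrite E cImD !cImM /=; ring.
apply: (is_derive_eq (dvD (dvM dc (dvC _ _)) (dvM ds (dvC _ _)))).
by rewrite E2 cImM /= mul0r sin0 cos0; ring.
Qed.

Lemma entry_cont (i j : 'I_2) : cont (fun g => SU2val g i j).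
Proof.
have h g : SU2val x i j @[x --> g] --> SU2val g i j.
  apply: (@continuous_comp _ _ _ (@SU2val R : G -> 'M[C]_2) (fun M : 'M[C]_2 => M i j)).
    exact: SU2_continuous.
  exact: coord_continuous.
by split=> g; have [h1 h2] := (cvg_ReIm _ _).1 (h g).
Qed.

Lemma sm_entry (i j : 'I_2) : sm (fun g => SU2val g i j).
Proof.
move=> k; elim: k i j => [|k IH] i j; first exact: entry_cont.
split; [exact: entry_cont|move=> X sX; exists (fun g => (SU2val g *m X) i j); first exact: entry_lie].
have -> : (fun g => (SU2val g *m X) i j) = fun g => SU2val g i 0 * X 0 j + SU2val g i 1 * X 1 j.
  by apply/funext => g; rewrite !mxE !big_ord_recl big_ord0 addr0; congr (_ + _ * _); congr (_ _ _); apply: val_inj.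
by apply: smCD; apply: smCM => //; exact: smC_cst.
Qed.

(** Coefficientwise, so that the product and power rules for polynomials yield the derivatives of
    all matrix coefficients at once. *)
Definition smP (P : G -> {poly C}) := forall i, sm (fun g => (P g)`_i).
Definition is_lieP X (P P' : G -> {poly C}) := forall i, is_lie X (fun g => (P g)`_i) (fun g => (P' g)`_i).

Lemma smPM P Q : smP P -> smP Q -> smP (fun g => P g * Q g).
Proof.
move=> sP sQ i; have -> : (fun g => (P g * Q g)`_i) = fun g => \sum_(j < i.+1) (P g)`_j * (Q g)`_(i - j).
  by apply/funext => g; rewrite coefM.
by apply: sm_sum => j; exact: smM.
Qed.

Lemma is_lie_sum X n (F F' : 'I_n -> G -> C) : (forall i, is_lie X (F i) (F' i)) ->
  is_lie X (fun g => \sum_(i < n) F i g) (fun g => \sum_(i < n) F' i g).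
Proof.
elim: n F F' => [|n IH] F F' dF.
  have -> : (fun g => \sum_(i < 0) F i g) = fun=> 0 by apply/funext => g; rewrite big_ord0.
  have -> : (fun g => \sum_(i < 0) F' i g) = fun=> 0 by apply/funext => g; rewrite big_ord0.
  exact: is_lie_cst.
have E (H : 'I_n.+1 -> G -> C) : (fun g => \sum_(i < n.+1) H i g) =
    fun g => H ord0 g + \sum_(i < n) H (lift ord0 i) g.
  by apply/funext => g; rewrite big_ord_recl.
by rewrite !E; apply: is_lieD => //; exact: (IH (fun i => F (lift ord0 i)) (fun i => F' (lift ord0 i))).
Qed.

Lemma is_liePM X P P' Q Q' : su2 R X -> is_lieP X P P' -> is_lieP X Q Q' ->
  is_lieP X (fun g => P g * Q g) (fun g => P' g * Q g + P g * Q' g).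
Proof.
move=> sX dP dQ i.
have -> : (fun g => (P g * Q g)`_i) = fun g => \sum_(j < i.+1) (P g)`_j * (Q g)`_(i - j).
  by apply/funext => g; rewrite coefM.
have -> : (fun g => (P' g * Q g + P g * Q' g)`_i) = fun g => \sum_(j < i.+1) ((P' g)`_j * (Q g)`_(i - j) + (P g)`_j * (Q' g)`_(i - j)).
  by apply/funext => g; rewrite coefD !coefM big_split.
by apply: is_lie_sum => j; exact: is_lieM.
Qed.

Lemma smPX P n : smP P -> smP (fun g => P g ^+ n).
Proof.
move=> sP; elim: n => [|n IH].
  have -> : (fun g => P g ^+ 0) = fun=> 1 by apply/funext.
  by move=> i; exact: sm_cst.
have -> : (fun g => P g ^+ n.+1) = fun g => P g * P g ^+ n by apply/funext => g; rewrite exprS.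
exact: smPM.
Qed.

Lemma is_liePX X P P' n : su2 R X -> is_lieP X P P' ->
  is_lieP X (fun g => P g ^+ n) (fun g => n%:R * P g ^+ n.-1 * P' g).
Proof.
move=> sX dP; elim: n => [|n IH].
  move=> i; have -> : (fun g => (P g ^+ 0)`_i) = fun=> (1 : {poly C})`_i by apply/funext.
  have -> : (fun g => (0%:R * P g ^+ 0.-1 * P' g)`_i) = fun=> 0 by apply/funext => g; rewrite !mul0r coef0.
  exact: is_lie_cst.
have -> : (fun g => P g ^+ n.+1) = fun g => P g * P g ^+ n by apply/funext => g; rewrite exprS.
have -> : (fun g => n.+1%:R * P g ^+ n.+1.-1 * P' g) = fun g => P' g * P g ^+ n + P g * (n%:R * P g ^+ n.-1 * P' g).
  apply/funext => g; case: n {IH} => [|n] /=; first by rewrite expr0; ring.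
  by rewrite -natr1 exprS; ring.
exact: is_liePM.
Qed.

Definition pA g : {poly C} := (SU2val g 0 0)%:P * 'X + (SU2val g 1 0)%:P.
Definition pB g : {poly C} := (SU2val g 0 1)%:P * 'X + (SU2val g 1 1)%:P.
(* Matrix coefficients of the representation of SU(2) on binary forms of degree k + m. *)
Definition mcoef (k m i : nat) g : C := (pA g ^+ k * pB g ^+ m)`_i.

Lemma lin_coef (a b : C) i : (a%:P * 'X + b%:P)`_i = a * (i == 1%N)%:R + b * (i == 0%N)%:R.
Proof. by rewrite coefD coefCM coefX coefC; case: (i == 0%N); rewrite ?mulr1 ?mulr0. Qed.

Lemma sm_pA : smP pA.
Proof.
move=> i; have -> : (fun g => (pA g)`_i) = fun g => (i == 1%N)%:R * SU2val g 0 0 + (i == 0%N)%:R * SU2val g 1 0.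
  by apply/funext => g; rewrite lin_coef; ring.
by apply: smD; apply: smZ; exact: sm_entry.
Qed.

Lemma sm_pB : smP pB.
Proof.
move=> i; have -> : (fun g => (pB g)`_i) = fun g => (i == 1%N)%:R * SU2val g 0 1 + (i == 0%N)%:R * SU2val g 1 1.
  by apply/funext => g; rewrite lin_coef; ring.
by apply: smD; apply: smZ; exact: sm_entry.
Qed.

Lemma sm_mcoef k m i : sm (mcoef k m i).
Proof. by apply: smPM; apply: smPX; [exact: sm_pA|exact: sm_pB]. Qed.

Lemma lin_lie X (j : 'I_2) : su2 R X ->
  is_lieP X (fun g => (SU2val g 0 j)%:P * 'X + (SU2val g 1 j)%:P)
    (fun g => ((SU2val g *m X) 0 j)%:P * 'X + ((SU2val g *m X) 1 j)%:P).
Proof.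
move=> sX i.
have E (a b : G -> C) : (fun g => ((a g)%:P * 'X + (b g)%:P)`_i) = fun g => (i == 1%N)%:R * a g + (i == 0%N)%:R * b g.
  by apply/funext => g; rewrite lin_coef; ring.
rewrite !E; apply: is_lieD; apply: is_lieZ => //; exact: entry_lie.
Qed.

Lemma pAB_lie X (a b c d : C) : su2 R X -> X = mx2 a b c d ->
  is_lieP X pA (fun g => a%:P * pA g + c%:P * pB g) /\ is_lieP X pB (fun g => b%:P * pA g + d%:P * pB g).
Proof.
move=> sX XE.
have mE g i : ((SU2val g *m X) i 0 = SU2val g i 0 * a + SU2val g i 1 * c) *
   ((SU2val g *m X) i 1 = SU2val g i 0 * b + SU2val g i 1 * d).
  split; rewrite XE !mxE !big_ord_recl big_ord0 addr0 !mxE /=; congr (_ + SU2val g _ _ * _); exact: val_inj.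
have E (p q x y x' y' : C) : (x * p + y * q)%:P * 'X + (x' * p + y' * q)%:P =
   p%:P * (x%:P * 'X + x'%:P) + q%:P * (y%:P * 'X + y'%:P).
  by rewrite !polyCD !polyCM; ring.
split=> i.
  have := lin_lie 0 sX i; have -> // : (fun g => (((SU2val g *m X) 0 0)%:P * 'X + ((SU2val g *m X) 1 0)%:P)`_i) = (fun g => (a%:P * pA g + c%:P * pB g)`_i).
  by apply/funext => g; rewrite !mE E.
have := lin_lie 1 sX i; have -> // : (fun g => (((SU2val g *m X) 0 1)%:P * 'X + ((SU2val g *m X) 1 1)%:P)`_i) = (fun g => (b%:P * pA g + d%:P * pB g)`_i).
by apply/funext => g; rewrite !mE E.
Qed.

(** X sends A = [pA] to aA + cB and B = [pB] to bA + dB, so this is the product rule for A^k B^m.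
    For k = 0 or m = 0 the truncated predecessor comes with the factor 0. *)
Lemma mcoef_lie X (a b c d : C) k m i : su2 R X -> X = mx2 a b c d ->
  lie X (mcoef k m i) = fun g => (a * k%:R + d * m%:R) * mcoef k m i g
    + c * k%:R * mcoef k.-1 m.+1 i g + b * m%:R * mcoef k.+1 m.-1 i g.
Proof.
move=> sX XE; have [dA dB] := pAB_lie sX XE; apply: is_lie_lie.
apply: (is_lie_eq (is_liePM sX (is_liePX k sX dA) (is_liePX m sX dB) i)) => g.
rewrite /mcoef; move: (pA g) (pB g) => A B.
have E (z : C) (p : {poly C}) : (z%:P * p)`_i = z * p`_i by exact: coefCM.
rewrite -!E -!coefD; apply: (congr1 (fun p : {poly C} => p`_i)); rewrite !polyCD !polyCM !polyC_natr.
case: k => [|k]; case: m => [|m] /=; rewrite ?exprS; ring.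
Qed.

Lemma eI_mx : eI = mx2 'i%C 0 0 (- 'i%C) :> 'M[C]_2.
Proof. by rewrite /eI /su2v /quat; congr mx2; apply: ReIm_eq => /=; ring. Qed.
Lemma eJ_mx : eJ = mx2 0 1 (- 1) 0 :> 'M[C]_2.
Proof. by rewrite /eJ /su2v /quat; congr mx2; apply: ReIm_eq => /=; ring. Qed.
Lemma eK_mx : eK = mx2 0 'i%C 'i%C 0 :> 'M[C]_2.
Proof. by rewrite /eK /su2v /quat; congr mx2; apply: ReIm_eq => /=; ring. Qed.

Lemma wt_mcoef k m i : wt (k%:Z - m%:Z) (mcoef k m i).
Proof.
split; first exact: sm_mcoef.
by move=> g; rewrite (mcoef_lie k m i su2_eI eI_mx); ring.
Qed.

Lemma Ep_mcoef k m i : Ep (mcoef k m i) = fun g => - 2 * k%:R * mcoef k.-1 m.+1 i g.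
Proof.
apply/funext => g; rewrite /Ep (mcoef_lie k m i su2_eJ eJ_mx) (mcoef_lie k m i su2_eK eK_mx).
move: (mcoef k m i g) (mcoef k.-1 m.+1 i g) (mcoef k.+1 m.-1 i g) => x y z.
transitivity (('i%C * 'i%C - 1) * k%:R * y + ('i%C * 'i%C + 1) * m%:R * z); first by ring.
by rewrite sqr_iC; ring.
Qed.

Lemma Em_mcoef k m i : Em (mcoef k m i) = fun g => - 2 * m%:R * mcoef k.+1 m.-1 i g.
Proof.
apply/funext => g; rewrite /Em (mcoef_lie k m i su2_eJ eJ_mx) (mcoef_lie k m i su2_eK eK_mx).
move: (mcoef k m i g) (mcoef k.-1 m.+1 i g) (mcoef k.+1 m.-1 i g) => x y z.
transitivity (('i%C * 'i%C + 1) * k%:R * y + ('i%C * 'i%C - 1) * m%:R * z); first by ring.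
by rewrite sqr_iC; ring.
Qed.

Lemma casimir_mcoef k m i : casimir_eigen (k + m) k (mcoef k m i).
Proof.
split; first by have := wt_mcoef k m i; congr wt; lia.
move=> g; rewrite Em_mcoef EpZ; last exact: sm_mcoef.
rewrite Ep_mcoef addKn; case: m => [|m] /=; first by rewrite !mulr0 !mul0r.
by ring.
Qed.

(** At 1 the forms [pA] and [pB] are the monomials X and 1; this makes the jets below diagonal. *)
Lemma mcoef1 k m i : mcoef k m i 1%g = (i == k)%:R.
Proof.
have e : SU2val (1%g : G) = 1%:M by [].
by rewrite /mcoef /pA /pB e !mxE /= mulr1n mulr0n polyC1 polyC0 mul1r addr0 mul0r add0r expr1n mulr1 coefXn.
Qed.

Definition gJ : G := MkSU2 Jmx_SU2.

Lemma mcoef_gJ k m i g : mcoef k m i (g * gJ)%g = (-1) ^+ k * mcoef m k i g.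
Proof.
have E j : (SU2val (g * gJ)%g j 0 = - SU2val g j 1) * (SU2val (g * gJ)%g j 1 = SU2val g j 0).
  split; rewrite -[SU2val _]/(SU2val g *m Jmx) !mxE !big_ord_recl big_ord0 !mxE /= ?mulr0 ?mulr1 ?addr0 ?add0r ?mulrN1 //.
  by congr (- SU2val g _ _); apply: val_inj.
have eA : pA (g * gJ)%g = - pB g by rewrite /pA /pB !E !polyCN; ring.
have eB : pB (g * gJ)%g = pA g by rewrite /pA /pB !E.
rewrite /mcoef eA eB; have -> : (- pB g) ^+ k * pA g ^+ m = ((-1) ^+ k)%:P * (pA g ^+ m * pB g ^+ k).
  have -> : ((-1) ^+ k)%:P = (-1) ^+ k :> {poly C}.
    by elim: (k) => [|n IH]; rewrite ?expr0 ?exprS ?polyCM ?IH ?polyCN ?polyC1.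
  by rewrite [(- pB g) ^+ k]exprNn -mulrA [pB g ^+ k * _]mulrC.
exact: coefCM.
Qed.

Lemma iterEm_mcoef k m j : (j <= m)%N -> exists2 a : C, a != 0 &
  forall i, iter j Em (mcoef k m i) = fun g : G => a * mcoef (k + j) (m - j) i g.
Proof.
elim: j => [|j IH] jm.
  by exists 1 => [|i]; rewrite ?oner_eq0//= addn0 subn0; apply/funext => g; rewrite mul1r.
have [a a0 E] := IH (ltnW jm); exists (a * (- 2 * (m - j)%:R)).
  by rewrite mulf_neq0// mulf_neq0 ?oppr_eq0 ?pnatr_eq0// subn_eq0 -ltnNge.
move=> i; rewrite iterS E EmZ; last exact: sm_mcoef.
by apply/funext => g; rewrite Em_mcoef -addnS -subnS !mulrA.
Qed.

Lemma iterEp_mcoef n l : (l <= n)%N -> exists2 a : C, a != 0 &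
  forall i, iter l Ep (mcoef n 0 i) = fun g : G => a * mcoef (n - l) l i g.
Proof.
elim: l => [|l IH] ln.
  by exists 1 => [|i]; rewrite ?oner_eq0//= subn0; apply/funext => g; rewrite mul1r.
have [a a0 E] := IH (ltnW ln); exists (a * (- 2 * (n - l)%:R)).
  by rewrite mulf_neq0// mulf_neq0 ?oppr_eq0 ?pnatr_eq0// subn_eq0 -ltnNge.
move=> i; rewrite iterS E EpZ; last exact: sm_mcoef.
by apply/funext => g; rewrite Ep_mcoef -subnS !mulrA.
Qed.

(** Raise to the top weight n, lower l times, evaluate at 1. For l <= n these functionals determine
    a [casimir_eigen] function ([casimir_uniq]) and are dual, up to nonzero factors, to the matrix
    coefficients with i = n - l ([jet_mcoef]). *)
Definition jet (n k l : nat) F : C := iter l Ep (iter (n - k) Em F) 1%g.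

Lemma jet_mcoef n k l : (k <= n)%N -> (l <= n)%N -> exists2 a : C, a != 0 &
  forall i, jet n k l (mcoef k (n - k) i) = a * (i == n - l)%N%:R.
Proof.
move=> kn ln; have [a a0 E] := iterEm_mcoef k (leqnn (n - k)).
have [b b0 E'] := iterEp_mcoef ln; exists (a * b); first by rewrite mulf_neq0.
move=> i; rewrite /jet E subnKC// subnn iterEpZ; last exact: sm_mcoef.
by rewrite E' mcoef1 mulrA.
Qed.

Lemma jetD n k l f h : sm f -> sm h -> jet n k l (fun g => f g + h g) = jet n k l f + jet n k l h.
Proof. by move=> sf sh; rewrite /jet iterEmD// iterEpD//; exact: sm_iterEm. Qed.

Lemma jetZ n k l (a : C) f : sm f -> jet n k l (fun g => a * f g) = a * jet n k l f.
Proof. by move=> sf; rewrite /jet iterEmZ// iterEpZ//; exact: sm_iterEm. Qed.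

Lemma jet0 n k l : jet n k l (fun=> 0) = 0.
Proof. by have := jetZ n k l 0 (sm_cst 0); under eq_fun do rewrite mul0r; rewrite mul0r. Qed.

Lemma jet_sum n k l (I : Type) (r : seq I) (F : I -> G -> C) : (forall i, sm (F i)) ->
  jet n k l (fun g => \sum_(i <- r) F i g) = \sum_(i <- r) jet n k l (F i).
Proof.
move=> sF; elim: r => [|i r IH].
  by rewrite big_nil -[RHS](jet0 n k l); congr jet; apply/funext => g; rewrite big_nil.
have -> : (fun g => \sum_(j <- i :: r) F j g) = fun g => F i g + \sum_(j <- r) F j g.
  by apply/funext => g; rewrite big_cons.
by rewrite jetD ?IH ?big_cons//; exact: sm_sum.
Qed.

Lemma jet_comb n k l (c : 'I_n.+1 -> C) : (k <= n)%N -> (l <= n)%N -> exists2 a : C, a != 0 &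
  jet n k l (fun g => \sum_(i < n.+1) c i * mcoef k (n - k) i g) = a * c (inord (n - l)) /\
  forall i, jet n k l (mcoef k (n - k) i) = a * (i == n - l)%N%:R.
Proof.
move=> kn ln; have [a a0 E] := jet_mcoef kn ln; exists a => //; split => //.
rewrite jet_sum; last by move=> i; apply: smZ; exact: sm_mcoef.
rewrite (bigD1 (inord (n - l)))//= big1 ?addr0.
  by rewrite jetZ ?E ?inordK ?eqxx ?mulr1 1?mulrC ?ltnS ?leq_subr//; exact: sm_mcoef.
move=> i ni; rewrite jetZ ?E; last exact: sm_mcoef.
have -> : (i == n - l :> nat)%N = false.
  by apply/negbTE; apply: contra ni => /eqP e; apply/eqP/val_inj; rewrite /= inordK ?ltnS ?leq_subr.
by rewrite !mulr0.
Qed.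

Lemma casimirD n k f h : casimir_eigen n k f -> casimir_eigen n k h ->
  casimir_eigen n k (fun g => f g + h g).
Proof.
move=> [wf fE] [wh hE]; split; first exact: wtD.
have [sf _] := wf; have [sh _] := wh.
move=> g; rewrite (EmD sf sh) (EpD (sm_Em sf) (sm_Em sh)) fE hE; ring.
Qed.

Lemma casimirZ n k (a : C) f : casimir_eigen n k f -> casimir_eigen n k (fun g => a * f g).
Proof.
move=> [wf fE]; split; first exact: wtZ.
have [sf _] := wf.
move=> g; rewrite (EmZ a sf) (EpZ a (sm_Em sf)) fE; ring.
Qed.

Lemma casimir_comb n k (c : 'I_n.+1 -> C) : (k <= n)%N ->
  casimir_eigen n k (fun g : G => \sum_(i < n.+1) c i * mcoef k (n - k) i g).
Proof.
move=> kn; have H : forall i : nat, casimir_eigen n k (mcoef k (n - k) i : G -> C).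
  by move=> i; have := @casimir_mcoef k (n - k) i; rewrite subnKC.
have : forall s : seq 'I_n.+1, casimir_eigen n k (fun g : G => \sum_(i <- s) c i * mcoef k (n - k) i g).
  elim=> [|i s IH].
    have -> : (fun g : G => \sum_(i <- [::]) c i * mcoef k (n - k) i g) = fun g => 0 * mcoef k (n - k) 0 g.
      by apply/funext => g; rewrite big_nil mul0r.
    exact: casimirZ.
  have -> : (fun g : G => \sum_(j <- i :: s) c j * mcoef k (n - k) j g) =
     fun g => c i * mcoef k (n - k) i g + \sum_(j <- s) c j * mcoef k (n - k) j g.
    by apply/funext => g; rewrite big_cons.
  by apply: casimirD => //; apply: casimirZ.
by [].
Qed.

(** Subtract the combination of matrix coefficients with the same jets and apply [casimir_uniq]. *)
Lemma casimir_span n k F : (k <= n)%N -> casimir_eigen n k F ->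
  exists c : 'I_n.+1 -> C, F = fun g => \sum_(i < n.+1) c i * mcoef k (n - k) i g.
Proof.
move=> kn cF.
have cid l : {a : C | (l <= n)%N -> a != 0 /\ forall i, jet n k l (mcoef k (n - k) i) = a * (i == n - l)%N%:R}.
  apply: cid; case: (leqP l n) => ln; last by exists 0.
  by have [a a0 E] := jet_mcoef kn ln; exists a.
pose a l := projT1 (cid l).
pose c (i : 'I_n.+1) := jet n k (n - i) F / a (n - i)%N.
exists c; pose D g := F g + (-1) * (\sum_(i < n.+1) c i * mcoef k (n - k) i g).
have cD : casimir_eigen n k D by apply: casimirD => //; apply: casimirZ; exact: casimir_comb.
have sF : sm F by have [[]] := cF.
have D0 : forall g, D g = 0.
  apply: (casimir_uniq kn cD) => l ln; rewrite -/(jet n k l D) jetD//; last first.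
    by apply: smZ; have [[]] := casimir_comb c kn.
  rewrite jetZ; last by have [[]] := casimir_comb c kn.
  have [b b0 [-> E]] := jet_comb c kn ln.
  have [al0 E'] := projT2 (cid l) ln.
  have ab : a l = b.
    by have := E (n - l)%N; rewrite (E' (n - l)%N) eqxx !mulr1.
  rewrite /c inordK ?ltnS ?leq_subr// subKn// ab; field; exact: b0.
by apply/funext => g; have /eqP := D0 g; rewrite /D mulN1r subr_eq0 => /eqP.
Qed.

End sl2.

(** * The Dirac equation in components *)

Section bridge.
Context {R : realType}.
Local Notation C := R[i].
Local Notation G := (SU2 R).
Local Notation Re := complex.Re.
Local Notation Im := complex.Im.
Local Notation spinor := (G -> 'cV[C]_2).
Implicit Types (f h F : G -> C) (g c : G) (psi : spinor).

Definition entry psi (j : 'I_2) : G -> C := fun g => psi g j 0.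

Lemma cvg_col {T : Type} (F : set_system T) {FF : Filter F} (u : T -> 'cV[C]_2) (v : 'cV[C]_2) :
  u x @[x --> F] --> v <-> forall j, u x j 0 @[x --> F] --> v j 0.
Proof.
split=> [uv j|uv].
  exact: (cvg_comp _ _ uv (@coord_continuous _ _ _ j 0 v)).
have E (w : 'cV[C]_2) : w = w 0 0 *: delta_mx 0 0 + w 1 0 *: delta_mx 1 0.
  apply/matrixP => i k; rewrite !mxE (ord1 k) eqxx !andbT.
  by case: i => [[|[|//]] i2] /=; rewrite ?mulr1 ?mulr0 ?addr0 ?add0r; congr (w _ _); exact: val_inj.
rewrite (E v); have -> : u = fun x => u x 0 0 *: delta_mx 0 0 + u x 1 0 *: delta_mx 1 0.
  by apply/funext => x; exact: E.
by apply: cvgD; apply: cvgZr_tmp; exact: uv.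
Qed.

Lemma cont_comp psi : continuous psi <-> forall j, cont (entry psi j).
Proof.
split=> [cp j|cp g].
  have h g : entry psi j x @[x --> g] --> entry psi j g by exact: ((cvg_col _ _).1 (cp g) j).
  by split=> g; have [h1 h2] := (cvg_ReIm _ _).1 (h g).
apply: ((@cvg_col _ (nbhs g) (nbhs_filter g) psi (psi g)).2) => j.
apply: ((@cvg_ReIm _ _ (nbhs g) (nbhs_filter g) (entry psi j) (entry psi j g)).2).
by split; [exact: (cp j).1 g|exact: (cp j).2 g].
Qed.

Lemma diff_quotE (X : 'M[C]_2) psi g (t : R) j :
  diff_quot X psi g t j 0 = (t^-1)%:C * (entry psi j (g * rexp X t)%g - entry psi j g).
Proof. by rewrite /diff_quot -rexpE !mxE. Qed.

Lemma dv_lie_cvg (X : 'M[C]_2) psi g j (v : C) : su2 R X ->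
  diff_quot X psi g t j 0 @[t --> (0:R)^'] --> v <->
  is_derive (0:R) (1:R) (fun t => Re (entry psi j (g * rexp X t)%g)) (Re v) /\
  is_derive (0:R) (1:R) (fun t => Im (entry psi j (g * rexp X t)%g)) (Im v).
Proof.
move=> sX.
have e (P : C -> R) (PB : forall a b : C, P (a - b) = P a - P b) (PZ : forall (a : R) (b : C), P (a%:C * b) = a * P b) :
   (fun t : R => P (diff_quot X psi g t j 0)) = fun t => t^-1 * (P (entry psi j (g * rexp X (0 + t))%g) - P (entry psi j (g * rexp X 0)%g)).
  by apply/funext => t; rewrite diff_quotE PZ PB add0r rexp0// mulg1.
have eR := e (fun z => Re z); have eI' := e (fun z => Im z).
have bR (a b : C) : Re (a - b) = Re a - Re b by case: a => ? ?; case: b.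
have bI (a b : C) : Im (a - b) = Im a - Im b by case: a => ? ?; case: b.
have zR (a : R) (b : C) : Re (a%:C * b) = a * Re b by rewrite cReM /= mul0r subr0.
have zI (a : R) (b : C) : Im (a%:C * b) = a * Im b by rewrite cImM /= mul0r addr0.
have {}eR := eR bR zR; have {}eI' := eI' bI zI.
split.
  move=> /cvg_ReIm [h1 h2]; split; apply: cvg_dv.
    by rewrite -eR.
  by rewrite -eI'.
move=> [h1 h2]; apply/cvg_ReIm; rewrite eR eI'; split.
  exact: (dv_cvg h1).
exact: (dv_cvg h2).
Qed.

Lemma lie_derivable_is_lie (X : 'M[C]_2) psi : su2 R X -> lie_derivable X psi ->
  forall j, is_lie X (entry psi j) (entry (lie_derive X psi) j).
Proof.
move=> sX dX j; have h g : diff_quot X psi g t j 0 @[t --> (0:R)^'] --> lie_derive X psi g j 0.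
  by have /cvg_col /(_ j) := dX g.
by split=> g; have [h1 h2] := (dv_lie_cvg psi g j _ sX).1 (h g).
Qed.

Lemma is_lie_lie_derivable (X : 'M[C]_2) psi (f' : 'I_2 -> G -> C) : su2 R X ->
  (forall j, is_lie X (entry psi j) (f' j)) ->
  lie_derivable X psi /\ lie_derive X psi = fun g => \col_j f' j g.
Proof.
move=> sX df.
have h g : diff_quot X psi g t @[t --> (0:R)^'] --> (\col_j f' j g : 'cV[C]_2).
  apply/cvg_col => j; rewrite mxE; apply/(dv_lie_cvg psi g j _ sX).
  by have [d1 d2] := df j; split; [exact: d1|exact: d2].
split=> [g|]; first by apply/cvg_ex; eexists; exact: h.
by apply/funext => g; apply/cvg_lim; [exact: norm_hausdorff|exact: h].
Qed.

Lemma CkP k psi : Ck k psi <-> forall j, smC k (entry psi j).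
Proof.
elim: k psi => [|k IH] psi; first exact: cont_comp.
split=> [[cp dp] j|sp].
  split; first by have /cont_comp := cp.
  move=> X sX; have [dX CX] := dp X sX.
  by exists (entry (lie_derive X psi) j); [exact: lie_derivable_is_lie|exact: (IH _).1 CX j].
split; first by apply/cont_comp => j; have [] := sp j.
move=> X sX; have ex j : {f' | is_lie X (entry psi j) f' & smC k f'}.
  by apply: cid2; have [_ /(_ X sX)] := sp j.
have [dX ->] := @is_lie_lie_derivable X psi (fun j => s2val (ex j)) sX (fun j => s2valP (ex j)).
split=> //; apply/IH => j; have -> : entry (fun g => \col_j0 s2val (ex j0) g) j = s2val (ex j).
  by apply/funext => g; rewrite /entry mxE.
exact: s2valP'.
Qed.

Lemma smoothP psi : smooth psi <-> forall j, sm (entry psi j).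
Proof. by split=> [sp j k|sp k]; [exact: (CkP k psi).1 (sp k) j|apply/CkP => j; exact: sp]. Qed.

Lemma lie_derive_smooth (X : 'M[C]_2) psi : su2 R X -> smooth psi ->
  lie_derive X psi = fun g => \col_j lie X (entry psi j) g.
Proof.
move=> sX /smoothP sp.
by have [_ ->] := @is_lie_lie_derivable X psi (fun j => lie X (entry psi j)) sX (fun j => sm_is_lie (sp j) sX).
Qed.

Lemma Imx_eI : Imx = eI :> 'M[C]_2.
Proof. by rewrite eI_mx; congr mx2; apply: ReIm_eq => /=; ring. Qed.
Lemma Jmx_eJ : Jmx = eJ :> 'M[C]_2. Proof. by rewrite eJ_mx. Qed.
Lemma Kmx_eK : Kmx = eK :> 'M[C]_2.
Proof. by rewrite eK_mx; congr mx2; apply: ReIm_eq => /=; ring. Qed.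

Lemma lie_scale (r : R) f : sm f -> lie (r%:C *: eI) f = fun g => r%:C * lie eI f g.
Proof.
move=> sf; rewrite -su2v_scale !mulr0 mulr1 lie_lin//.
by apply/funext => g; ring.
Qed.

Lemma mx2_mul_col (a b c d : C) (v : 'cV[C]_2) :
  ((mx2 a b c d *m v) 0 0 = a * v 0 0 + b * v 1 0) * ((mx2 a b c d *m v) 1 0 = c * v 0 0 + d * v 1 0).
Proof.
by split; rewrite !mxE !big_ord_recl big_ord0 addr0 !mxE /=; congr (_ + _ * v _ _); apply: val_inj.
Qed.

Lemma dirac_comp (T : R) psi : smooth psi -> forall g,
  (dirac_op T psi g 0 0 = 'i%C * (T^-1)%:C * lie eI (entry psi 0) g + Ep (entry psi 1) g
     - (T / 2 + T^-1)%:C * entry psi 0 g) *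
  (dirac_op T psi g 1 0 = - 'i%C * (T^-1)%:C * lie eI (entry psi 1) g + Em (entry psi 0) g
     - (T / 2 + T^-1)%:C * entry psi 1 g).
Proof.
move=> sp g; have /smoothP sj := sp.
have sT : su2 R ((T^-1)%:C *: eI) by rewrite -su2v_scale; exact: su2_su2v.
have E (M N P : 'M[C]_2) (u v w x : 'cV[C]_2) (a : C) i :
    (M *m u + N *m v + P *m w - a *: x) i 0 = (M *m u) i 0 + (N *m v) i 0 + (P *m w) i 0 - a * x i 0.
  by move: (M *m u) (N *m v) (P *m w) => p q r; rewrite !mxE.
rewrite /dirac_op Imx_eI Jmx_eJ Kmx_eK !lie_derive_smooth//; try exact: su2_su2v.
rewrite !E eI_mx eJ_mx eK_mx !mx2_mul_col -eI_mx -eJ_mx -eK_mx ![(\col__ _) _ _]mxE !lie_scale//.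
by split; rewrite /Ep /Em /entry; ring.
Qed.

Lemma gJ_quat : SU2val (gJ : G) = quat 0 0 1 0.
Proof. by rewrite -[SU2val _]/(Jmx) Jmx_eJ. Qed.

Lemma lieI_gJ f : sm f -> lie eI (fun g => f (g * gJ)%g) = fun g => - lie eI f (g * gJ)%g.
Proof.
move=> sf; rewrite (@lie_trans _ _ eI (su2v (-1) 0 0))//; try exact: su2_su2v.
  by apply/funext => g; rewrite lie_lin//; ring.
by rewrite gJ_quat /eI /su2v !quat_mul; congr quat; ring.
Qed.

Lemma lieJ_gJ f : sm f -> lie eJ (fun g => f (g * gJ)%g) = fun g => lie eJ f (g * gJ)%g.
Proof.
move=> sf; rewrite (@lie_trans _ _ eJ eJ)//; try exact: su2_su2v.
by rewrite gJ_quat /eJ /su2v !quat_mul; congr quat; ring.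
Qed.

Lemma lieK_gJ f : sm f -> lie eK (fun g => f (g * gJ)%g) = fun g => - lie eK f (g * gJ)%g.
Proof.
move=> sf; rewrite (@lie_trans _ _ eK (su2v 0 0 (-1)))//; try exact: su2_su2v.
  by apply/funext => g; rewrite lie_lin//; ring.
by rewrite gJ_quat /eK /su2v !quat_mul; congr quat; ring.
Qed.

(** Conjugation by J fixes J and negates I and K, so translation by [gJ] exchanges raising and
    lowering up to sign. *)
Lemma Em_gJ f : sm f -> Em (fun g => f (g * gJ)%g) = fun g => - Ep f (g * gJ)%g.
Proof.
by move=> sf; apply/funext => g; rewrite /Em /Ep lieJ_gJ// lieK_gJ//; ring.
Qed.

Lemma Ep_gJ f : sm f -> Ep (fun g => f (g * gJ)%g) = fun g => - Em f (g * gJ)%g.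
Proof.
by move=> sf; apply/funext => g; rewrite /Em /Ep lieJ_gJ// lieK_gJ//; ring.
Qed.

Definition spinor_of f : spinor := fun g => \col_j (if j == 0 then f g else - f (g * gJ)%g).

Lemma entry_spinor_of f : (entry (spinor_of f) 0 = f) * (entry (spinor_of f) 1 = fun g => - f (g * gJ)%g).
Proof. by split; apply/funext => g; rewrite /entry mxE. Qed.

(* The equations for the first component [f] of an eigenspinor; by equivariance under [gJ]
   the second component is [g |-> - f (g * gJ)]. *)
Definition eigA (N : nat) (T : R) (lambda : C) f := [/\ sm f,
  forall g, f (g * rexp eI (pi / N%:R))%g = cis (- (pi / N%:R)) * f g &
  forall g, Em f (g * gJ)%g = (lambda + (T / 2 + T^-1)%:C) * f g - 'i%C * (T^-1)%:C * lie eI f g].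

Lemma rexpV (X : 'M[C]_2) t : su2 R X -> ((rexp X t)^-1)%g = rexp X (- t).
Proof. by move=> sX; apply: (mulgI (rexp X t)); rewrite mulgV -rexpD// subrr rexp0. Qed.

Lemma rexpI_mx t : SU2val (rexp eI t) = mx2 (cis t) 0 0 (cis (- t)) :> 'M[C]_2.
Proof.
rewrite rexp_unit ?n100// /quat /cis cosN sinN.
by congr mx2; apply: ReIm_eq => /=; ring.
Qed.

Lemma gen_a (N : nat) : MkSU2 (dicyclic_a_SU2 N) = rexp eI (pi / N%:R) :> G.
Proof.
apply: val_inj; rewrite /= rexpI_mx /dicyclic_a /cis cosN sinN.
by congr mx2; apply: ReIm_eq => /=; ring.
Qed.

Lemma eig_pow (t : R) f : (forall g, f (g * rexp eI t)%g = cis (- t) * f g) ->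
  forall (n : nat) g, f (g * rexp eI (n%:R * t))%g = cis (- (n%:R * t)) * f g.
Proof.
move=> ft; elim=> [|n IH] g.
  by rewrite mul0r rexp0 ?mulg1 ?oppr0 ?cis0 ?mul1r//; exact: su2_eI.
have -> : n.+1%:R * t = t + n%:R * t by rewrite -natr1; ring.
rewrite rexpD; last exact: su2_eI.
by rewrite mulgA IH ft mulrA -cisD; congr (cis _ * _); ring.
Qed.

Lemma gJJ : (gJ * gJ)%g = rexp eI pi :> G.
Proof.
apply: val_inj; rewrite -[LHS]/(SU2val gJ *m SU2val gJ) -[RHS]/(SU2val _).
by rewrite rexp_unit ?n100// cospi sinpi gJ_quat quat_mul; congr quat; ring.
Qed.

(** The N-th power of the rotation by pi/N is exp(pi I) = -1, which is also the square of [gJ]. *)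
Lemma eig_odd (N : nat) f : (0 < N)%N -> (forall g, f (g * rexp eI (pi / N%:R))%g = cis (- (pi / N%:R)) * f g) ->
  forall g, f (g * gJ * gJ)%g = - f g.
Proof.
move=> N0 ft g; have := eig_pow ft N g.
have -> : N%:R * (pi / N%:R) = pi :> R by rewrite mulrC divfK// pnatr_eq0 -lt0n.
rewrite -gJJ mulgA => ->; rewrite /cis cosN sinN cospi sinpi.
by apply: ReIm_eq; rewrite ?cReM ?cImM /=; case: (f g) => a b /=; ring.
Qed.

Lemma gJ_rot (t : R) : (gJ * rexp eI t)%g = (rexp eI (- t) * gJ)%g :> G.
Proof.
apply: val_inj; rewrite -[LHS]/(SU2val gJ *m SU2val (rexp eI t)) -[RHS]/(SU2val (rexp eI (- t)) *m SU2val gJ).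
by rewrite gJ_quat !rexp_unit ?n100// !quat_mul cosN sinN; congr quat; ring.
Qed.

Lemma gJV_mx : SU2val (gJ^-1)%g = mx2 0 (- 1) 1 0 :> 'M[C]_2.
Proof.
have E := q_quat gJ_quat; rewrite SU2_quat !qV !E /quat.
by congr mx2; apply: ReIm_eq => /=; ring.
Qed.

Lemma colP2 (u v : 'cV[C]_2) : u 0 0 = v 0 0 -> u 1 0 = v 1 0 -> u = v.
Proof.
move=> e0 e1; apply/matrixP => i k; rewrite (ord1 k).
case: i => [[|[|//]] i2].
  by have -> : Ordinal i2 = 0 by apply: val_inj.
by have -> : Ordinal i2 = 1 by apply: val_inj.
Qed.

(** The elements c for which equivariance holds form a subgroup, so the two generators suffice. *)
Lemma dicyclic_equivariant (N : nat) psi :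
  (forall g c, dicyclic N c -> psi (g * c)%g = SU2val (c^-1)%g *m psi g) <->
  (forall g, psi (g * rexp eI (pi / N%:R))%g = mx2 (cis (- (pi / N%:R))) 0 0 (cis (pi / N%:R)) *m psi g) /\
  (forall g, psi (g * gJ)%g = mx2 0 (- 1) 1 0 *m psi g).
Proof.
have aV : SU2val ((rexp eI (pi / N%:R))^-1)%g = mx2 (cis (- (pi / N%:R))) 0 0 (cis (pi / N%:R)) :> 'M[C]_2.
  by rewrite rexpV ?rexpI_mx ?opprK//; exact: su2_eI.
split=> [H|[Ha HJ] g c dc].
  split=> g.
    by rewrite -aV; apply: H; rewrite -gen_a => M [_ incl]; apply: incl; left.
  by rewrite -gJV_mx; apply: H => M [_ incl]; apply: incl; right.
pose H : set G := [set c | forall g, psi (g * c)%g = SU2val (c^-1)%g *m psi g].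
suff : H c by [].
apply: dc; split; last first.
  move=> d [->|->] x.
    by rewrite gen_a aV.
  by rewrite -[MkSU2 _]/(gJ : G) gJV_mx.
split.
- by move=> x; rewrite mulg1 invg1 -[SU2val 1%g]/(1%:M) mul1mx.
- by move=> a b ha hb x; rewrite mulgA hb ha invgM -[SU2val (_ * _)%g]/(SU2val _ *m SU2val _) mulmxA.
- move=> a ha x; rewrite invgK; have := ha (x * a^-1)%g; rewrite -mulgA mulVg mulg1 => ->.
  by rewrite mulmxA -[SU2val a *m SU2val (a^-1)%g]/(SU2val (a * a^-1)%g) mulgV -[SU2val 1%g]/(1%:M) mul1mx.
Qed.

Lemma eigenspace_eigA (N : nat) (T : R) (lambda : C) psi :
  dirac_eigenspace N T lambda psi -> eigA N T lambda (entry psi 0) /\ psi = spinor_of (entry psi 0).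
Proof.
move=> [[sp /dicyclic_equivariant [Ha HJ]] D].
have /smoothP sj := sp; have s0 := sj 0; have s1 := sj 1.
have E1 g : entry psi 1 g = - entry psi 0 (g * gJ)%g.
  by rewrite /entry HJ mx2_mul_col; ring.
have E2 : entry psi 1 = fun g => (-1) * entry psi 0 (g * gJ)%g.
  by apply/funext => g; rewrite E1 mulN1r.
split; last first.
  by apply/funext => g; apply: colP2; rewrite mxE//= -E1.
split=> // [g|g]; first by rewrite /entry Ha mx2_mul_col; ring.
have e : dirac_op T psi g 0 0 = lambda * entry psi 0 g by rewrite D mxE.
rewrite (dirac_comp T sp) E2 EpZ in e; last exact: sm_trans.
rewrite Ep_gJ// in e.
by rewrite mulrDl -e; ring.
Qed.

(** The second component of the Dirac equation is the first one evaluated at g gJ, because f and Em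
    f are odd under translation by gJ^2 = -1. *)
Lemma eigA_eigenspace (N : nat) (T : R) (lambda : C) f : (0 < N)%N ->
  eigA N T lambda f -> dirac_eigenspace N T lambda (spinor_of f).
Proof.
move=> N0 [sf fa fD]; have odd := eig_odd N0 fa.
have sfJ := sm_trans gJ sf.
have c1 : entry (spinor_of f) 1 = fun g => (-1) * f (g * gJ)%g.
  by rewrite entry_spinor_of; apply/funext => g; rewrite mulN1r.
have sp : smooth (spinor_of f).
  apply/smoothP => j; have [->|->] : j = 0 \/ j = 1.
    by case: j => [[|[|//]] j2]; [left|right]; exact: val_inj.
    by rewrite entry_spinor_of.
  by rewrite c1; exact: smZ.
split; first split => //.
  apply/dicyclic_equivariant; split=> g; apply: colP2; rewrite mx2_mul_col !mxE /=.
  - by rewrite fa; ring.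
  - rewrite -mulgA.
    have -> : (rexp eI (pi / N%:R) * gJ)%g = (gJ * rexp eI (- (pi / N%:R)))%g :> G by rewrite gJ_rot opprK.
    rewrite mulgA; have := fa (g * gJ * rexp eI (- (pi / N%:R)))%g.
    have -> : (g * gJ * rexp eI (- (pi / N%:R)) * rexp eI (pi / N%:R))%g = (g * gJ)%g.
      by rewrite -(mulgA (g * gJ)%g) -rexpD ?addNr ?rexp0 ?mulg1//; exact: su2_eI.
    by move=> ->; rewrite mulrN mulrA cisN; ring.
  - by ring.
  - by rewrite odd; ring.
have c0 : entry (spinor_of f) 0 = f by rewrite entry_spinor_of.
apply/funext => g; have [D0 D1] := dirac_comp T sp g; rewrite c0 c1 in D0 D1.
apply: colP2; rewrite [RHS]mxE.
  rewrite D0 -[spinor_of f g 0 0]/(entry (spinor_of f) 0 g) c0 EpZ// Ep_gJ// fD; ring.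
rewrite D1 -[spinor_of f g 1 0]/(entry (spinor_of f) 1 g) c1 lieZ//; last exact: su2_eI.
rewrite lieI_gJ//.
have e1 := fD (g * gJ)%g.
have e2 : Em f (g * gJ * gJ)%g = - Em f g.
  have : Em (fun x => f (x * gJ * gJ)%g) g = Em f (g * gJ * gJ)%g.
    by rewrite (@Em_gJ (fun x => f (x * gJ)%g))// Ep_gJ// opprK.
  move=> <-; have -> : (fun x => f (x * gJ * gJ)%g) = fun x => (-1) * f x.
    by apply/funext => x; rewrite odd mulN1r.
  by rewrite EmZ// mulN1r.
rewrite e2 in e1.
have -> : Em f g = - (- Em f g) by rewrite opprK.
by rewrite e1; ring.
Qed.

Lemma spinor_of_comb d (F : 'I_d -> G -> C) (a : 'I_d -> C) :
  \sum_(i < d) a i *: spinor_of (F i) = spinor_of (fun g => \sum_(i < d) a i * F i g).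
Proof.
have E (S : spinor) (j : 'I_2) g : S g j 0 = entry S j g by [].
have sumE (s : seq 'I_d) : \sum_(i <- s) a i *: spinor_of (F i) = spinor_of (fun g => \sum_(i <- s) a i * F i g).
  elim: s => [|i s IH].
    by rewrite big_nil; apply/funext => g; apply: colP2; rewrite !mxE /= big_nil ?oppr0.
  rewrite big_cons IH; apply/funext => g.
  by apply: colP2; rewrite [LHS]mxE [X in X + _]mxE !mxE /= big_cons ?opprD ?mulrN.
exact: sumE.
Qed.

Lemma has_dim_eigA (N : nat) (T : R) (lambda : C) d (F : 'I_d -> G -> C) : (0 < N)%N ->
  (forall i, eigA N T lambda (F i)) ->
  (forall a : 'I_d -> C, (forall g, \sum_(i < d) a i * F i g = 0) -> forall i, a i = 0) ->
  (forall f, eigA N T lambda f -> exists a : 'I_d -> C, f = fun g => \sum_(i < d) a i * F i g) ->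
  has_dim (dirac_eigenspace N T lambda) d.
Proof.
move=> N0 FA free gen; exists (fun i => spinor_of (F i)); split.
- by move=> i; exact: eigA_eigenspace.
- move=> a; rewrite spinor_of_comb => e; apply: free => g.
  by have := congr1 (fun S : spinor => S g 0 0) e; rewrite !mxE.
- move=> psi /eigenspace_eigA[pA ->]; have [a ->] := gen _ pA.
  by exists a; rewrite spinor_of_comb.
Qed.

End bridge.

(** * Weight components of eigenspinors *)

Section components.
Context {R : realType}.
Local Notation C := R[i].
Local Notation G := (SU2 R).
Implicit Types (f h F : G -> C) (g c : G).

Lemma odd_op f : sm f -> (forall g, f (g * gJ * gJ)%g = - f g) ->
  (forall g, Em f (g * gJ * gJ)%g = - Em f g) /\ (forall g, Ep f (g * gJ * gJ)%g = - Ep f g).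
Proof.
move=> sf fo; have sR := sm_trans gJ sf.
have E : (fun x => f (x * gJ * gJ)%g) = fun x => (-1) * f x.
  by apply/funext => x; rewrite fo mulN1r.
split=> g.
  have <- : Em (fun x => f (x * gJ * gJ)%g) g = Em f (g * gJ * gJ)%g.
    by rewrite (@Em_gJ _ (fun x => f (x * gJ)%g))// Ep_gJ// opprK.
  by rewrite E EmZ// mulN1r.
have <- : Ep (fun x => f (x * gJ * gJ)%g) g = Ep f (g * gJ * gJ)%g.
  by rewrite (@Ep_gJ _ (fun x => f (x * gJ)%g))// Em_gJ// opprK.
by rewrite E EpZ// mulN1r.
Qed.

Lemma wproj_sum K s n (A : 'I_n -> G -> C) (a : 'I_n -> int) : (`|s| <= K)%N ->
  (forall j, (`|a j| <= K)%N) -> (forall j, rotw (a j) (A j)) ->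
  wproj K s (fun g => \sum_(j < n) A j g) = fun g => \sum_(j < n) if a j == s then A j g else 0.
Proof.
move=> sK aK Aa; apply/funext => g.
transitivity (\sum_(j < n) wproj K s (A j) g).
  rewrite /wproj -mulr_sumr; congr (_ * _); rewrite exchange_big /=.
  by apply: eq_bigr => k _; rewrite mulr_sumr.
by apply: eq_bigr => j _; rewrite (proj_rotw (aK j) sK (Aa j)).
Qed.

Lemma sum_pick L (r : int) (X : int -> C) :
  \sum_(j < L.*2.+1) (if j%:Z - L%:Z == r then X (j%:Z - L%:Z) else 0) =
  if (`|r| <= L)%N then X r else 0.
Proof.
case: ifP => rL; last first.
  by rewrite big1// => j _; case: eqP => // e; have := ltn_ord j; lia.
have jL : (`|(r + L%:Z)%R| < L.*2.+1)%N by lia.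
rewrite (bigD1 (Ordinal jL))//= big1 ?addr0; last first.
  by move=> j /eqP jn; case: eqP => // e; case: jn; apply: val_inj => /=; lia.
have E : `|(r + L%:Z)%R|%N%:Z - L%:Z = r by lia.
by rewrite E eqxx.
Qed.

(** Cut off outside [-L, L], where [wproj], which depends only on r modulo 2L + 1, would repeat
    another component; r may then range over all integers. *)
Definition wcomp L r f g : C := if (`|r| <= L)%N then wproj L r f g else 0.

Lemma wcomp_out L r f : (L < `|r|)%N -> wcomp L r f = fun=> 0.
Proof. by move=> rL; apply/funext => g; rewrite /wcomp leqNgt rL. Qed.

Lemma wcomp_comb L r d (c : 'I_d -> C) (F : 'I_d -> G -> C) :
  wcomp L r (fun g => \sum_(i < d) c i * F i g) = fun g => \sum_(i < d) c i * wcomp L r (F i) g.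
Proof.
apply/funext => g; rewrite /wcomp; case: ifP => _; last by rewrite big1// => i _; rewrite mulr0.
rewrite /wproj.
under eq_bigr do rewrite mulr_sumr.
rewrite exchange_big /= mulr_sumr; apply: eq_bigr => i _.
rewrite mulrCA; congr (_ * _); rewrite mulr_sumr.
by apply: eq_bigr => k _; ring.
Qed.

Lemma wcompB L r f h : wcomp L r (fun g => f g - h g) = fun g => wcomp L r f g - wcomp L r h g.
Proof.
apply/funext => g; rewrite /wcomp; case: ifP => _; last by rewrite subr0.
rewrite /wproj -mulrBr -sumrB; congr (_ * _); apply: eq_bigr => k _; ring.
Qed.

Lemma wcomp_sum L f g : \sum_(j < L.*2.+1) wcomp L (j%:Z - L%:Z) f g = f g.
Proof.
rewrite -[RHS](proj_sum L); apply: eq_bigr => j _; rewrite /wcomp ifT//.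
by have := ltn_ord j; lia.
Qed.

Lemma wcomp_rotw L r q f : (`|q| <= L)%N -> rotw q f ->
  wcomp L r f = fun g => if q == r then f g else 0.
Proof.
move=> qL fq; have [rL|rL] := leqP `|r| L.
  by apply/funext => g; rewrite /wcomp rL (proj_rotw qL rL fq).
rewrite wcomp_out//; apply/funext => g; case: eqP => // e; lia.
Qed.

Lemma wt_rotw r f : wt r f -> rotw r f.
Proof.
move=> [sf fE] g t; apply: (weight_rot sf) => x.
by rewrite fE intC.
Qed.

Lemma wt_gJ q f : wt q f -> wt (- q) (fun g => f (g * gJ)%g).
Proof.
move=> [sf fE]; split; first exact: sm_trans.
by move=> g; rewrite lieI_gJ// fE mulrNz; ring.
Qed.

Lemma Em_sum n (F : 'I_n -> G -> C) : (forall i, sm (F i)) ->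
  Em (fun g => \sum_(i < n) F i g) = fun g => \sum_(i < n) Em (F i) g.
Proof.
move=> sF; apply/funext => g; rewrite /Em.
rewrite (lie_sum _ _ su2_eJ sF) (lie_sum _ _ su2_eK sF) mulr_sumr -sumrN -big_split /=.
by [].
Qed.

Variables (N : nat) (T : R) (lambda : C).
Local Notation nu := (lambda + (T / 2 + T^-1)%:C).
Local Notation eig := (eigA N T lambda).

(** Apply Em to the first-order equation, then use that equation again at g gJ; two translations by
    [gJ] give the sign -1. *)
Lemma eigA_berger f : (0 < N)%N -> eig f ->
  berger_eq (T ^- 2) (2 * T ^- 2 - 2) (2 * nu * (T^-1)%:C - nu ^+ 2) f.
Proof.
move=> N0 [sf fa fD]; split=> // g.
have odd := eig_odd N0 fa; have [oE _] := odd_op sf odd.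
have [_ oEE] := odd_op (sm_Em sf) oE.
have sI := sm_lie sf su2_eI; have sEm := sm_Em sf; have sEI := sm_Em sI.
have sERJ := sm_trans gJ sEm.
pose H g := nu * f g + (- 'i%C * (T^-1)%:C) * lie eI f g.
have HE : (fun g => Em f (g * gJ)%g) = H by apply/funext => x; rewrite /H fD; ring.
have IH : lie eI H = fun g => nu * lie eI f g + (- 'i%C * (T^-1)%:C) * lie eI (lie eI f) g.
  exact: (lie2 nu (- 'i%C * (T^-1)%:C) su2_eI sf sI).
have IEm x : lie eI (Em f) (x * gJ)%g = - lie eI H x.
  by rewrite -HE lieI_gJ// opprK.
have HEx x : Em f (x * gJ)%g = H x by have := congr1 (fun F => F x) HE.
have EmI x : Em (lie eI f) (x * gJ)%g = - lie eI H x - 2 * 'i%C * H x.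
  by have := lieIEm sf (x * gJ)%g; rewrite IEm HEx => ->; ring.
have EE x : Ep (Em f) (x * gJ)%g = - (nu * Em f x + (- 'i%C * (T^-1)%:C) * Em (lie eI f) x).
  have := congr1 (fun F => Em F x) HE; rewrite Em_gJ// => e.
  have -> : Ep (Em f) (x * gJ)%g = - Em H x by rewrite -e opprK.
  congr (- _); rewrite /H.
  by rewrite (EmD (smZ nu sf) (smZ _ sI)) (EmZ nu sf) (EmZ _ sI).
have T1 : (T ^- 2)%:C = (T^-1)%:C * (T^-1)%:C :> C by rewrite -rmorphM /= -exprVn expr2.
have T2 : (2 * T ^- 2 - 2)%:C = 2 * ((T^-1)%:C * (T^-1)%:C) - 2 :> C.
  by rewrite -T1 rmorphB rmorphM /= rmorph_nat.
have := EE (g * gJ)%g; rewrite oEE EmI HEx (EpEm sf) IH /H T1 T2.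
move: (lie eJ (lie eJ f) g) (lie eK (lie eK f) g) (lie eI (lie eI f) g) (lie eI f g) (f g).
move: (T^-1)%:C (nu) (@sqr_iC R); set ii := 'i%C; move: ii => ii t n i2 JJ KK II If F e.
apply/eqP; rewrite -subr_eq0; apply/eqP.
(* [ring] treats i as a variable, so the required multiple of i^2 + 1 is added explicitly. *)
transitivity (((- (- (JJ + KK) + 2 * ii * If))
  - (- (n * (n * F + - ii * t * If) + - ii * t *
       (- (n * If + - ii * t * II) - 2 * ii * (n * F + - ii * t * If)))))
  + (ii * ii + 1) * (t * t * II + 2 * ii * t * t * If - 2 * t * n * F)); first by ring.
by rewrite e subrr i2 addNr mul0r addr0.
Qed.

Section level.
Variable L : nat.
(** Supplied by [weight_decomposition], through [eigA_berger], for every sufficiently large L. *)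
Hypothesis HL : forall f, eig f -> forall r, sm (wcomp L r f) /\
  forall g, lie eI (wcomp L r f) g = 'i%C * r%:~R * wcomp L r f g.

Lemma wcomp_wt r f : eig f -> wt r (wcomp L r f).
Proof. by move=> ef; exact: HL. Qed.

(** Both sides of the first-order equation are sums of functions of definite weight; the parts of
    weight -r - 2 are compared. *)
Lemma wcomp_Em r f : eig f -> forall g,
  Em (wcomp L r f) (g * gJ)%g = (nu - (T^-1)%:C * (r%:~R + 2)) * wcomp L (- r - 2) f g.
Proof.
move=> ef g; have [sf _ fD] := ef.
have wf q := wcomp_wt q ef; have scf q : sm (wcomp L q f) by have [] := wf q.
have fS : f = fun x => \sum_(j < L.*2.+1) wcomp L (j%:Z - L%:Z) f x.
  by apply/funext => x; rewrite wcomp_sum.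
pose A q x := Em (wcomp L q f) (x * gJ)%g.
pose B q x := (nu + (T^-1)%:C * q%:~R) * wcomp L q f x.
have AB : (fun x => \sum_(j < L.*2.+1) A (j%:Z - L%:Z) x) = fun x => \sum_(j < L.*2.+1) B (j%:Z - L%:Z) x.
  apply/funext => x; transitivity (Em f (x * gJ)%g).
    by rewrite {1}fS Em_sum.
  rewrite fD {1 2}fS (lie_sum _ _ su2_eI)// !mulr_sumr -sumrB; apply: eq_bigr => j _.
  have [_ ->] := wf (j%:Z - L%:Z); rewrite /B.
  move: (wcomp _ _ _ _) (T^-1)%:C (nu) => y t n.
  transitivity (n * y - ('i%C * 'i%C) * t * (j%:Z - L%:Z)%:~R * y); first by ring.
  by rewrite sqr_iC; ring.
have Aw q : rotw (- (q + 2)) (A q) by apply/wt_rotw/wt_gJ/wt_Em/wf.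
have Bw q : rotw q (B q) by move=> x t; rewrite /B (wt_rotw (wf q)); ring.
(* Raising produces weights up to L + 2 in absolute value, so the comparison projects with L + 2 in
   place of L. *)
have [rL|rL] := leqP `|- r - 2| (L + 2); last first.
  by rewrite !wcomp_out ?Em0 ?mulr0//; lia.
have := congr1 (fun F => wproj (L + 2) (- r - 2) F g) AB; cbv beta.
rewrite (@wproj_sum (L + 2) (- r - 2) _ _ (fun j : 'I__ => - ((j%:Z - L%:Z) + 2)))//; first last.
  by move=> j; have := ltn_ord j; lia.
rewrite (@wproj_sum (L + 2) (- r - 2) _ _ (fun j : 'I__ => (j%:Z - L%:Z)))//; first last.
  by move=> j; have := ltn_ord j; lia.
rewrite (sum_pick L _ (fun q => B q g)).
rewrite (eq_bigr (fun j : 'I_(L.*2.+1) => if (j%:Z - L%:Z) == r then A (j%:Z - L%:Z) g else 0)); last first.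
  by move=> j _; congr (if _ then _ else _); lia.
rewrite (sum_pick L _ (fun q => A q g)) => e.
transitivity (if (`|r| <= L)%N then A r g else 0).
  by case: leqP => // h; rewrite wcomp_out// Em0.
rewrite e; case: leqP => h; last by rewrite wcomp_out ?mulr0.
rewrite /B; congr (_ * _); rewrite rmorphB rmorphN /= -[2%:~R]/(2 : C); ring.
Qed.

(** Equivariance under the rotation by pi/N gives e^{i pi r/N} = e^{-i pi/N} on a nonzero component,
    so 2N divides r + 1. *)
Lemma wcomp_lattice r f : (0 < N)%N -> eig f -> (exists g, wcomp L r f g != 0) ->
  exists m : int, r = 2 * m * N%:Z - 1.
Proof.
move=> N0 ef [g fg0]; have [sf fa _] := ef; have wf q := wcomp_wt q ef.
have rL : (`|r| <= L)%N.
  by rewrite leqNgt; apply/negP => h; move: fg0; rewrite wcomp_out ?eqxx.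
have fS : f = fun x => \sum_(j < L.*2.+1) wcomp L (j%:Z - L%:Z) f x.
  by apply/funext => x; rewrite wcomp_sum.
pose A q x := cis (q%:~R * (pi / N%:R)) * wcomp L q f x.
pose B q x := cis (- (pi / N%:R)) * wcomp L q f x.
have Aw q : rotw q (A q) by move=> x t; rewrite /A (wt_rotw (wf q)); ring.
have Bw q : rotw q (B q) by move=> x t; rewrite /B (wt_rotw (wf q)); ring.
have AB : (fun x => \sum_(j < L.*2.+1) A (j%:Z - L%:Z) x) = fun x => \sum_(j < L.*2.+1) B (j%:Z - L%:Z) x.
  apply/funext => x; transitivity (f (x * rexp eI (pi / N%:R))%g).
    rewrite {1}fS; apply: eq_bigr => j _; by rewrite (wt_rotw (wf _)).
  by rewrite fa {1}fS mulr_sumr.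
have := congr1 (fun F => wproj L r F g) AB; cbv beta.
have jL (j : 'I_L.*2.+1) : (`|(j%:Z - L%:Z)%R| <= L)%N by have := ltn_ord j; lia.
rewrite !(@wproj_sum L r _ _ (fun j : 'I__ => (j%:Z - L%:Z)))//.
rewrite (sum_pick L _ (fun q => A q g)) (sum_pick L _ (fun q => B q g)) rL => /(mulIf fg0) e.
have {e} c1 : cis ((r + 1)%:~R * (pi / N%:R)) = 1 :> C.
  by rewrite rmorphD /= mulrDl mul1r cisD e mulrC cisN.
exists ((r + 1) %/ (2 * N%:Z))%Z.
have N2 : 2 * N%:Z != 0 by lia.
have := divz_eq (r + 1) (2 * N%:Z); have := modz_ge0 (r + 1) N2; have := ltz_mod (r + 1) N2.
set q := (_ %/ _)%Z; set s := (_ %% _)%Z => sN s0 rE.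
suff s00 : s = 0 by move: rE; rewrite s00; lia.
have NR : (N%:R : R) != 0 by rewrite pnatr_eq0 -lt0n.
have : cis (s%:~R * (pi / N%:R)) = 1 :> C.
  have E : (r + 1)%:~R * (pi / N%:R) = 2 * pi * q%:~R + s%:~R * (pi / N%:R) :> R.
    by rewrite rE rmorphD rmorphM rmorphM /= -[2%:~R]/(2 : R) -[N%:Z%:~R]/(N%:R : R); field.
  by move: c1; rewrite E cisD cis2piz mul1r.
move=> c2; apply/eqP.
have h : `|s%:~R * (pi / N%:R)| < 2 * pi :> R; last first.
  by have /eqP := cis_eq1 h c2; rewrite mulf_eq0 mulf_eq0 invr_eq0 (negbTE NR) orbF (gt_eqF (pi_gt0 R)) orbF intr_eq0.
have Npos : 0 < N%:R :> R by rewrite ltr0n.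
rewrite ger0_norm; last by rewrite mulr_ge0 ?ler0z// divr_ge0// ?pi_ge0 ?ltW.
rewrite mulrA ltr_pdivrMr// mulrAC mulrC [ltRHS]mulrC ltr_pM2l ?pi_gt0//.
have -> : 2 * N%:R = (2 * N%:Z)%:~R :> R by rewrite rmorphM.
by rewrite ltr_int; lia.
Qed.

End level.
End components.

(** * Possible degrees and eigenvalues *)

Section classification.
Context {R : realType}.
Local Notation C := R[i].
Local Notation G := (SU2 R).
Implicit Types (f h F : G -> C) (g c : G).

Lemma cis_odd (q : int) : cis ((2 * q - 1)%:~R * pi) = -1 :> C.
Proof.
have -> : (2 * q - 1)%:~R * pi = 2 * pi * q%:~R + - pi :> R by rewrite rmorphB rmorphM /=; ring.
by rewrite cisD cis2piz mul1r /cis cosN sinN cospi sinpi; apply: ReIm_eq => /=; ring.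
Qed.

Lemma wt_odd (q : int) F : wt (2 * q - 1) F -> forall g, F (g * gJ * gJ)%g = - F g.
Proof.
move=> wF g; rewrite -mulgA gJJ (wt_rotw wF).
by rewrite cis_odd mulN1r.
Qed.

Lemma casimir_sq (n k : nat) (p : int) : (k <= n)%N -> p - 1 = 2 * k%:Z - n%:Z ->
  4 * k.+1%:R * (n - k)%N%:R = n.+1%:R ^+ 2 - p%:~R ^+ 2 :> C.
Proof.
move=> kn e; rewrite natrB//.
have -> : p = 2 * k%:Z - n%:Z + 1 by lia.
rewrite rmorphD rmorphB rmorphM /= -[k%:Z%:~R]/(k%:R : C) -[n%:Z%:~R]/(n%:R : C) -[2%:~R]/(2 : C) -[1%:~R]/(1 : C).
by rewrite -!natr1; ring.
Qed.

(** A nonzero function with Ep Em F = 0 sits at the top of its chain, n = k, where the weight n is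
    nonnegative. *)
Lemma negative_weight_lowest (p : int) F : 0 <= p -> wt (- p - 1) F -> (forall g, Ep (Em F) g = 0) ->
  forall g, F g = 0.
Proof.
move=> p0 wF E g; apply/eqP/negP => /negP F0.
have E' x : Ep (Em F) x = 0 * F x by rewrite mul0r.
have [n [k [kn e /esym/eqP + _ _]]] := casimir_ends wF E' (ex_intro _ g F0).
by rewrite !mulf_eq0 !pnatr_eq0 /= => h; lia.
Qed.

(** With n = 2k + 1, on [mcoef k k.+1 i] the operator Em gives the factor -2(k + 1), and translation
    by [gJ] restores the same coefficient with the sign (-1)^(k+1). *)
Lemma zero_weight_Em (n : nat) F : odd n -> casimir_eigen n n./2 F ->
  forall g, Em F (g * gJ)%g = (-1) ^+ n./2 * n.+1%:R * F g.
Proof.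
move=> on cF g; have kn : (n./2 <= n)%N by lia.
have [c ->] := casimir_span kn cF.
have nE : (n - n./2)%N = n./2.+1 by lia.
rewrite nE Em_sum; last by move=> i; apply: smZ; exact: sm_mcoef.
rewrite mulr_sumr; apply: eq_bigr => i _.
rewrite EmZ; last exact: sm_mcoef.
rewrite Em_mcoef /= mcoef_gJ exprS.
have -> : n.+1%:R = 2 * n./2.+1%:R :> C by rewrite -natrM; congr _%:R; lia.
by ring.
Qed.

Variables (N : nat) (T : R) (lambda : C).
Hypotheses (N0 : (0 < N)%N) (T0 : 0 < T).
Local Notation mu := (lambda + (T / 2)%:C).
Local Notation t := ((T^-1)%:C).
Local Notation eig := (eigA N T lambda).

Lemma nuE : lambda + (T / 2 + T^-1)%:C = mu + t.
Proof. by rewrite rmorphD addrA. Qed.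

Section level.
Variable L : nat.
Hypothesis HL : forall f, eig f -> forall r, sm (wcomp L r f) /\
  forall g, lie eI (wcomp L r f) g = 'i%C * r%:~R * wcomp L r f g.

(** With weights written as p - 1, the coupling becomes the symmetry p -> -p. *)
Lemma wcomp_Em_sym (p : int) f : eig f -> forall g,
  Em (wcomp L (p - 1) f) (g * gJ)%g = (mu - t * p%:~R) * wcomp L (- p - 1) f g.
Proof.
move=> ef g; rewrite (wcomp_Em HL)// nuE; congr (_ * wcomp L _ f g); last by lia.
by rewrite rmorphB /=; ring.
Qed.

(** Using [wcomp_Em_sym] for p and for -p multiplies the factors mu - p/T and mu + p/T; as p is
    even, the weight p - 1 is odd and gJ^2 acts by -1. *)
Lemma wcomp_casimir (m : int) f : eig f -> let p := 2 * (m * N%:Z) in forall g,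
  Ep (Em (wcomp L (p - 1) f)) g = (mu ^+ 2 - (t * p%:~R) ^+ 2) * wcomp L (p - 1) f g.
Proof.
move=> ef p g; have wF : wt (p - 1) (wcomp L (p - 1) f) by exact: (wcomp_wt HL _ ef).
have [sF' _] : wt (- p - 1) (wcomp L (- p - 1) f) by exact: (wcomp_wt HL _ ef).
have wE : wt (p - 1) (Ep (Em (wcomp L (p - 1) f))).
  by have := wt_Ep (wt_Em wF); rewrite addrK.
have [sE _] := wt_Em wF.
have e x : Ep (Em (wcomp L (p - 1) f)) (x * gJ)%g = - ((mu - t * p%:~R) * Em (wcomp L (- p - 1) f) x).
  have := congr1 (fun F => Em F x) (funext (wcomp_Em_sym p ef)).
  by rewrite Em_gJ// EmZ// => <-; rewrite opprK.
have := e (g * gJ)%g; rewrite (wt_odd wE) (wcomp_Em_sym (- p))// opprK => /oppr_inj ->.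
by rewrite rmorphN /=; ring.
Qed.

(** Raising the component of weight -p - 1 gives, up to translation, a multiple of the component of
    weight p - 1; if the latter vanishes, [negative_weight_lowest] kills the former. *)
Lemma wcomp_nonneg_eq0 f : eig f -> (forall (m : nat) g, wcomp L (2 * (m%:Z * N%:Z) - 1) f g = 0) ->
  forall g, f g = 0.
Proof.
move=> ef H g; rewrite -(wcomp_sum L f g) big1// => j _; move: (j%:Z - L%:Z) => {j} r.
apply/eqP/negP => /negP F0.
have [m rE] := wcomp_lattice HL N0 ef (ex_intro _ g F0).
case: m rE F0 => m rE; first by rewrite rE -mulrA H eqxx.
have E0 x : Em (wcomp L r f) x = 0.
  have -> : x = (x * gJ^-1 * gJ)%g by rewrite mulgVK.
  have -> : r = (- (2 * (m.+1%:Z * N%:Z))) - 1 by rewrite rE NegzE; lia.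
  by rewrite wcomp_Em_sym// opprK H mulr0.
have wF : wt (- (2 * (m.+1%:Z * N%:Z)) - 1) (wcomp L r f).
  by have := wcomp_wt HL r ef; congr wt; rewrite rE NegzE; lia.
have p0 : 0 <= 2 * (m.+1%:Z * N%:Z) :> int by lia.
rewrite (negative_weight_lowest p0 wF) ?eqxx//.
by move=> x; rewrite (_ : Em _ = fun=> 0) ?Ep0//; apply/funext.
Qed.

(* For n odd, [mcoef k (n - k) i] with k = [up_degree m n] has weight 2k - n = 2mN - 1. *)
Definition up_degree (m n : nat) : nat := (N * m + n./2)%N.

(* The eigenvalue [lambda] receives a contribution of dimension n + 1 from the weight 2mN - 1:
   m = 0 corresponds to the families (2) and (3), the two disjuncts to (1) and (4). *)
Definition admissible (m n : nat) : bool := odd n &&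
  if m == 0%N then mu == (-1) ^+ n./2 * n.+1%:R else
  ((2 * N * m < n)%N && (mu ^+ 2 == n.+1%:R ^+ 2 + (2 * N * m)%:R ^+ 2 * (t ^+ 2 - 1))) ||
  ((n.+1 == 2 * N * m)%N && (mu == - (t * (2 * N * m)%:R))).

Lemma admissibleP m n : admissible m n -> [/\ odd n, (2 * N * m <= n.+1)%N &
  mu ^+ 2 = n.+1%:R ^+ 2 + (2 * N * m)%:R ^+ 2 * (t ^+ 2 - 1)].
Proof.
rewrite /admissible => /andP[on]; case: eqP => [->|m0].
  move=> /eqP ->; rewrite muln0 expr0n /= mul0r addr0 leq0n.
  by rewrite exprMn -exprM mulnC exprM sqrrN expr1n expr1n mul1r.
case/orP => /andP[].
  by move=> h /eqP ->; split=> //; exact: ltnW (ltnW _).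
by move=> /eqP <- /eqP ->; split=> //; ring.
Qed.

Lemma t_gt0 : 0 < t.
Proof. by rewrite ltcR invr_gt0. Qed.

Lemma wcomp_classification m f : eig f -> let F := wcomp L (2 * (m%:Z * N%:Z) - 1) f in
  (exists g, F g != 0) -> exists n, admissible m n /\ casimir_eigen n (up_degree m n) F.
Proof.
move=> ef F F0; have wF := wcomp_wt HL (2 * (m%:Z * N%:Z) - 1) ef.
have FE := @wcomp_casimir m f ef.
have [n [k [kn e kE _ _]]] := casimir_ends wF FE F0.
have on : odd n by lia.
have kE' : k = up_degree m n by rewrite /up_degree; lia.
have cF : casimir_eigen n (up_degree m n) F.
  by rewrite -kE'; split; [rewrite -e|rewrite -kE].
exists n; split=> //; rewrite /admissible on /=.
have pE : (2 * (m%:Z * N%:Z))%:~R = (2 * N * m)%:R :> C.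
  by have -> : 2 * (m%:Z * N%:Z) = (2 * N * m)%N%:Z by lia.
move: kE; rewrite (casimir_sq kn e) pE => kE.
have muE : mu ^+ 2 = n.+1%:R ^+ 2 + (2 * N * m)%:R ^+ 2 * (t ^+ 2 - 1).
  by rewrite -[LHS](subrK ((t * (2 * N * m)%:R) ^+ 2)) kE; ring.
have [m0|m0] := eqVneq m 0%N.
  have [g Fg] := F0; apply/eqP/(mulIf Fg).
  have k0 : up_degree m n = n./2 by rewrite /up_degree m0 muln0.
  move: cF; rewrite k0 => /(zero_weight_Em on) <-.
  by rewrite /F wcomp_Em_sym// m0 mul0r mulr0 !mulr0 subr0 oppr0.
(* k <= n and the parity of n leave only 2Nm < n and 2Nm = n + 1. *)
apply/orP; have [pn|pn] := ltnP (2 * N * m) n; first by left; rewrite muE eqxx.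
have nE : n.+1 = (2 * N * m)%N by lia.
right; rewrite nE eqxx /=; move: muE; rewrite nE => muE.
have : (mu - t * (2 * N * m)%:R) * (mu + t * (2 * N * m)%:R) = 0.
  by rewrite -subr_sqr muE; ring.
move/eqP; rewrite mulf_eq0 => /orP[]; last by rewrite addr_eq0.
(* With p = 2Nm, mu = p/T kills the component of weight -p - 1; the coupling from -p back to p,
   whose factor is 2p/T, then kills F. *)
move=> mu0; have [g Fg] := F0; case/negP: Fg.
have wF' := wcomp_wt HL (- (2 * (m%:Z * N%:Z)) - 1) ef.
have : forall x, wcomp L (- (2 * (m%:Z * N%:Z)) - 1) f x = 0.
  apply: (negative_weight_lowest _ wF'); first by lia.
  move=> x; have := @wcomp_casimir (- m%:Z) f ef x; rewrite mulNr mulrN => ->.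
  by rewrite rmorphN /= mulrN sqrrN pE subr_sqr (eqP mu0) !mul0r.
move=> F'0; have := @wcomp_Em_sym (- (2 * (m%:Z * N%:Z))) f ef g.
rewrite (_ : wcomp L (- _ - 1) f = fun=> 0); last by apply/funext.
rewrite Em0 opprK rmorphN /= mulrN opprK pE => /esym/eqP; rewrite mulf_eq0 => /orP[|//].
rewrite (subr0_eq (eqP mu0)) -mulr2n mulrn_eq0 mulf_eq0 /= gt_eqF ?t_gt0//= pnatr_eq0; lia.
Qed.

End level.
End classification.

(** * A basis of the eigenspace *)

Section eigenbasis.
Context {R : realType}.
Local Notation C := R[i].
Local Notation G := (SU2 R).
Implicit Types (f h F : G -> C) (g c : G).

Variables (N : nat) (T : R) (lambda : C).
Hypotheses (N0 : (0 < N)%N) (T0 : 0 < T).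
Local Notation mu := (lambda + (T / 2)%:C).
Local Notation t := ((T^-1)%:C).
Local Notation eig := (eigA N T lambda).
Local Notation cond := (admissible N T lambda).
Local Notation kk := (up_degree N).

Lemma eigA_comb d (a : 'I_d -> C) (F : 'I_d -> G -> C) : (forall i, eig (F i)) ->
  eig (fun g => \sum_(i < d) a i * F i g).
Proof.
move=> eF; have sF i : sm (F i) by have [] := eF i.
have saF i : sm (fun g => a i * F i g) by exact: smZ.
split=> [|g|g]; first exact: sm_sum.
  by rewrite mulr_sumr; apply: eq_bigr => i _; have [_ -> _] := eF i; ring.
rewrite Em_sum// (lie_sum _ _ su2_eI)// !mulr_sumr -sumrB.
apply: eq_bigr => i _; rewrite EmZ// (lieZ _ su2_eI)//.
by have [_ _ ->] := eF i; ring.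
Qed.

Lemma eigAB f h : eig f -> eig h -> eig (fun g => f g - h g).
Proof.
move=> ef eh.
have -> : (fun g => f g - h g) =
    fun g => \sum_(i < 2) (if i == ord0 then 1 else -1) * (if i == ord0 then f else h) g.
  by apply/funext => g; rewrite !big_ord_recl big_ord0 /= addr0 mul1r mulN1r.
by apply: eigA_comb => i; case: ifP.
Qed.

Lemma admissible_uniq m n n' : cond m n -> cond m n' -> n = n'.
Proof.
move=> /admissibleP [_ _ e] /admissibleP [_ _]; rewrite e => /addIr.
by rewrite -!natrX => /eqP; rewrite eqr_nat eqn_sqr => /eqP [].
Qed.

(** A matrix coefficient of weight p - 1, p = 2Nm, together with the part of weight -p - 1 that
    [wcomp_Em_sym] forces. For m = 0 the two weights coincide and nothing is added. *)
Definition phi (m n i : nat) g : C := mcoef (kk m n) (n - kk m n) i g +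
  (if m == 0%N then 0 else (mu - t * (2 * N * m)%:R)^-1) * Em (mcoef (kk m n) (n - kk m n) i) (g * gJ)%g.

Lemma kk_le m n : cond m n -> (kk m n <= n)%N.
Proof. by move=> /admissibleP [on mn _]; rewrite /up_degree; lia. Qed.

Lemma kk_wt m n i : cond m n -> wt (2 * (m%:Z * N%:Z) - 1) (mcoef (kk m n) (n - kk m n) i : G -> C).
Proof.
move=> cmn; have kn := kk_le cmn; have [on mn _] := admissibleP cmn.
by have := @wt_mcoef R (kk m n) (n - kk m n) i; congr wt; rewrite /up_degree in kn *; lia.
Qed.

(** With p = 2Nm: if p < n, then mu = p/T would turn the formula for mu^2 into (n + 1)^2 = p^2; if n
    + 1 = p, the difference is -2p/T. *)
Lemma mu_neq m n : cond m n -> m != 0%N -> mu - t * (2 * N * m)%:R != 0.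
Proof.
move=> cmn m0; have [_ _ mu2] := admissibleP cmn.
have tp : 0 < t * (2 * N * m)%:R.
  rewrite mulr_gt0 ?(t_gt0 T0)// ltr0n; lia.
move: cmn; rewrite /admissible (negbTE m0) => /andP[_ /orP[/andP[pn _]|/andP[_ /eqP ->]]]; last first.
  by rewrite -opprD oppr_eq0 -mulr2n mulrn_eq0 /= gt_eqF.
apply/eqP => /subr0_eq muE; move: mu2; rewrite muE => /eqP; rewrite -subr_eq0.
have -> : (t * (2 * N * m)%:R) ^+ 2 - (n.+1%:R ^+ 2 + (2 * N * m)%:R ^+ 2 * (t ^+ 2 - 1)) =
  (2 * N * m)%:R ^+ 2 - n.+1%:R ^+ 2 :> C by ring.
by rewrite subr_eq0 -!natrX eqr_nat eqn_sqr; lia.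
Qed.

Lemma phi_zero m n i : cond m n -> m = 0%N -> forall g,
  Em (mcoef (kk m n) (n - kk m n) i) (g * gJ)%g = mu * mcoef (kk m n) (n - kk m n) i g.
Proof.
move=> cmn m0 g; have [on _ _] := admissibleP cmn; have kn := kk_le cmn.
have kE : kk m n = n./2 by rewrite /up_degree m0 muln0.
have := @casimir_mcoef R (kk m n) (n - kk m n) i; rewrite subnKC// kE.
move=> /(zero_weight_Em on) ->; congr (_ * _).
by move: cmn; rewrite /admissible m0 eqxx => /andP[_ /eqP].
Qed.

Lemma phi_eig m n i : cond m n -> eig (phi m n i).
Proof.
move=> cmn; have [on mn mu2] := admissibleP cmn; have kn := kk_le cmn.
have := kk_wt i cmn; have := phi_zero i cmn; rewrite /phi.
have := @casimir_mcoef R (kk m n) (n - kk m n) i; rewrite subnKC//.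
move: (mcoef _ _ _) => F [_ FE] F0 wF; have wE := wt_Em wF.
have wH : wt (- (2 * (m%:Z * N%:Z)) - 1) (fun g => Em F (g * gJ)%g).
  by have := wt_gJ wE; congr wt; lia.
have [sF FI] := wF; have [sH HI] := wH.
set c := (if _ then _ else _).
have pE : (2 * (m%:Z * N%:Z))%:~R = (2 * N * m)%:R :> C.
  by have -> : 2 * (m%:Z * N%:Z) = (2 * N * m)%N%:Z by lia.
split; first by apply: smD => //; exact: smZ.
  move=> g.
  have rot (q : int) : cis ((2 * (q * N%:Z) - 1)%:~R * (pi / N%:R)) = cis (- (pi / N%:R)) :> C.
    have NR : N%:R != 0 :> R by rewrite pnatr_eq0 -lt0n.
    have -> : (2 * (q * N%:Z) - 1)%:~R * (pi / N%:R) = 2 * pi * q%:~R + - (pi / N%:R) :> R.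
      by rewrite rmorphB rmorphM rmorphM /= -[N%:Z%:~R]/(N%:R : R) -[2%:~R]/(2:R) -[1%:~R]/(1:R); field.
    by rewrite cisD cis2piz mul1r.
  have rF := wt_rotw wF g (pi / N%:R); have rH := wt_rotw wH g (pi / N%:R).
  rewrite rF rH rot (_ : - (2 * (m%:Z * N%:Z)) = 2 * ((- m%:Z) * N%:Z)); last by lia.
  by rewrite rot; ring.
move=> g; rewrite (EmD sF (smZ _ sH)) (EmZ _ sH) (lieD su2_eI sF (smZ _ sH)) (lieZ _ su2_eI sH).
have [sE _] := wE.
rewrite FI HI Em_gJ// (wt_odd (q := m%:Z * N%:Z)); last by have := wt_Ep wE; rewrite addrK.
rewrite FE opprK (casimir_sq (p := 2 * (m%:Z * N%:Z)) kn); last first.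
  by rewrite /up_degree in kn *; lia.
rewrite nuE pE !rmorphB rmorphN /= pE -[1%:~R]/(1 : C).
(* For m > 0 the coefficients of the two weights agree separately, since (n + 1)^2 - p^2 = mu^2 -
   p^2/T^2; for m = 0 both parts have weight -1 and [phi_zero] relates them. *)
have cE : c * (n.+1%:R ^+ 2 - (2 * N * m)%:R ^+ 2) * F g + Em F (g * gJ)%g = (mu + t * (2 * N * m)%:R) * F g + c * (mu - t * (2 * N * m)%:R) * Em F (g * gJ)%g.
  rewrite /c; case: eqP => [m0|/eqP m0].
    by rewrite F0// m0 muln0; ring.
  have M0 := mu_neq cmn m0; rewrite mulVf// mul1r; congr (_ * _ + _).
  have -> : n.+1%:R ^+ 2 - (2 * N * m)%:R ^+ 2 = (mu - t * (2 * N * m)%:R) * (mu + t * (2 * N * m)%:R).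
    by rewrite -subr_sqr mu2; ring.
  by rewrite mulKf.
move: cE; move: (F g) (Em F (g * gJ)%g) => x y cE.
transitivity (c * (n.+1%:R ^+ 2 - (2 * N * m)%:R ^+ 2) * x + y); first by ring.
rewrite cE; apply/eqP; rewrite -subr_eq0; apply/eqP.
transitivity (('i%C * 'i%C + 1) * (t * ((2 * N * m)%:R - 1) * x - c * t * ((2 * N * m)%:R + 1) * y)); first by ring.
by rewrite sqr_iC addNr mul0r.
Qed.

(** 2Nm < L keeps both weights of [phi] in [-L, L]; for m > 0 the weight -2Nm - 1 lies below all
    weights 2Nm' - 1. *)
Lemma wcomp_phi L m m' n i : cond m n -> (2 * N * m < L)%N ->
  wcomp L (2 * (m'%:Z * N%:Z) - 1) (phi m n i) =
  fun g => if m' == m then mcoef (kk m n) (n - kk m n) i g else 0.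
Proof.
move=> cmn mL; have wF := kk_wt i cmn; have wH := wt_gJ (wt_Em wF).
have wH' : wt (- (2 * (m%:Z * N%:Z)) - 1) (fun g => Em (mcoef (kk m n) (n - kk m n) i) (g * gJ)%g).
  by have := wH; congr wt; lia.
pose c : C := if m == 0%N then 0 else (mu - t * (2 * N * m)%:R)^-1.
have -> : phi m n i = fun g => \sum_(j < 2) (if j == ord0 then 1 else c) *
    (if j == ord0 then mcoef (kk m n) (n - kk m n) i else fun g => Em (mcoef (kk m n) (n - kk m n) i) (g * gJ)%g) g.
  by apply/funext => g; rewrite !big_ord_recl big_ord0 /= addr0 mul1r.
rewrite wcomp_comb; apply/funext => g; rewrite !big_ord_recl big_ord0 /= addr0 mul1r.
rewrite (wcomp_rotw _ _ (wt_rotw wF)); last by lia.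
rewrite (wcomp_rotw _ _ (wt_rotw wH')); last by lia.
have -> : (2 * (m%:Z * N%:Z) - 1 == 2 * (m'%:Z * N%:Z) - 1 :> int) = (m' == m) by nia.
rewrite /c; have [m0|m0] := eqVneq m 0%N; first by rewrite mul0r addr0.
rewrite (_ : (_ == _ :> int) = false) ?mulr0 ?addr0//; apply/eqP => e; nia.
Qed.

Lemma wcomp0 L r : wcomp L r (fun=> 0) = fun=> 0 :> C.
Proof.
have := @wcomp_comb R L r 0 (fun=> 0) (fun=> fun=> 0).
rewrite (_ : (fun g => _) = fun=> 0); last by apply/funext => g; rewrite big_ord0.
by move=> ->; apply/funext => g; rewrite big_ord0.
Qed.

Section dimension.
Variables (L B : nat).
Hypothesis HL : forall f, eig f -> forall r, sm (wcomp L r f) /\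
  forall g, lie eI (wcomp L r f) g = 'i%C * r%:~R * wcomp L r f g.
Hypothesis BL : (2 * N * B < L)%N.
Hypothesis condB : forall m n, cond m n -> (m < B)%N /\ (n < B)%N.

(** Reads off, up to a nonzero factor, the coefficient of [phi m n i] in an eigenfunction
    ([dual_phi]). *)
Definition dual (m n i : nat) f : C :=
  jet n (kk m n) (n - i) (wcomp L (2 * (m%:Z * N%:Z) - 1) f).

Lemma dual_phi m n i : cond m n -> (i <= n)%N -> exists2 a : C, a != 0 &
  forall m' n' i', cond m' n' -> (i' <= n')%N ->
  dual m n i (phi m' n' i') = a * ((m', n', i') == (m, n, i))%:R.
Proof.
move=> cmn ni; have kn := kk_le cmn.
have [a a0 E] := @jet_mcoef R n _ _ kn (leq_subr i n); exists a => // m' n' i' cmn' ni'.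
have [mB _] := condB cmn'.
rewrite /dual wcomp_phi//; last by apply: leq_ltn_trans BL; rewrite leq_mul2l ltnW ?orbT.
rewrite !xpair_eqE [m == m']eq_sym; have [e|_] := eqVneq m' m; last by rewrite jet0 mulr0.
subst m'; rewrite (admissible_uniq cmn' cmn) eqxx /=.
by rewrite -[fun g => _]/(mcoef (kk m n) (n - kk m n) i') E subKn.
Qed.

Lemma dual_comb m n i d (c : 'I_d -> C) (F : 'I_d -> G -> C) : (forall j, eig (F j)) ->
  dual m n i (fun g => \sum_(j < d) c j * F j g) = \sum_(j < d) c j * dual m n i (F j).
Proof.
move=> eF; have sF j : sm (wcomp L (2 * (m%:Z * N%:Z) - 1) (F j)) by have [] := HL (eF j) (2 * (m%:Z * N%:Z) - 1).
rewrite /dual wcomp_comb jet_sum; last by move=> j; exact: smZ.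
by apply: eq_bigr => j _; rewrite jetZ.
Qed.

Lemma dualB m n i f h : eig f -> eig h ->
  dual m n i (fun g => f g - h g) = dual m n i f - dual m n i h.
Proof.
move=> ef eh.
have [sf _] := HL ef (2 * (m%:Z * N%:Z) - 1); have [sh _] := HL eh (2 * (m%:Z * N%:Z) - 1).
rewrite /dual wcompB (_ : (fun g => _) = fun g => wcomp L (2 * (m%:Z * N%:Z) - 1) f g + (-1) * wcomp L (2 * (m%:Z * N%:Z) - 1) h g).
  by rewrite jetD ?jetZ ?mulN1r//; exact: smZ.
by apply/funext => g; rewrite mulN1r.
Qed.

(** The components with m >= 0 determine f; each nonzero one has an admissible degree n, and its
    jets determine it. *)
Lemma dual_eq0 f : eig f -> (forall m n i, cond m n -> (i <= n)%N -> dual m n i f = 0) ->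
  forall g, f g = 0.
Proof.
move=> ef D; apply: (wcomp_nonneg_eq0 N0 T0 HL ef) => m g; apply/eqP/negP => /negP F0.
have [n [cmn cF]] := wcomp_classification N0 T0 HL ef (ex_intro _ g F0).
have kn := kk_le cmn; case/eqP: F0; apply: (casimir_uniq kn cF) => l ln.
by have := D m n (n - l)%N cmn (leq_subr _ _); rewrite /dual subKn.
Qed.

Definition eigen_index : {set 'I_B * 'I_B * 'I_B} := [set x : 'I_B * 'I_B * 'I_B | cond x.1.1 x.1.2 & (x.2 <= x.1.2)%N].

Lemma card_eigen_index : #|eigen_index| = (\sum_(m < B) \sum_(n < B) if cond m n then n.+1 else 0)%N.
Proof.
pose u (y : 'I_B * 'I_B) (i : 'I_B) : nat := if (y, i) \in eigen_index then 1 else 0.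
pose v (m n : 'I_B) : nat := \sum_(i < B) u (m, n) i.
transitivity (\sum_(x : 'I_B * 'I_B * 'I_B) u x.1 x.2)%N.
  by rewrite -sum1_card big_mkcond /=; apply: eq_bigr => -[y i] _.
rewrite -(pair_bigA _ u) /=.
transitivity (\sum_(y : 'I_B * 'I_B) v y.1 y.2)%N; first by apply: eq_bigr => -[m n] _.
rewrite -(pair_bigA _ v) /=.
apply: eq_bigr => m _; apply: eq_bigr => n _.
rewrite /v /u; under eq_bigr do rewrite inE /=.
have [_|_] := boolP (cond m n) => /=; last by rewrite big1.
rewrite -big_mkcond /= (eq_bigl (fun i : 'I_B => (i < n.+1)%N))//.
by rewrite (big_ord_narrow (ltn_ord n)) sum1_card card_ord.
Qed.

Lemma dirac_eigenspace_dim : has_dim (dirac_eigenspace N T lambda) #|eigen_index|.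
Proof.
pose x (j : 'I_#|eigen_index|) := enum_val j.
pose F j := phi (x j).1.1 (x j).1.2 (x j).2.
have xP j : cond (x j).1.1 (x j).1.2 /\ ((x j).2 <= (x j).1.2)%N.
  by have := enum_valP j; rewrite inE => /andP.
have eF j : eig (F j) by have [h _] := xP j; exact: phi_eig.
have /choice [a aP] : forall j, exists a : C, a != 0 /\
    forall j', dual (x j).1.1 (x j).1.2 (x j).2 (F j') = a * (j' == j)%:R.
  move=> j; have [c i_n] := xP j; have [a a0 E] := dual_phi c i_n.
  exists a; split=> // j'; have [c' i_n'] := xP j'; rewrite /F E//; congr (_ * _%:R).
  congr nat_of_bool; rewrite -(inj_eq (@enum_val_inj _ (mem eigen_index))) -/(x j) -/(x j').
  by case: (x j) => [[? ?] ?]; case: (x j') => [[? ?] ?].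
apply: (has_dim_eigA N0 eF) => [c c0 j|f ef].
  have [aj E] := aP j; apply/eqP.
  have : dual (x j).1.1 (x j).1.2 (x j).2 (fun g => \sum_(i < #|eigen_index|) c i * F i g) = 0.
    by rewrite (_ : (fun g => _) = fun=> 0) ?/dual ?wcomp0 ?jet0//; apply/funext.
  rewrite dual_comb// (bigD1 j)//= big1 => [|i ij]; last by rewrite E (negbTE ij) !mulr0.
  by rewrite addr0 E eqxx mulr1 => /eqP; rewrite mulf_eq0 (negbTE aj) orbF.
pose c j := dual (x j).1.1 (x j).1.2 (x j).2 f / a j.
have eS : eig (fun g => \sum_(i < #|eigen_index|) c i * F i g) by exact: eigA_comb.
exists c; apply/funext => g; apply/eqP; rewrite -subr_eq0; apply/eqP.
apply: (dual_eq0 (eigAB ef eS)) => m n i cmn ni.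
have [mB nB] := condB cmn; have iB := leq_ltn_trans ni nB.
have yI : (Ordinal mB, Ordinal nB, Ordinal iB) \in eigen_index by rewrite inE /= cmn.
have [j xj] : exists j, x j = (Ordinal mB, Ordinal nB, Ordinal iB).
  by exists (enum_rank_in yI (Ordinal mB, Ordinal nB, Ordinal iB)); rewrite /x enum_rankK_in.
have [aj E] := aP j; rewrite dualB// dual_comb//.
have -> : dual m n i = dual (x j).1.1 (x j).1.2 (x j).2 by rewrite xj.
rewrite (bigD1 j)//= big1 => [|k kj]; last by rewrite E (negbTE kj) !mulr0.
by rewrite addr0 E eqxx mulr1 /c mulfVK// subrr.
Qed.

End dimension.
End eigenbasis.

(** * Multiplicities *)

Section counting.
Context {R : realType}.
Local Notation C := R[i].
Local Notation Re := complex.Re.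

(** Turns a sum over a possibly infinite index set into a finite one, all nonzero terms lying in the
    list r. *)
Lemma esum_nat_seq (I : choiceType) (S : set I) (P : pred I) (r : seq I) (u : I -> nat) : uniq r ->
  (forall i, S i <-> P i) -> (forall i, P i -> u i != 0%N -> i \in r) ->
  (\esum_(i in S) (u i)%:R%:E = (\sum_(i <- r | P i) u i)%N%:R%:E :> \bar R)%E.
Proof.
move=> ur SP Pr; pose v i : nat := if P i then u i else 0%N.
transitivity (\esum_(i in [set` r]) (v i)%:R%:E : \bar R)%E.
  rewrite esum_mkcond [RHS]esum_mkcond; apply: eq_esum => i _; rewrite /v.
  have -> : (i \in S) = P i by apply/idP/idP; rewrite inE => /SP.
  have -> : (i \in [set` r]%classic) = (i \in r) by apply/idP/idP; rewrite inE.
  case: ifP => Pi; last by rewrite if_same.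
  by case: ifP => // /negbT; apply: contraNeq => ui; apply: Pr => //; apply: contraNneq ui => ->.
rewrite esum_fset; [|exact: finite_seq|by move=> i _; rewrite lee_fin].
rewrite -fsbig_seq// sumEFin; congr (_%:E).
by rewrite -natr_sum [in RHS]big_mkcond.
Qed.

Variables (N : nat) (T : R) (lambda : C).
Hypotheses (N0 : (0 < N)%N) (T0 : 0 < T).
Local Notation mu := (lambda + (T / 2)%:C).
Local Notation t := ((T^-1)%:C).
Local Notation cond := (admissible N T lambda).

Definition mult_at (x : R) (k : nat) : nat := if lambda == x%:C then k else 0%N.

Lemma contribE x k : contrib lambda x k = (mult_at x k)%:R%:E :> \bar R.
Proof. by []. Qed.

Lemma lambda_mu (x : R) : (lambda == (- (T / 2) + x)%:C) = (mu == x%:C).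
Proof.
rewrite -(inj_eq (addIr (T / 2)%:C)); congr (_ == _).
by rewrite -rmorphD addrAC addNr add0r.
Qed.

Lemma natC (n : nat) : (n%:R : C) = (n%:R)%:C.
Proof. by rewrite rmorph_nat. Qed.

Definition radicand (n m : nat) : R := (1 + n%:R) ^+ 2 + 4 * m%:R ^+ 2 * N%:R ^+ 2 * ((T ^+ 2)^-1 - 1).

Lemma radicandE n m : radicand n m = n.+1%:R ^+ 2 + (2 * N * m)%:R ^+ 2 * (T^-1 ^+ 2 - 1).
Proof. by rewrite /radicand -natr1 !natrM exprVn; ring. Qed.

Lemma radicandC n m : (radicand n m)%:C = n.+1%:R ^+ 2 + (2 * N * m)%:R ^+ 2 * (t ^+ 2 - 1) :> C.
Proof.
by rewrite radicandE !(rmorphD, rmorphB, rmorphM, rmorphXn, rmorph1, rmorphN) /= !natC.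
Qed.

(** With p = 2Nm and q = n + 1 the radicand is affine in p^2, running from q^2 at p = 0 to q^2 / T^2
    at p = q, and q <= q^2. The bound makes the square roots positive and n bounded in terms of
    mu. *)
Lemma radicand_ge n m : (2 * N * m <= n.+1)%N -> n.+1%:R * Num.min 1 (T^-1 ^+ 2) <= radicand n m.
Proof.
move=> mn; rewrite radicandE; set p : R := (2 * N * m)%:R; set q : R := n.+1%:R.
have pq : p <= q by rewrite ler_nat.
have p0 : 0 <= p by rewrite ler0n.
have q1 : 1 <= q by rewrite ler1n.
have t0 : 0 < T^-1 ^+ 2 by rewrite exprn_gt0// invr_gt0.
have q2 : q <= q ^+ 2 by rewrite expr2 ler_peMl// (le_trans _ q1).
have p2 : p ^+ 2 <= q ^+ 2 by rewrite lerXn2r// nnegrE (le_trans _ q1).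
have p20 : 0 <= p ^+ 2 by rewrite sqr_ge0.
move: (T^-1 ^+ 2) t0 (p ^+ 2) (q ^+ 2) q2 p2 p20 => x x0 pp qq q2 p2 p20.
rewrite minEle; case: ifP => [|/negbT]; rewrite -?ltNge => x1.
  have := mulr_ge0 p20 (_ : 0 <= x - 1); rewrite subr_ge0 => /(_ x1); lra.
have h1 : 0 <= (qq - pp) * (1 - x) by rewrite mulr_ge0// subr_ge0// ltW.
have h2 : 0 <= (qq - q) * x by rewrite mulr_ge0// ?subr_ge0// ltW.
lra.
Qed.

Lemma admissible_bound : exists B, forall m n, cond m n -> (m < B)%N /\ (n < B)%N.
Proof.
have t0 : 0 < Num.min 1 (T^-1 ^+ 2) by rewrite lt_min ltr01 exprn_gt0// invr_gt0.
pose x := Re (mu ^+ 2) / Num.min 1 (T^-1 ^+ 2).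
exists (Num.bound x).+1 => m n /admissibleP[_ mn mu2].
have := radicand_ge mn; have -> : radicand n m = Re (mu ^+ 2) by rewrite mu2 -radicandC.
rewrite -ler_pdivlMr// -/x => h.
have nB : (n.+1 < Num.bound x)%N.
  by rewrite -(ltr_nat R) (le_lt_trans h)// archi_boundP// (le_trans _ h).
by split; nia.
Qed.

(** Family (1), with m standing for the absolute value of its negative index. *)
Definition pair_mult (m n : nat) : nat :=
  if odd n && (0 < m)%N && (2 * N * m < n)%N then
    (mult_at (- (T / 2) + Num.sqrt (radicand n m))%R n.+1 + mult_at (- (T / 2) - Num.sqrt (radicand n m))%R n.+1)%N else 0%N.

Definition plus_mult (n : nat) : nat := if (n %% 4 == 1)%N then mult_at (- (T / 2) + (n%:R + 1)) n.+1 else 0%N.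
Definition minus_mult (n : nat) : nat := if (n %% 4 == 3)%N then mult_at (- (T / 2) - (n%:R + 1)) n.+1 else 0%N.
Definition lowest_mult (m : nat) : nat := mult_at (- (T / 2) - 2 * m%:R * N%:R / T) (2 * m * N)%N.

(** The root is positive, so the two values are distinct and mu equals at most one of them: the sum
    is n + 1 exactly when mu^2 is the radicand. *)
Lemma pair_multE m n : pair_mult m n =
  if odd n && (0 < m)%N && (2 * N * m < n)%N && (mu ^+ 2 == n.+1%:R ^+ 2 + (2 * N * m)%:R ^+ 2 * (t ^+ 2 - 1)) then n.+1 else 0%N.
Proof.
rewrite /pair_mult; case: ifP => [/andP[/andP[_ _] mn]|//].
have r0 : 0 < radicand n m.
  apply: lt_le_trans (radicand_ge (leqW (ltnW mn))); rewrite mulr_gt0// lt_min ltr01.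
  by rewrite exprn_gt0// invr_gt0.
have s0 : 0 < Num.sqrt (radicand n m) by rewrite sqrtr_gt0.
rewrite -radicandC; have := sqr_sqrtr (ltW r0).
move: (Num.sqrt _) s0 => s s0 <-.
rewrite /mult_at !lambda_mu rmorphXn eqf_sqr rmorphN /=.
have [->|] := eqVneq mu s%:C; last by case: ifP.
rewrite (_ : (s%:C == - s%:C :> C) = false) ?addn0 ?eqxx//.
by apply/eqP => -[] e; lra.
Qed.

(** m = 0 carries families (2) and (3), the sign (-1)^((n-1)/2) separating n = 1 from n = 3 modulo
    4; m > 0 carries (1) for 2Nm < n and (4) for 2Nm = n + 1. *)
Lemma admissible_terms m n : (if cond m n then n.+1 else 0%N) =
  (pair_mult m n + (if m == 0 then plus_mult n + minus_mult n else 0) +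
   (if n.+1 == 2 * N * m then lowest_mult m else 0))%N.
Proof.
have even_sign (k : nat) : n = (4 * k + 1)%N -> (-1) ^+ n./2 = 1 :> C.
  move=> ->; have -> : ((4 * k + 1)./2 = 2 * k)%N by lia.
  by rewrite exprM sqrrN !expr1n.
have odd_sign (k : nat) : n = (4 * k + 3)%N -> (-1) ^+ n./2 = -1 :> C.
  move=> ->; have -> : ((4 * k + 3)./2 = (2 * k).+1)%N by lia.
  by rewrite exprS exprM sqrrN !expr1n mulr1.
rewrite pair_multE /plus_mult /minus_mult /lowest_mult /mult_at !lambda_mu /admissible.
have [->|m0] := eqVneq m 0%N.
  rewrite ltnn !andbF /= muln0 add0n addn0.
  have E : (n%:R + 1)%:C = n.+1%:R :> C by rewrite natr1 natC.
  have E' : (- (n%:R + 1))%:C = - n.+1%:R :> C by rewrite -E rmorphN.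
  rewrite E E'.
  have := modn_small (ltn_pmod n (isT : 0 < 4)%N); have nE := divn_eq n 4.
  move: (ltn_pmod n (isT : 0 < 4)%N) nE; case: (n %% 4)%N => [|[|[|[|//]]]] _ nE _ /=.
  - by rewrite (_ : odd n = false)//; lia.
  - by rewrite (_ : odd n = true) /= ?(even_sign (n %/ 4)%N) ?mul1r ?addn0//; lia.
  - by rewrite (_ : odd n = false)//; lia.
  - by rewrite (_ : odd n = true) /= ?(odd_sign (n %/ 4)%N) ?mulN1r ?addn0//; lia.
rewrite lt0n m0 /= addn0 andbT.
have -> : (- (2 * m%:R * N%:R / T))%:C = - (t * (2 * N * m)%:R) :> C.
  by rewrite natC -(rmorphM (real_complex R)) -(rmorphN (real_complex R)) !natrM; congr _%:C; ring.
have [pn|pn] := eqVneq n.+1 (2 * N * m)%N.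
  have -> : (2 * N * m < n)%N = false by lia.
  rewrite andbF /= (_ : odd n = true) /=; last by lia.
  by rewrite pn mulnAC; case: ifP.
by rewrite /= orbF addn0 andbA; case: ifP.
Qed.

End counting.

(** * Total multiplicity *)

Section total.
Context {R : realType}.
Variables (N : nat) (T : R) (lambda : R[i]) (B : nat).
Hypotheses (N0 : (0 < N)%N) (T0 : 0 < T).
Hypothesis condB : forall m n, admissible N T lambda m n -> (m < B)%N /\ (n < B)%N.

Lemma pair_mult_admissible m n : pair_mult N T lambda m n != 0%N -> admissible N T lambda m n.
Proof.
have := admissible_terms lambda N0 T0 m n; case: ifP => // _.
by move=> /esym/eqP; rewrite !addn_eq0 => /andP[/andP[/eqP -> _] _].
Qed.

Lemma plus_mult_lt n : plus_mult T lambda n != 0%N -> (n < B)%N.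
Proof.
move=> h; suff /condB[] : admissible N T lambda 0 n by [].
have := admissible_terms lambda N0 T0 0 n; case: ifP => // _ /esym/eqP.
by rewrite !addn_eq0 /= => /andP[/andP[_ /andP[/eqP e _]] _]; rewrite e in h.
Qed.

Lemma minus_mult_lt n : minus_mult T lambda n != 0%N -> (n < B)%N.
Proof.
move=> h; suff /condB[] : admissible N T lambda 0 n by [].
have := admissible_terms lambda N0 T0 0 n; case: ifP => // _ /esym/eqP.
by rewrite !addn_eq0 /= => /andP[/andP[_ /andP[_ /eqP e]] _]; rewrite e in h.
Qed.

Lemma lowest_mult_admissible m : lowest_mult N T lambda m != 0%N -> (0 < m)%N /\ admissible N T lambda m (2 * N * m).-1.
Proof.
move=> h; have m0 : (0 < m)%N.
  by rewrite lt0n; apply: contraNneq h => ->; rewrite /lowest_mult /mult_at muln0 mul0n; case: ifP.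
split=> //; have := admissible_terms lambda N0 T0 m (2 * N * m).-1; case: ifP => // _ /esym/eqP.
rewrite !addn_eq0 prednK; last by lia.
by rewrite eqxx => /andP[_ /eqP e]; rewrite e in h.
Qed.

Lemma sum_mult : (\sum_(m < B) \sum_(n < B) (if admissible N T lambda m n then n.+1 else 0) =
  \sum_(m < B) \sum_(n < B) pair_mult N T lambda m n + \sum_(n < B) plus_mult T lambda n + \sum_(n < B) minus_mult T lambda n + \sum_(m < B) lowest_mult N T lambda m)%N.
Proof.
under eq_bigr do under eq_bigr do rewrite (admissible_terms lambda N0 T0).
under eq_bigr do rewrite !big_split /=.
rewrite !big_split /= -!addnA; congr (_ + _)%N; rewrite addnA -[X in _ = (X + _)%N]big_split /=; congr (_ + _)%N.
  case: B => [|b]; first by rewrite !big_ord0.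
  by rewrite big_ord_recl /= [X in (_ + X)%N]big1 ?addn0// => m _; rewrite big1.
apply: eq_bigr => m _; rewrite -big_mkcond /=.
have [->|h] := eqVneq (lowest_mult N T lambda m) 0%N; first by rewrite big1_eq.
have [m0 /condB[_ nB]] := lowest_mult_admissible h.
rewrite (eq_bigl (fun i : 'I_B => i == Ordinal nB)) ?big_pred1_eq// => i.
by apply/eqP/eqP => [e|->] /=; [apply: val_inj => /=; lia|lia].
Qed.

End total.

Theorem theorem6p1 (R : realType) (N : nat) (T : R) :
  (2 <= N)%N -> 0 < T ->
  forall lambda : R[i],
  exists2 d : nat, has_dim (dirac_eigenspace N T lambda) d &
    (d%:R%:E =
       \esum_(p in [set p : nat * int |
           odd p.1 /\ (- p.1%:Z <= 2 * p.2 * N%:Z - 1 < - 1)%R])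
         (let s := Num.sqrt ((1 + p.1%:R) ^+ 2
                + 4 * p.2%:~R ^+ 2 * N%:R ^+ 2 * ((T ^+ 2)^-1 - 1))%R in
          contrib lambda (- (T / 2) + s)%R p.1.+1
          + contrib lambda (- (T / 2) - s)%R p.1.+1)
     + \esum_(n in [set n : nat | n = 1 %[mod 4]])
         contrib lambda (- (T / 2) + (n%:R + 1))%R n.+1
     + \esum_(n in [set n : nat | n = 3 %[mod 4]])
         contrib lambda (- (T / 2) - (n%:R + 1))%R n.+1
     + \esum_(m in [set: nat])
         contrib lambda (- (T / 2) - 2 * m%:R * N%:R / T)%R (2 * m * N)%N)%E.
Proof.
move=> N2 T0 lambda; have N0 : (0 < N)%N by exact: ltnW.
have [B condB] := admissible_bound lambda N0 T0.
have k0 : 0 < T ^- 2 by rewrite invr_gt0 exprn_gt0.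
have [L0 WD] := weight_decomposition (2 * T ^- 2 - 2)
  (2 * (lambda + (T / 2 + T^-1)%:C) * (T^-1)%:C - (lambda + (T / 2 + T^-1)%:C) ^+ 2) k0.
(* L is at least L0, for exact weights, and larger than 2NB, so that all weights of the functions
   [phi] are in range. *)
pose L := (L0 + (2 * N * B).+1)%N.
have HL f : eigA N T lambda f -> forall r, sm (wcomp L r f) /\
    forall g, lie eI (wcomp L r f) g = 'i%C * r%:~R * wcomp L r f g.
  move=> /(eigA_berger N0) bf r; have [rL|rL] := leqP `|r| L; last first.
    by rewrite wcomp_out//; split=> [|g]; [exact: sm_cst|rewrite lie_cst mulr0].
  have -> : wcomp L r f = wproj L r f by apply/funext => g; rewrite /wcomp rL.
  split=> [|g]; first by have [] := berger_proj L r bf.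
  by rewrite (WD L (leq_addr _ _) f bf r rL) intC.
exists #|eigen_index N T lambda B|.
  by apply: (dirac_eigenspace_dim N0 T0 HL) => //; rewrite /L; lia.
rewrite card_eigen_index sum_mult// !natrD !EFinD.
rewrite -!(big_mkord xpredT).
congr (_ + _ + _ + _)%E.
- pose P (p : nat * int) := odd p.1 && (- p.1%:Z <= 2 * p.2 * N%:Z - 1 < - 1)%R.
  pose u (p : nat * int) := pair_mult N T lambda `|p.2| p.1.
  have uE p : P p -> u p =
    let s := Num.sqrt ((1 + p.1%:R) ^+ 2 + 4 * p.2%:~R ^+ 2 * N%:R ^+ 2 * ((T ^+ 2)^-1 - 1))%R in
    (mult_at lambda (- (T / 2) + s)%R p.1.+1 + mult_at lambda (- (T / 2) - s)%R p.1.+1)%N.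
    (* The condition 2mN - 1 < -1 means m < 0, so the index is minus its absolute value. *)
    case: p => n z /andP[/= podd /andP[h1 h2]]; have zE : z = - `|z|%N%:Z by nia.
    have -> : (1 + n%:R) ^+ 2 + 4 * z%:~R ^+ 2 * N%:R ^+ 2 * ((T ^+ 2)^-1 - 1) = radicand N T n `|z|.
      by rewrite /radicand {1}zE rmorphN sqrrN.
    rewrite /u /pair_mult /= podd (_ : (0 < `|z|)%N = true); last by lia.
    by rewrite (_ : (2 * N * `|z| < n)%N = true)//; nia.
  rewrite (@eq_esum _ _ _ _ (fun p => (u p)%:R%:E)); last first.
    move=> p [podd pP]; rewrite uE /=; last by rewrite /P podd.
    by rewrite !contribE natrD EFinD.
  rewrite (@esum_nat_seq _ _ _ P [seq (n, - m%:Z) | n <- index_iota 0 B, m <- index_iota 0 B]).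
  + congr (_%:R%:E); rewrite [in RHS]big_mkcond big_allpairs_dep /= [RHS]exchange_big /=.
    rewrite [RHS]big_mkord; apply: eq_bigr => m _; rewrite [RHS]big_mkord; apply: eq_bigr => n _.
    rewrite /u /= abszN absz_nat; case: ifP => // /negbT nP.
    rewrite /pair_mult; case: ifP => // /andP[/andP[nodd m0] mn]; case/negP: nP.
    by rewrite /P /= nodd /=; nia.
  + apply: allpairs_uniq; rewrite ?iota_uniq// => -[n m] [n' m'] _ _ /= [-> h].
    by congr (_, _); lia.
  + by move=> p; split=> [[podd pP]|/andP[]]; rewrite ?/P ?podd.
  + move=> [n z] Pp up; apply/allpairsP; exists (n, `|z|%N).
    have [] := condB _ _ (pair_mult_admissible N0 T0 up); rewrite !mem_index_iota /= => zB nB.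
    split=> //; congr (_, _); move: Pp => /andP[_ /andP[_ h2]]; rewrite /= in h2 *; nia.
- rewrite (@esum_nat_seq _ _ _ (fun n => n %% 4 == 1)%N (index_iota 0 B) (fun n => mult_at lambda (- (T / 2) + (n%:R + 1)) n.+1)) ?iota_uniq//.
  + by rewrite [in RHS]big_mkcond.
  + by move=> n; split=> [/eqP|/eqP].
  + move=> n n4 un; rewrite mem_index_iota; apply: (plus_mult_lt N0 T0 condB).
    by rewrite /plus_mult n4.
- rewrite (@esum_nat_seq _ _ _ (fun n => n %% 4 == 3)%N (index_iota 0 B) (fun n => mult_at lambda (- (T / 2) - (n%:R + 1)) n.+1)) ?iota_uniq//.
  + by rewrite [in RHS]big_mkcond.
  + by move=> n; split=> [/eqP|/eqP].
  + move=> n n4 un; rewrite mem_index_iota; apply: (minus_mult_lt N0 T0 condB).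
    by rewrite /minus_mult n4.
- rewrite (@esum_nat_seq _ _ _ xpredT (index_iota 0 B) (lowest_mult N T lambda)) ?iota_uniq//.
  by move=> m _ /(lowest_mult_admissible N0 T0)[_ /condB[]]; rewrite mem_index_iota.
Qed.
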